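(* Let $X$ be a closed infinite dimensional subspace of $V_2^0$, $f\in X^{**}\setminus X$ and $(f_n)_n$ be a bounded sequence in $X$ pointwise convergent to $f$. Then for every $0<\delta<\operatorname{dist}(f,X)$ and for every sequence $(\varepsilon_n)_n$ of positive real numbers there exists a convex block sequence $(h_n)_n$ of $(f_n)_n$ such that for all $n<m$ the following are satisfied. (i) $\delta<\|h_m-h_n\|_{V_2}\le 2M$, where $M=\sup_n\|f_n\|_{V_2}$. (ii) $\|h_m-h_n\|_\infty\le 2\|\widetilde{osc}_{[0,1]}f\|_\infty+\varepsilon_n\le 4\|f\|_\infty+\varepsilon_n$. (iii) For every $\mathcal{I}\in\mathcal{A}$, $v_2^2(h_m-h_n,\mathcal{I})\le 4\mu_f(\cup\mathcal{I})+32\|f\|_{V_2}\sqrt{\|\mu_f^d\|}+\varepsilon_n$. Moreover, given $k\in\mathbb{N}$ and an open subset $V$ of $[0,1]$ with $\mu_f(V)>\theta>0$, there exist $\mathcal{J}\in\mathcal{A}$ with $\cup\mathcal{J}\subseteq V$ and $l>k$ such that (iv) $v_2^2(h_l-h_k,\mathcal{J})>\theta$.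
   Context: For $f:[0,1]\to\mathbb{R}$ and a finite set $\mathcal{P}=\{t_0<\dots<t_p\}\subseteq[0,1]$ with $p\ge 1$, let $v_2(f,\mathcal{P})=\big(\sum_{i=0}^{p-1}(f(t_{i+1})-f(t_i))^2\big)^{1/2}$ and $\|\mathcal{P}\|_{\max}=\max_i (t_{i+1}-t_i)$. $V_2$ is the Banach space of all $f:[0,1]\to\mathbb{R}$ with $f(0)=0$ and $\|f\|_{V_2}=\sup_{\mathcal{P}}v_2(f,\mathcal{P})<\infty$. $V_2^0$ is the closed subspace of those $f\in V_2$ with $\lim_{\delta\to0}\sup\{v_2(f,\mathcal{P}):\|\mathcal{P}\|_{\max}<\delta\}=0$ (the square absolutely continuous functions). The bidual of $V_2^0$ is identified isometrically with $V_2$ (the weak$^*$ topology on bounded sets being pointwise convergence), and for a closed subspace $X\subseteq V_2^0$, $X^{**}$ is identified with the corresponding subspace of $V_2$ (the weak$^*$ closure of $X$), which consists exactly of the pointwise limits of bounded sequences in $X$. The distance is taken in $\|\cdot\|_{V_2}$. $\mathcal{A}$ is the set of all finite families of intervals of $[0,1]$ with pairwise disjoint interiors. For $\mathcal{I}=(I_i)_{i=1}^k\in\mathcal{A}$, where $I_i$ has endpoints $a_i,b_i$, $v_2(f,\mathcal{I})=(\sum_{i=1}^k(f(b_i)-f(a_i))^2)^{1/2}$, and $\cup\mathcal{I}=\bigcup_i I_i$. Measure $\mu_f$: for $f\in V_2$ and an interval $I\subseteq[0,1]$, let $\widetilde{\mu}_f(I)=\inf_{\delta>0}\sup\{v_2^2(f,\mathcal{P}):\mathcal{P}\subseteq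 I \text{ finite},\ \|\mathcal{P}\|_{\max}<\delta\}$. Then $\mu_f$ is the finite positive Borel measure on $[0,1]$ determined by $\mu_f[0,x]=\lim_{y\to x^+}\widetilde{\mu}_f[0,y]$ for $0\le x<1$ and $\mu_f[0,1]=\widetilde{\mu}_f[0,1]$; $\mu_f^d$ is its discrete (atomic) part, and $\|\nu\|=\nu[0,1]$ for positive $\nu$. $\widetilde{osc}_{[0,1]}f(t)=\inf\{\sup_{x\in V}|f(x)-f(t)|: V \text{ open neighbourhood of } t \text{ in } [0,1]\}$. A convex block sequence of $(f_n)_n$ is a sequence $h_n=\sum_{i\in F_n}r_if_i$ with $F_1<F_2<\dots$ successive finite subsets of $\mathbb{N}$, $r_i\ge0$ and $\sum_{i\in F_n}r_i=1$ for each $n$. *)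

(* Defs.v *)
(* A function f : [0,1] -> R is a term of type {i01 R} -> R. *)
From HB Require Import structures.
From mathcomp Require Export all_boot all_order all_algebra finmap.
From mathcomp Require Export all_classical all_reals all_analysis.

Set Implicit Arguments.
Unset Strict Implicit.
Unset Printing Implicit Defensive.

Export Order.TTheory GRing.Theory Num.Theory.
Export numFieldNormedType.Exports.

#[global] Open Scope classical_set_scope.
#[global] Open Scope ring_scope.

Section Variation.
Variable R : realType.
Implicit Types (f g : {i01 R} -> R) (t : nat -> {i01 R}).

Definition val01 (t : {i01 R}) : R := t%:num.
Definition zero01 : {i01 R} := 0%:i01.
Definition one01 : {i01 R} := 1%:i01.

(* The finite set {t 0 < ... < t p}; the values of t beyond p are irrelevant. *)
Definition subdivision (p : nat) t : Prop :=
  (0 < p)%N /\ forall i, (i < p)%N -> val01 (t i) < val01 (t i.+1).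

Definition mesh (p : nat) t : R :=
  \big[Num.max/0]_(i < p) (val01 (t i.+1) - val01 (t i)).

Definition v2 f (p : nat) t : R :=
  Num.sqrt (\sum_(i < p) (f (t i.+1) - f (t i)) ^+ 2).

Definition V2norm f : \bar R :=
  ereal_sup [set (v2 f P.1 P.2)%:E | P in [set P | subdivision P.1 P.2]].

Definition V2 : set ({i01 R} -> R) :=
  [set f | f zero01 = 0 /\ (V2norm f < +oo)%E].

Definition fine_variation f (delta : R) : \bar R :=
  ereal_sup [set (v2 f P.1 P.2)%:E |
    P in [set P | subdivision P.1 P.2 /\ mesh P.1 P.2 < delta]].

Definition V20 : set ({i01 R} -> R) :=
  [set f | V2 f /\ fine_variation f delta @[delta --> 0^'+] --> 0%E].

Definition closed_subspace (X : set ({i01 R} -> R)) : Prop :=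
  [/\ X `<=` V20, GRing.submod_closed (mem X) &
      forall f, V20 f ->
        (forall e : R, 0 < e -> exists2 g, X g & (V2norm (f - g)%R < e%:E)%E) ->
        X f].

Definition infinite_dimensional (X : set ({i01 R} -> R)) : Prop :=
  ~ exists (n : nat) (e : 'I_n -> {i01 R} -> R),
      (forall i, X (e i)) /\
      forall f, X f -> exists c : 'I_n -> R, f = \sum_(i < n) c i *: e i.

Definition pointwise_cvg (u : nat -> {i01 R} -> R) f : Prop :=
  forall x, u n x @[n --> \oo] --> f x.

Definition sup_V2norm (u : nat -> {i01 R} -> R) : \bar R :=
  ereal_sup (range (fun n => V2norm (u n))).

(* X^** as a subspace of V_2 = (V_2^0)^**: the weak* closure of X consists of the
   pointwise limits of bounded sequences in X. *)
Definition bidual (X : set ({i01 R} -> R)) : set ({i01 R} -> R) :=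
  [set f | V2 f /\ exists u : nat -> {i01 R} -> R,
     [/\ forall n, X (u n), (sup_V2norm u < +oo)%E & pointwise_cvg u f]].

Definition dist_V2 f (X : set ({i01 R} -> R)) : \bar R :=
  ereal_inf [set V2norm (f - g) | g in X].

(* The empty set is excluded by neitv, and an infinite bound of an interval of
   the ordered set [0,1] stands for the corresponding end of [0,1]. *)
Definition left_end (I : interval {i01 R}) : {i01 R} :=
  if I is Interval (BSide _ a) _ then a else zero01.

Definition right_end (I : interval {i01 R}) : {i01 R} :=
  if I is Interval _ (BSide _ b) then b else one01.

Definition interval_family (k : nat) (I : 'I_k -> interval {i01 R}) : Prop :=
  (forall i, neitv (I i)) /\
  trivIset setT (fun i => interior (val01 @` [set` I i])).

Definition v2_family f (k : nat) (I : 'I_k -> interval {i01 R}) : R :=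
  Num.sqrt (\sum_(i < k) (f (right_end (I i)) - f (left_end (I i))) ^+ 2).

Definition union_family (k : nat) (I : 'I_k -> interval {i01 R}) :
  set {i01 R} := \bigcup_i [set` I i].

Definition open01 (V : set {i01 R}) : Prop :=
  exists2 U : set R, open U & V = val01 @^-1` U.

Definition supnorm (g : {i01 R} -> \bar R) : \bar R :=
  ereal_sup (range (fun x => `|g x|%E)).

Definition osc f (t : {i01 R}) : \bar R :=
  ereal_inf [set ereal_sup [set `|f x - f t|%:E | x in V]
            | V in [set V | open01 V /\ V t]].

Definition convex_block (u h : nat -> {i01 R} -> R) : Prop :=
  exists (F : nat -> {fset nat}) (r : nat -> R),
    [/\ forall n i j, i \in F n -> j \in F n.+1 -> (i < j)%N,
        forall n i, i \in F n -> 0 <= r i,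
        forall n, \sum_(i <- F n) r i = 1 &
        forall n, h n = \sum_(i <- F n) r i *: u i].

End Variation.

Section Measure.
Variable R : realType.
Implicit Types (f : {i01 R} -> R) (t : nat -> {i01 R}).

Definition fine_sup f (I : set R) (delta : R) : \bar R :=
  ereal_sup [set ((v2 f P.1 P.2) ^+ 2)%:E | P in [set P |
    [/\ subdivision P.1 P.2,
        forall i, (i <= P.1)%N -> I (val01 (P.2 i)) &
        mesh P.1 P.2 < delta]]].

Definition mu_tilde f (I : set R) : \bar R :=
  ereal_inf [set fine_sup f I delta | delta in [set delta | 0 < delta]].

(* The distribution function x |-> mu_f [0, x], extended by 0 to the left of 0
   and by mu_f [0, 1] to the right of 1; by convention it is the zero
   function when V2norm f is infinite. *)
Definition mu_cdf f (x : R) : R :=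
  if (V2norm f < +oo)%E then
    if x < 0 then 0
    else if x < 1 then fine (lim (mu_tilde f `[0, y] @[y --> x^'+]))
    else fine (mu_tilde f `[0, 1])
  else 0.

Lemma val01_ge0 (t : {i01 R}) : 0 <= val01 t.
Proof. by rewrite /val01. Qed.

Lemma val01_le1 (t : {i01 R}) : val01 t <= 1.
Proof. by rewrite /val01. Qed.

Lemma mu_tilde_le f (I J : set R) : I `<=` J ->
  (mu_tilde f I <= mu_tilde f J)%E.
Proof.
move=> IJ; apply: le_ereal_inf_tmp => _ [d d0 <-].
apply: (@le_trans _ _ (fine_sup f I d)).
  by apply: ereal_inf_lbound; exists d.
apply: ge_ereal_sup => _ [P [P1 P2 P3] <-].
by apply: ereal_sup_ubound; exists P => //; split => // i /P2 /IJ.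
Qed.

Lemma mu_tilde_ge0 f (y : R) : 0 < y -> (0 <= mu_tilde f `[0%R, y])%E.
Proof.
move=> y0; apply: le_ereal_inf_tmp => _ [d /= d0 <-].
pose z : R := Num.min y (Num.min 1 (d / 2)).
have z0 : 0 < z by rewrite !lt_min y0 ltr01 divr_gt0.
have z1 : z <= 1 by rewrite !ge_min lexx orbT.
have zy : z <= y by rewrite !ge_min lexx.
have zd : z < d.
  apply: (@le_lt_trans _ _ (d / 2)); first by rewrite !ge_min lexx !orbT.
  by rewrite ltr_pdivrMr// ltr_pMr// ltr1n.
pose t (i : nat) : {i01 R} := if i is 0%N then zero01 R else Itv01 (ltW z0) z1.
apply: (@le_trans _ _ ((v2 f 1 t) ^+ 2)%:E); first by rewrite lee_fin sqr_ge0.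
apply: ereal_sup_ubound; exists (1%N, t) => //=; split.
- by split=> // -[].
- by move=> [|[]]//= _; rewrite in_itv/= ?lexx ?(ltW y0)// (ltW z0).
- by rewrite /mesh/= big_ord_recl big_ord0/= /val01/= subr0 gt_max d0 zd.
Qed.

Lemma mu_tilde_fin f (y : R) : (V2norm f < +oo)%E -> 0 < y ->
  mu_tilde f `[0, y] \is a fin_num.
Proof.
move=> fV y0; rewrite ge0_fin_numE ?mu_tilde_ge0//.
have N0 : (0 <= V2norm f)%E.
  pose t (i : nat) : {i01 R} := if i is 0%N then zero01 R else one01 R.
  apply: (@le_trans _ _ (v2 f 1 t)%:E); first by rewrite lee_fin sqrtr_ge0.
  apply: ereal_sup_ubound; exists (1%N, t) => //=.
  by split=> // -[]//= _; rewrite /val01/=.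
have Nfin : V2norm f \is a fin_num by rewrite ge0_fin_numE.
apply: (@le_lt_trans _ _ ((fine (V2norm f)) ^+ 2)%:E); last exact: ltry.
apply: (@le_trans _ _ (fine_sup f `[0, y] 1)).
  by apply: ereal_inf_lbound; exists 1 => //=.
apply: ge_ereal_sup => _ [P [P1 _ _] <-].
rewrite lee_fin ler_pXn2r// ?nnegrE ?sqrtr_ge0 ?fine_ge0//.
by rewrite -lee_fin fineK//; apply: ereal_sup_ubound; exists P.
Qed.

Lemma le_mu_tilde f (x y : R) : x <= y ->
  (mu_tilde f `[0%R, x] <= mu_tilde f `[0%R, y])%E.
Proof.
by move=> xy; apply: mu_tilde_le => z /=; rewrite !in_itv/= => /andP[-> /le_trans->].
Qed.

Lemma mu_tilde_cvg f (x : R) : x < 1 ->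
  mu_tilde f `[0, y] @[y --> x^'+] -->
    ereal_inf [set mu_tilde f `[0, y] | y in `]x, 1%R[].
Proof.
move=> x1.
apply: (@nondecreasing_at_right_cvge _ (fun y => mu_tilde f `[0, y]) x (BLeft 1)).
  by rewrite bnd_simp.
by move=> y z _ _; exact: le_mu_tilde.
Qed.

Lemma mu_cdf_lt0 f x : x < 0 -> mu_cdf f x = 0.
Proof. by rewrite /mu_cdf => ->; case: ifP. Qed.

Lemma mu_cdf_ge1 f x : (V2norm f < +oo)%E -> 1 <= x ->
  mu_cdf f x = fine (mu_tilde f `[0, 1]).
Proof.
move=> fV x1; rewrite /mu_cdf fV !ltNge x1/=.
by rewrite (le_trans ler01 x1).
Qed.

Lemma mu_cdfE f x : (V2norm f < +oo)%E -> 0 <= x -> x < 1 ->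
  ((mu_cdf f x)%:E = ereal_inf [set mu_tilde f `[0%R, y] | y in `]x, 1%R[])%E.
Proof.
move=> fV x0 x1; rewrite /mu_cdf fV ltNge x0/= x1.
have -> := cvg_lim (@ereal_hausdorff _) (mu_tilde_cvg (f := f) x1).
rewrite fineK// ge0_fin_numE; last first.
  apply: le_ereal_inf_tmp => w [y /=]; rewrite in_itv/= => /andP[xy _] <-.
  by apply: mu_tilde_ge0; rewrite (le_lt_trans x0).
have [z /andP[xz z1]] : exists z, x < z < 1.
  by exists ((x + 1) / 2); rewrite !midf_lt.
apply: (@le_lt_trans _ _ (mu_tilde f `[0, z])).
  by apply: ereal_inf_lbound; exists z => //=; rewrite in_itv/= xz.
by rewrite ltey_eq mu_tilde_fin// (le_lt_trans x0).
Qed.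

Lemma mu_cdf_le_tilde f x y : (V2norm f < +oo)%E -> 0 < y -> x < y ->
  mu_cdf f x <= fine (mu_tilde f `[0, y]).
Proof.
move=> fV y0 xy.
have [x0|x0] := ltP x 0; first by rewrite mu_cdf_lt0// fine_ge0// mu_tilde_ge0.
have [x1|x1] := ltP x 1; last first.
  rewrite mu_cdf_ge1//; apply: fine_le; rewrite ?mu_tilde_fin//.
  by rewrite le_mu_tilde// (le_trans x1)// ltW.
rewrite -lee_fin mu_cdfE// fineK ?mu_tilde_fin//.
pose z := Num.min y ((x + 1) / 2).
have xz : x < z by rewrite lt_min xy midf_lt.
have z1 : z < 1 by rewrite gt_min midf_lt// orbT.
apply: (@le_trans _ _ (mu_tilde f `[0, z])).
  by apply: ereal_inf_lbound; exists z => //=; rewrite in_itv/= xz.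
by rewrite le_mu_tilde// ge_min lexx.
Qed.

Lemma mu_cdf_nondecreasing f : nondecreasing (mu_cdf f).
Proof.
move=> x y; rewrite le_eqVlt => /predU1P[->//|xy].
have [fV|] := boolP (V2norm f < +oo)%E; last first.
  by move=> /negbTE fV; rewrite /mu_cdf fV.
have [y0|y0] := ltP y 0.
  by rewrite !mu_cdf_lt0// (lt_trans xy).
have [y1|y1] := ltP y 1; last first.
  rewrite (mu_cdf_ge1 fV y1).
  have [x1|x1] := ltP x 1; first exact: mu_cdf_le_tilde.
  by rewrite mu_cdf_ge1.
rewrite -[leRHS]/(fine (mu_cdf f y)%:E) mu_cdfE// -lee_fin fineK; last first.
  by rewrite -mu_cdfE.
apply: le_ereal_inf_tmp => w [z /=]; rewrite in_itv/= => /andP[yz _] <-.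
have z0 : 0 < z by apply: le_lt_trans yz.
rewrite -(fineK (mu_tilde_fin fV z0)) lee_fin mu_cdf_le_tilde//.
exact: lt_trans yz.
Qed.

Lemma mu_cdf_right_continuous f (x : R) :
  mu_cdf f @ at_right x --> mu_cdf f x.
Proof.
have [fV|] := boolP (V2norm f < +oo)%E; last first.
  move=> /negbTE fV.
  by rewrite (_ : mu_cdf f = cst 0); [exact: cvg_cst|apply/funext => y; rewrite /mu_cdf fV].
apply/cvgrPdist_le => /= e e0.
suff [z xz Hz] : exists2 z, x < z & mu_cdf f z <= mu_cdf f x + e.
  near=> y.
  have xy : x <= y by apply: ltW; near: y; exact: nbhs_right_gt.
  have yz : y <= z by apply: ltW; near: y; exact: nbhs_right_lt.
  rewrite distrC ger0_norm ?subr_ge0 ?mu_cdf_nondecreasing// lerBlDl.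
  by apply: le_trans Hz; exact: mu_cdf_nondecreasing.
have [x0|x0] := ltP x 0.
  exists (x / 2); first by rewrite ltr_pdivlMr// mulr_natr mulr2n gtrDl.
  by rewrite !mu_cdf_lt0 ?add0r ?ltW// pmulr_llt0.
have [x1|x1] := ltP x 1; last first.
  exists (x + 1); first by rewrite ltrDl.
  have y1 : 1 <= x + 1 by rewrite (le_trans x1)// lerDl.
  by rewrite (mu_cdf_ge1 fV x1) (mu_cdf_ge1 fV y1) lerDl ltW.
have : (ereal_inf [set mu_tilde f `[0%R, y] | y in `]x, 1%R[]
        < (mu_cdf f x + e)%:E)%E by rewrite -mu_cdfE// lte_fin ltrDl.
move=> /ereal_inf_lt[w [y /=]]; rewrite in_itv/= => /andP[xy _] <- ye.
have y0 : 0 < y by exact: le_lt_trans xy.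
exists ((x + y) / 2); first by rewrite midf_lt.
rewrite -lee_fin (le_trans _ (ltW ye))//.
rewrite -(fineK (mu_tilde_fin fV y0)) lee_fin mu_cdf_le_tilde//.
by rewrite midf_lt.
Unshelve. all: end_near. Qed.

HB.instance Definition _ f := @isCumulative.Build R _ R (mu_cdf f)
  (@mu_cdf_nondecreasing f) (@mu_cdf_right_continuous f).

(* mu_f as a Borel measure on R concentrated on [0,1]; mu_itvE below states that
   it satisfies the conditions which determine mu_f. *)
Definition mu f : set (measurableTypeR R) -> \bar R :=
  lebesgue_stieltjes_measure (mu_cdf f).
HB.instance Definition _ f := Measure.on (mu f).

Lemma mu_oc f (a b : R) : a <= b ->
  mu f `]a, b]%classic = (mu_cdf f b - mu_cdf f a)%:E.
Proof.
move=> ab; rewrite /mu/= /lebesgue_stieltjes_measure/= /measure_extension/=.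
rewrite measurable_mu_extE/=; last exact: is_ocitv.
by rewrite wlength_itv_bnd.
Qed.

Lemma mu_lt0 f : mu f `]-oo, 0[%classic = 0%E.
Proof.
have H : (mu f).-negligible (\bigcup_n `](- n.+1%:R : R), (- n.+1%:R^-1)]%classic).
  apply: negligible_bigcup => n; apply/negligibleP; first exact: measurable_itv.
  rewrite [LHS]mu_oc; last by rewrite lerN2 (@le_trans _ _ 1)// ?invf_le1 ?ler1n.
  by rewrite !mu_cdf_lt0 ?subrr// oppr_lt0 ?invr_gt0.
apply/negligibleP; first exact: measurable_itv.
apply: negligibleS H => x /=; rewrite in_itv/= => x0.
have Nx0 : 0 < - x by rewrite oppr_gt0.
pose m := maxn (Num.bound (- x)) (Num.bound (- x)^-1).
exists m => //=; rewrite in_itv/=; apply/andP; split.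
- rewrite ltrNl (lt_le_trans (archi_boundP (ltW Nx0)))// ler_nat.
  by rewrite (leq_trans (leq_maxl _ _) (leqnSn _)).
- rewrite lerNr -[leRHS]invrK lef_pV2 ?posrE ?invr_gt0//.
  have := @archi_boundP _ ((- x)^-1); rewrite invr_ge0 => /(_ (ltW Nx0)).
  move=> /ltW/le_trans; apply; rewrite ler_nat.
  by rewrite (leq_trans (leq_maxr _ _) (leqnSn _)).
Qed.

Lemma mu_gt1 f : mu f `]1, +oo[%classic = 0%E.
Proof.
have H : (mu f).-negligible (\bigcup_n `](1 : R), n.+1%:R]%classic).
  apply: negligible_bigcup => n; apply/negligibleP; first exact: measurable_itv.
  rewrite [LHS]mu_oc ?ler1n//.
  have [fV|/negbTE fV] := boolP (V2norm f < +oo)%E.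
    by rewrite !mu_cdf_ge1 ?ler1n ?subrr.
  by rewrite /mu_cdf fV subrr.
apply/negligibleP; first exact: measurable_itv.
apply: negligibleS H => x /=; rewrite !in_itv/= andbT => x1.
exists (Num.bound x) => //=; rewrite in_itv/= x1/=.
have x0 : 0 <= x by rewrite (le_trans ler01)// ltW.
by rewrite (le_trans (ltW (archi_boundP x0)))// ler_nat.
Qed.

Lemma mu_cc f (x : R) : 0 <= x ->
  mu f `[0, x]%classic = (mu_cdf f x)%:E.
Proof.
move=> x0.
have <- : mu f `]-1, x]%classic = (mu_cdf f x)%:E.
  have N : -1 < 0 :> R by rewrite oppr_lt0.
  by rewrite mu_oc ?(mu_cdf_lt0 f N) ?subr0// (le_trans _ x0)// ltW.
have -> : `]-1, x]%classic = `]-1, 0[%classic `|` `[0, x]%classic :> set R.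
  rewrite -itv_bndbnd_setU// ?bnd_simp ?x0//.
have Z : mu f `]-1, 0[%classic = 0%E.
  apply/eqP; rewrite eq_le measure_ge0 andbT -(mu_lt0 f).
  apply: le_measure; rewrite ?inE; try exact: measurable_itv.
  by move=> y /=; rewrite !in_itv/= => /andP[].
apply: esym; rewrite -[RHS]add0e -[in RHS]Z; apply: measureU; try exact: measurable_itv.
apply/seteqP; split=> // y [/=]; rewrite !in_itv/= => /andP[_ y0] /andP[].
by rewrite leNgt y0.
Qed.

Lemma mu_itvE f : (V2norm f < +oo)%E ->
  [/\ (forall x : R, 0 <= x < 1 ->
        mu_tilde f `[0, y] @[y --> x^'+] --> mu f `[0, x]%classic),
      mu f `[0, 1]%classic = mu_tilde f `[0, 1],
      mu f (~` `[0, 1]%classic) = 0%E & (mu f setT < +oo)%E].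
Proof.
move=> fV.
have C0 : mu f (~` `[0, 1]%classic) = 0%E.
  have -> : ~` `[0, 1]%classic = `]-oo, 0[%classic `|` `]1, +oo[%classic :> set R.
    by rewrite setCitv.
  apply/negligibleP; first by apply: measurableU; exact: measurable_itv.
  apply: negligibleU; apply/negligibleP; try exact: measurable_itv.
    exact: mu_lt0.
  exact: mu_gt1.
have E1 : mu f `[0, 1]%classic = mu_tilde f `[0, 1].
  by rewrite mu_cc// mu_cdf_ge1// fineK// mu_tilde_fin.
split=> //.
- move=> x /andP[x0 x1]; rewrite mu_cc// mu_cdfE//.
  exact: mu_tilde_cvg.
- suff -> : mu f setT = mu f `[0, 1]%classic by rewrite E1 ltey_eq mu_tilde_fin.
  rewrite -[RHS]add0e -[in RHS]C0 -[in LHS](setvU `[0, 1]%classic).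
  apply: measureU; first by apply: measurableC; exact: measurable_itv.
    exact: measurable_itv.
  by rewrite setICl.
Qed.

Definition mu01 f (A : set {i01 R}) : \bar R := mu f (@val01 R @` A).

Definition mu_discrete f (A : set {i01 R}) : \bar R :=
  (\esum_(t in A) mu01 f [set t])%E.

End Measure.

(* Main.v *)
Require Import Defs.
From mathcomp Require Import measurable_realfun.
From mathcomp Require Import ring lra zify.

(** A function f on the unit interval is handled through its extension [ext f], which is
    constant on both sides, and a family of intervals through a chain, a list of
    intervals in increasing order; [qsum F s] is the sum of the squared increments of F
    over the chain s. Two facts carry the proof.

    The first one is a form of Mazur's lemma, [comb_small_variation]: a bounded sequence
    of V_2^0 that tends to 0 pointwise has convex combinations, with indices as large as
    one likes, that are small in norm. Since the quadratic variations are bounded, the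
    functions can only stay large near finitely many points; along a subsequence the
    peaks are disjoint, and averages of such functions are uniformly small
    ([small_average]). Once the functions tend to 0 uniformly, a sparse subsequence has
    the property that every interval is seen by at most one of its terms: a square
    absolutely continuous function does not vary on intervals that are too short for
    it, and the later terms are too small to vary on the other ones. The average of M
    such terms has a squared variation of order 1 / M ([average_small_variation]).

    The second one is an explicit sequence k_n of Lipschitz functions, bounded in V_2 and
    pointwise convergent to f, whose differences satisfy (ii) and (iii)
    ([approximating_sequence]). The function k_n interpolates f linearly along a partition
    Q_n, which is fine, contains Q_{n-1}, and along which the squared variation of f
    exceeds the mass D of the discrete part of mu_f by little. Such partitions exist
    ([small_partition]): between the large jumps, inserting points where f takes
    intermediate values divides the squared variation by any given factor, up to a small
    error. For i < j the increment of k_j - k_i over an interval is the sum of increments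
    of k_i and k_j inside cells, which contribute a multiple of D, and of two increments
    of f over short intervals ([split_chain]). By the very construction of mu_f the squares of
      the latter
    add up to at most the mass of the intervals ([upper_chain]); having two of them
    explains the factor 4. Finally D is at most the norm of f times the square root of D.

    Mazur's lemma for u_n - k_n provides convex blocks h_n of u that are close in norm to
    the same convex combinations of the k_n; the estimates (ii) and (iii) are stable under
    convex combinations, hence pass to the h_n. The lower bound in (i) holds along a
    subsequence, because the norm is lower semicontinuous for pointwise convergence and
    f is at distance more than delta from each h_n. For (iv), a fine chain inside V along
    which f has a squared variation larger than theta exists by [open_chain]; if it is
    fine enough, h_k does not vary along it, and h_l tends to f pointwise. *)

Set Implicit Arguments.
Unset Strict Implicit.
Unset Printing Implicit Defensive.

(** * Chains of intervals *)

Section Chains.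
Variable R : realType.
Implicit Types (F G : R -> R) (s : seq (R * R)) (l : seq R) (x y z d : R).

(** Degenerate intervals are allowed, so that chains are stable under clipping and
    cutting. *)
Fixpoint chain x y s : bool :=
  if s is J :: s' then [&& x <= J.1, J.1 <= J.2 & chain J.2 y s'] else x <= y.

Definition qsum F s : R := \sum_(I <- s) (F I.2 - F I.1) ^+ 2.

Definition short d s : bool := all (fun I => I.2 - I.1 < d) s.

Definition cov s : set R := [set x | has (fun I => I.1 <= x <= I.2) s].

Definition steps x l : seq (R * R) := zip (x :: l) l.

Definition step d : rel R := fun u v => (u <= v) && (v < u + d).

Lemma chain_le x y s : chain x y s -> x <= y.
Proof.
elim: s x => [//|I s IH] x /= /and3P[xI I12 /IH]; lra.
Qed.

Lemma chain_weaken x' y' x y s : x' <= x -> y <= y' -> chain x y s -> chain x' y' s.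
Proof.
move=> xx yy; elim: s x x' xx => [|I s IH] x x' xx /=; first lra.
case/and3P=> xI -> /(IH _ _ (lexx _)) ->; rewrite !andbT; lra.
Qed.

Lemma chain_cat y x z s1 s2 : chain x y s1 -> chain y z s2 -> chain x z (s1 ++ s2).
Proof.
elim: s1 x => [|I s IH] x /=; first by move=> xy; exact: chain_weaken.
by case/and3P=> -> -> /IH h /h ->.
Qed.

Lemma chain_filter (p : pred (R * R)) x y s : chain x y s -> chain x y [seq I <- s | p I].
Proof.
elim: s x => [//|I s IH] x /= /and3P[xI I12 /IH h].
case: (p I) => /=; first by rewrite xI I12.
by apply: chain_weaken h => //; exact: le_trans I12.
Qed.

Lemma chain_mem x y s I : chain x y s -> I \in s -> [/\ x <= I.1, I.1 <= I.2 & I.2 <= y].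
Proof.
elim: s x => [//|J s IH] x /= /and3P[xJ J12 c]; rewrite inE => /orP[/eqP->|Is].
  by split => //; exact: chain_le c.
have [h1 h2 h3] := IH _ c Is; split => //; lra.
Qed.

Lemma chain_sub a b x y s : chain x y s -> a <= b ->
  {in s, forall I, a <= I.1 /\ I.2 <= b} -> chain a b s.
Proof.
elim: s x a => [//|I s IH] x a /= /and3P[xI I12 c] ab h.
have [aI Ib] := h I (mem_head _ _).
rewrite aI I12 /=; apply: (IH _ _ c Ib) => J Js; split; last first.
  by have [] := h J; rewrite ?inE ?Js ?orbT.
by have [] := chain_mem c Js.
Qed.

Lemma chain_homo (h : R -> R) x y s : {homo h : u v / u <= v} -> chain x y s ->
  chain (h x) (h y) (map (fun I => (h I.1, h I.2)) s).
Proof.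
move=> hh; elim: s x => [|I s IH] x /=; first exact: hh.
by case/and3P=> /hh-> /hh-> /IH ->.
Qed.

Lemma chain_length x y d s : 0 < d -> chain x y s ->
  all (fun I => d <= I.2 - I.1) s -> (size s)%:R * d <= y - x.
Proof.
move=> d0; elim: s x => [|I s IH] x /=; first by rewrite mul0r; lra.
move=> /and3P[xI I12 /IH h] /andP[dI /h]; rewrite -natr1 mulrDl; lra.
Qed.

Lemma short_cat d s1 s2 : short d (s1 ++ s2) = short d s1 && short d s2.
Proof. exact: all_cat. Qed.

Lemma short_le d' d s : d' <= d -> short d' s -> short d s.
Proof. by move=> dd; apply: sub_all => I /=; lra. Qed.

Lemma short_filter d (p : pred (R * R)) s : short d s -> short d [seq I <- s | p I].
Proof. by move=> h; rewrite /short all_filter; apply: sub_all h => I /= ->; rewrite implybT.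
  Qed.

Lemma qsum_nil F : qsum F [::] = 0. Proof. exact: big_nil. Qed.

Lemma qsum_cons F I s : qsum F (I :: s) = (F I.2 - F I.1) ^+ 2 + qsum F s.
Proof. exact: big_cons. Qed.

Lemma qsum_cat F s1 s2 : qsum F (s1 ++ s2) = qsum F s1 + qsum F s2.
Proof. exact: big_cat. Qed.

Lemma qsum_ge0 F s : 0 <= qsum F s.
Proof. by apply: sumr_ge0 => I _; exact: sqr_ge0. Qed.

Lemma qsum_filterC F (p : pred (R * R)) s :
  qsum F s = qsum F [seq I <- s | p I] + qsum F [seq I <- s | ~~ p I].
Proof. by rewrite /qsum !big_filter (bigID p). Qed.

Lemma cov_cons I s : cov (I :: s) = [set x | I.1 <= x <= I.2] `|` cov s.
Proof.
apply/seteqP; split => x; rewrite /cov /=.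
  by case/orP; [left|right].
by case=> h; apply/orP; [left|right].
Qed.

Lemma covP s x : cov s x <-> exists2 I, I \in s & I.1 <= x <= I.2.
Proof. by split => [/hasP//|h]; apply/hasP. Qed.

Lemma path_step_le d x l : path (step d) x l -> x <= last x l.
Proof.
by elim: l x => //= y l IH x /andP[/andP[xy _] /IH]; exact: le_trans.
Qed.

Lemma grid d x y : 0 < d -> x <= y -> exists l, path (step d) x l /\ last x l = y.
Proof.
move=> d0 xy.
have [n hn] : exists n : nat, y - x < n%:R * (d / 2).
  exists (Num.bound ((y - x) / (d / 2))).
  rewrite -ltr_pdivrMr; last lra.
  by apply: archi_boundP; apply: divr_ge0; lra.
elim: n x xy hn => [|n IH] x xy hn; first by rewrite mul0r in hn; exfalso; lra.
have [h|h] := leP y (x + d / 2).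
  by exists [:: y]; rewrite /= /step xy andbT /=; split => //; lra.
have [||l [pl ll]] := IH (x + d / 2); first lra.
  by move: hn; rewrite -natr1 mulrDl; lra.
exists (x + d / 2 :: l); rewrite /= pl ll /step; split => //; lra.
Qed.

Lemma steps_cat x l1 l2 : steps x (l1 ++ l2) = steps x l1 ++ steps (last x l1) l2.
Proof. by elim: l1 x => //= y l IH x; rewrite /steps /= -!/(steps _ _) IH. Qed.

(** Filling the gaps with a grid only adds squares. *)
Lemma fill_gaps d x y s : 0 < d -> chain x y s -> short d s ->
  exists l, [/\ path (step d) x l, last x l = y &
    forall F, qsum F s <= qsum F (steps x l)].
Proof.
move=> d0; elim: s x => [|I s IH] x /=.
  move=> /(grid d0) [l [pl ll]] _; exists l; split => // F; rewrite qsum_nil; exact: qsum_ge0.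
case/and3P=> /(grid d0)[l1 [p1 e1]] I12 /IH h /andP[sI /h[l2 [p2 e2 q2]]].
exists (l1 ++ I.2 :: l2); split.
- rewrite cat_path p1 e1 /= p2 /step I12 /= andbT; lra.
- by rewrite last_cat.
- move=> F; rewrite steps_cat qsum_cat e1 [steps _ (_ :: _)]/= /steps /= -/(steps _ _).
  by rewrite !qsum_cons; have := q2 F; have := qsum_ge0 F (steps x l1); rewrite /=; lra.
Qed.

Lemma step_strict d x l : path (step d) x l ->
  exists l', [/\ path (fun u v => (u < v) && (v < u + d)) x l', last x l' = last x l,
    {subset l' <= l} & forall F, qsum F (steps x l') = qsum F (steps x l)].
Proof.
elim: l x => [|y l IH] x /=; first by exists [::].
case/andP=> /andP[]; rewrite le_eqVlt => /orP[/eqP<-|xy] yd /IH [l' [p e sub q]].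
  exists l'; split => // [z /sub zl|F]; first by rewrite inE zl orbT.
  by rewrite q /steps /= qsum_cons subrr expr0n add0r.
exists (y :: l'); split => //=; first by rewrite xy yd.
  by move=> z; rewrite !inE => /orP[->//|/sub ->]; rewrite orbT.
by move=> F; rewrite /steps /= !qsum_cons -!/(steps _ _) q.
Qed.

Lemma qsum_steps F x l : qsum F (steps x l) =
  \sum_(i < size l) (F (nth x (x :: l) i.+1) - F (nth x (x :: l) i)) ^+ 2.
Proof.
elim: l x => [|y l IH] x; first by rewrite big_ord0 qsum_nil.
rewrite /steps /= qsum_cons -/(steps _ _) big_ord_recl IH /=; congr (_ + _).
apply: eq_bigr => i _; rewrite (set_nth_default x y) ?(set_nth_default x y (s := y :: l)) //=.
by rewrite ltnS ltnW.
Qed.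

Definition nonover (I J : R * R) : bool := (I.2 <= J.1) || (J.2 <= I.1).

(** Discarding the degenerate intervals makes the left ends distinct, so that
    sorting by left ends puts the intervals one after the other. *)
Lemma sort_family x y s : x <= y ->
  {in s, forall I, [/\ x <= I.1, I.1 <= I.2 & I.2 <= y]} ->
  pairwise nonover s ->
  exists s', [/\ chain x y s', {subset s' <= s}, {in s', forall I, I.1 < I.2} &
    forall F, qsum F s' = qsum F s].
Proof.
move=> xy hs ps; pose s0 := [seq I : R * R <- s | I.1 < I.2].
pose r := fun I J : R * R => I.1 <= J.1.
have rt : total r by move=> I J; exact: le_total.
have ss0 : {subset sort r s0 <= s}.
  by move=> I; rewrite mem_sort mem_filter => /andP[].
have lt0 : {in sort r s0, forall I, I.1 < I.2}.
  by move=> I; rewrite mem_sort mem_filter => /andP[].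
have q0 F : qsum F (sort r s0) = qsum F s.
  rewrite /qsum (perm_big s0) /=; last by rewrite perm_sort.
  rewrite big_filter [RHS](bigID (fun I : R * R => I.1 < I.2)) /= [X in _ + X]big1_seq ?addr0//.
  move=> I /andP[nI /hs [_ h _]]; have -> : I.1 = I.2 by apply/eqP; rewrite eq_le h leNgt nI.
  by rewrite subrr expr0n.
exists (sort r s0); split => //.
have [u0 p0] : uniq (sort r s0) /\ {in sort r s0 &, forall I J, I != J -> nonover I J}.
  have := subseq_pairwise (filter_subseq (fun I : R * R => I.1 < I.2) s) ps.
  rewrite -/s0 => p0; have a0 : all (fun I : R * R => I.1 < I.2) s0 by exact: filter_all.
  rewrite sort_uniq uniq_pairwise; split.
    apply: (sub_in_pairwise (P := fun I : R * R => I.1 < I.2) _ a0 p0) => I J /= hI hJ.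
    by apply: contraL => /eqP ->; rewrite /nonover orbb -ltNge.
  have : pairwise (fun I J => (I == J) || nonover I J) s0.
    by apply: sub_pairwise p0 => I J /= ->; rewrite orbT.
  rewrite pairwise_all2rel; first last.
  - by move=> I J; rewrite eq_sym /nonover [in RHS]orbC [X in _ || X]orbC [RHS]orbC.
  - by move=> I /=; rewrite eqxx.
  move=> /allrelP h I J; rewrite !mem_sort => Is Js /negbTE nIJ.
  by have := h I J Is Js; rewrite nIJ.
have so : sorted r (sort r s0) by apply: sort_sorted.
move: (sort r s0) ss0 lt0 u0 p0 so {q0} => t st ltt ut pt so.
have hx : all (fun I : R * R => x <= I.1) t by apply/allP => I /st /hs [].
have {st}hy : {in t, forall I, I.2 <= y} by move=> I /st /hs [].
elim: t x xy hx hy ltt ut pt so {hs} => [//|I t IH] x xy /= /andP[xI hx] hy ltt /andP[nI ut] pt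
  so.
have I12 : I.1 < I.2 by apply: ltt; rewrite mem_head.
rewrite xI (ltW I12) /=; apply: IH => //.
- by apply: hy; rewrite mem_head.
- have tr : transitive r by move=> a b c; exact: le_trans.
  move: so; rewrite (path_sortedE tr) => /andP[/allP aI _].
  apply/allP => J Jt; have IJ : I != J by apply: contraNneq nI => ->.
  have := pt I J; rewrite mem_head inE Jt orbT => /(_ isT isT IJ) /orP[//|].
  have := aI _ Jt; have : J.1 < J.2 by apply: ltt; rewrite inE Jt orbT.
  rewrite /r; lra.
- by move=> J Jt; apply: hy; rewrite inE Jt orbT.
- by move=> J Jt; apply: ltt; rewrite inE Jt orbT.
- by move=> J K Jt Kt; apply: pt; rewrite inE ?Jt ?Kt orbT.
- exact: path_sorted so.
Qed.

End Chains.

(** * Functions on the line and the norm of V_2 *)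

Section Clip.
Variable R : realType.
Implicit Types (F G : R -> R) (s : seq (R * R)) (l : seq R) (x y z d : R) (f : {i01 R} -> R).

(** A function on the unit interval is handled through its extension which is
    constant on both sides; clipping a chain shortens its intervals and leaves the
    sum of squares of such an extension unchanged. *)
Definition clip x : R := Num.max 0 (Num.min 1 x).

Lemma clip_ge0 x : 0 <= clip x. Proof. by rewrite le_max lexx. Qed.
Lemma clip_le1 x : clip x <= 1.
Proof. by rewrite ge_max ler01 ge_min lexx. Qed.

Definition clip01 x : {i01 R} := Itv01 (clip_ge0 x) (clip_le1 x).

Definition ext f : R -> R := fun x => f (clip01 x).

Lemma clip_id x : 0 <= x -> x <= 1 -> clip x = x.
Proof. by move=> x0 x1; rewrite /clip min_r// max_r. Qed.

Lemma clip_homo : {homo clip : u v / u <= v}.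
Proof. by move=> u v uv; rewrite /clip; case: (leP 1 u); case: (leP 1 v); rewrite /Num.max; do
  ?case: ifP; lra. Qed.

Lemma clip_contract x y : x <= y -> clip y - clip x <= y - x.
Proof. by move=> uv; rewrite /clip; case: (leP 1 x); case: (leP 1 y); rewrite /Num.max; do
  ?case: ifP; lra. Qed.

Lemma val01_clip x : val01 (clip01 x) = clip x. Proof. by []. Qed.

Lemma clip01_val (t : {i01 R}) : clip01 (val01 t) = t.
Proof. by apply/val_inj; rewrite /= clip_id ?val01_ge0 ?val01_le1. Qed.

Lemma ext_val f t : ext f (val01 t) = f t.
Proof. by rewrite /ext clip01_val. Qed.

Lemma clipK x : clip (clip x) = clip x.
Proof. by rewrite clip_id ?clip_ge0 ?clip_le1. Qed.

Definition clipped F := forall x, F (clip x) = F x.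

Lemma ext_clip f : clipped (ext f).
Proof. by move=> x; rewrite /ext; congr f; apply/val_inj; rewrite /= clipK. Qed.

Lemma clip_chain x y s : chain x y s -> exists s', [/\ chain 0 1 s',
  (forall d, short d s -> short d s') & forall F, clipped F -> qsum F s' = qsum F s].
Proof.
move=> c; exists (map (fun I => (clip I.1, clip I.2)) s); split.
- by apply: chain_weaken (chain_homo clip_homo c); rewrite ?clip_ge0 ?clip_le1.
- move=> d h; rewrite /short all_map; apply/allP => I Is /=.
  have [_ h1 _] := chain_mem c Is.
  exact: le_lt_trans (clip_contract h1) (allP h _ Is).
- by move=> F cF; rewrite /qsum big_map; apply: eq_bigr => I _ /=; rewrite !cF.
Qed.

Lemma mesh_lt (p : nat) (t : nat -> {i01 R}) d : 0 < d ->
  (forall i, (i < p)%N -> val01 (t i.+1) - val01 (t i) < d) -> mesh p t < d.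
Proof. by move=> d0 h; apply: bigmax_lt => // i _; exact: h. Qed.

Lemma lt_mesh (p : nat) (t : nat -> {i01 R}) d : mesh p t < d ->
  forall i, (i < p)%N -> val01 (t i.+1) - val01 (t i) < d.
Proof.
move=> h i ip; apply: le_lt_trans h.
by rewrite /mesh (le_bigmax _ (fun i : 'I_p => val01 (t i.+1) - val01 (t i)) (Ordinal ip)).
Qed.

Lemma v2_sq f p t : (v2 f p t) ^+ 2 = \sum_(i < p) (f (t i.+1) - f (t i)) ^+ 2.
Proof. by rewrite sqr_sqrtr// sumr_ge0// => i _; exact: sqr_ge0. Qed.

Lemma subdivision_of_chain d x y s : 0 < d -> 0 <= x -> x < y -> y <= 1 ->
  chain x y s -> short d s -> exists p t, [/\ subdivision p t, mesh p t < d,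
   (forall i, (i <= p)%N -> x <= val01 (t i) <= y) &
   forall f, qsum (ext f) s <= (v2 f p t) ^+ 2].
Proof.
move=> d0 x0 xy y1 c sh; have [l [pl el ql]] := fill_gaps d0 c sh.
have [l' [pl' el' _ ql']] := step_strict pl.
have inxy i : (i <= size l')%N -> x <= nth x (x :: l') i <= y.
  move=> il; have pl2 : sorted <=%R (x :: l') by apply: sub_path pl' => u v /andP[/ltW].
  have mono := sorted_leq_nth le_trans lexx x pl2.
  have h0 := mono 0%N i; have hn := mono i (size l').
  move: h0 hn; rewrite !inE /= !ltnS leqnn il => /(_ isT isT isT) /= -> /(_ isT isT isT).
  by have := nth_last x (x :: l'); rewrite /= => ->; rewrite el' el.
pose t i := clip01 (nth x (x :: l') i).
have tE i : (i <= size l')%N -> val01 (t i) = nth x (x :: l') i.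
  move=> /inxy /andP[h1 h2]; rewrite val01_clip clip_id //; lra.
have st i : (i < size l')%N -> val01 (t i) < val01 (t i.+1) < val01 (t i) + d.
  move=> il; rewrite (tE i.+1) // (tE i) 1?ltnW //=.
  by have /(pathP x) /(_ i il) := pl'.
exists (size l'), t; split.
- split; last by move=> i /st /andP[].
  by case: (l') el' => //=; rewrite el => e; rewrite e ltxx in xy.
- by apply: mesh_lt => // i /st; lra.
- by move=> i il; rewrite tE //; exact: inxy.
- move=> f; apply: le_trans (ql _) _; rewrite -ql' qsum_steps v2_sq.
  by rewrite le_eqVlt; apply/orP; left; apply/eqP; apply: eq_bigr => i _; rewrite /t /ext.
Qed.

Lemma chain_of_subdivision p t : subdivision p t -> exists s,
  [/\ chain (val01 (t 0%N)) (val01 (t p)) s,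
    forall d, mesh p t < d -> short d s &
    forall f, qsum (ext f) s = (v2 f p t) ^+ 2].
Proof.
case=> p0 st; exists [seq (val01 (t i), val01 (t i.+1)) | i <- iota 0 p]; split.
- have : forall k m, (k + m <= p)%N ->
      chain (val01 (t k)) (val01 (t (k + m)%N)) [seq (val01 (t i), val01 (t i.+1)) | i <- iota
        k m].
    move=> k m; elim: m k => [|m IH] k h /=; first by rewrite addn0.
    rewrite lexx /= ltW /=; last by apply: st; lia.
    by have := IH k.+1; rewrite addSnnS; apply.
  by move=> /(_ 0%N p); apply.
- move=> d md; rewrite /short all_map; apply/allP => i; rewrite mem_iota /= => ip.
  by apply: (lt_mesh md); rewrite -[p]add0n.
- move=> f; rewrite /qsum big_map v2_sq.
  rewrite -(big_mkord xpredT (fun i => (f (t i.+1) - f (t i)) ^+ 2)) /index_iota subn0.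
  by apply: eq_bigr => i _; rewrite !ext_val.
Qed.

Lemma V2norm_le f c : 0 <= c -> (forall s, chain 0 1 s -> qsum (ext f) s <= c ^+ 2) ->
  (V2norm f <= c%:E)%E.
Proof.
move=> c0 h; apply: ge_ereal_sup => _ [[p t] /= sd <-]; rewrite lee_fin.
have [s [cs _ qs]] := chain_of_subdivision sd.
rewrite -(@ler_pXn2r _ 2) ?nnegrE ?sqrtr_ge0// -qs; apply: h.
by apply: chain_weaken cs; rewrite ?val01_ge0 ?val01_le1.
Qed.

Lemma V2norm_ge f c x y s : 0 <= c -> (V2norm f <= c%:E)%E -> chain x y s ->
  qsum (ext f) s <= c ^+ 2.
Proof.
move=> c0 h /clip_chain [s' [c' _ <-]]; last exact: ext_clip.
have [d [d0 sd]] : exists d, 0 < d /\ short d s'.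
  exists 2; split => //; apply/allP => I /(chain_mem c') []; lra.
have [p [t [st _ _ /(_ f) q]]] := subdivision_of_chain d0 (lexx 0) ltr01 (lexx 1) c' sd.
apply: le_trans q _; rewrite ler_pXn2r ?nnegrE ?sqrtr_ge0// -lee_fin.
by apply: le_trans h; apply: ereal_sup_ubound; exists (p, t).
Qed.

Lemma V2norm_gt f c : 0 <= c -> (c%:E < V2norm f)%E ->
  exists s, chain 0 1 s /\ c ^+ 2 < qsum (ext f) s.
Proof.
move=> c0 h; apply: contrapT => H; move: h; apply/negP; rewrite -leNgt.
apply: V2norm_le => // s cs; rewrite leNgt; apply/negP => q; by apply: H; exists s.
Qed.

Lemma lt_V2norm f c x y s : 0 <= c -> chain x y s -> c ^+ 2 < qsum (ext f) s ->
  (c%:E < V2norm f)%E.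
Proof.
move=> c0 cs h; rewrite ltNge; apply/negP => /(V2norm_ge c0)/(_ cs); by rewrite leNgt h.
Qed.

Definition sq_abs_cont F := forall e : R, 0 < e -> exists2 d, 0 < d &
  forall s, chain 0 1 s -> short d s -> qsum F s <= e.

Definition qsum_bounded F (C : R) := forall x y s, chain x y s -> qsum F s <= C.

Lemma V20_sq_abs_cont f : V20 f -> sq_abs_cont (ext f).
Proof.
case=> _ cf e e0; pose e' := Num.sqrt e.
have e'0 : 0 < e' by rewrite sqrtr_gt0.
have : \forall d \near 0^'+, (fine_variation f d < e'%:E)%E.
  apply: (cf [set y | (y < e'%:E)%E]); apply: open_nbhs_nbhs; split; last by rewrite /= lte_fin.
  exact: open_ereal_lt_ereal.
case=> d /= d0 hd.
have d2 : 0 < d / 2 by lra.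
have {hd} : (fine_variation f (d / 2) < e'%:E)%E.
  apply: hd => //=; rewrite sub0r normrN gtr0_norm //; lra.
move=> hd; exists (d / 2) => // s cs ss.
have [p [t [st md _ /(_ f) q]]] := subdivision_of_chain d2 (lexx 0) ltr01 (lexx 1) cs ss.
apply: le_trans q _; rewrite -[leRHS](sqr_sqrtr (ltW e0)) ler_pXn2r ?nnegrE ?sqrtr_ge0//.
rewrite -lee_fin; apply: le_trans (ltW hd).
by apply: ereal_sup_ubound; exists (p, t).
Qed.

Lemma fine_sup_ge f d y s : 0 < d -> 0 < y -> y <= 1 -> chain 0 y s -> short d s ->
  ((qsum (ext f) s)%:E <= fine_sup f `[0%R, y]%classic d)%E.
Proof.
move=> d0 y0 y1 c sh.
have [p [t [sd md inI q]]] := subdivision_of_chain d0 (lexx 0) y0 y1 c sh.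
apply: (@le_trans _ _ ((v2 f p t) ^+ 2)%:E); first by rewrite lee_fin.
apply: ereal_sup_ubound; exists (p, t) => //=; split => //.
Qed.

Lemma lt_fine_sup f r d y : (r%:E < fine_sup f `[0%R, y]%classic d)%E ->
  exists s, [/\ chain 0 y s, short d s & r < qsum (ext f) s].
Proof.
case/ereal_sup_gt => _ [[p t] [/= sd inI md]] <-; rewrite lte_fin => h.
have [s [cs ss qs]] := chain_of_subdivision sd.
exists s; split; [|exact: ss|by rewrite qs].
have := inI p (leqnn _); have := inI 0%N (leq0n _); rewrite /= !in_itv /= => /andP[h1 _]
  /andP[_ h2].
exact: chain_weaken cs.
Qed.

End Clip.

(** * The variation measure along fine chains *)

Section VariationMeasure.
Variables (R : realType) (f : {i01 R} -> R).
Hypothesis fV : (V2norm f < +oo)%E.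
Implicit Types (s : seq (R * R)) (x y z d e : R) (A B : set (measurableTypeR R)).

Notation F := (ext f).

Definition mu_real A : R := fine (mu f A).

Local Lemma muT : (mu f setT < +oo)%E.
Proof. by have [] := mu_itvE fV. Qed.

Lemma mu_realE A : measurable A -> mu f A = (mu_real A)%:E.
Proof.
move=> mA; rewrite fineK// ge0_fin_numE ?measure_ge0//.
by apply: le_lt_trans muT; apply: le_measure; rewrite ?inE.
Qed.

Lemma mu_real_ge0 A : 0 <= mu_real A.
Proof. by apply: fine_ge0. Qed.

Lemma mu_real_le A B : measurable A -> measurable B -> A `<=` B -> mu_real A <= mu_real B.
Proof.
by move=> mA mB AB; rewrite -lee_fin -!mu_realE//; apply: le_measure; rewrite ?inE.
Qed.

Lemma mu_realU A B : measurable A -> measurable B -> mu_real (A `|` B) <= mu_real A + mu_real B.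
Proof.
move=> mA mB; rewrite -lee_fin EFinD -!mu_realE//; last exact: measurableU.
exact: measureU2.
Qed.

Lemma mu_real0 : mu_real set0 = 0.
Proof. by rewrite /mu_real measure0. Qed.

Lemma mu_realC A : measurable A -> mu_real A + mu_real (~` A) = mu_real setT.
Proof.
move=> mA; apply: EFin_inj; rewrite EFinD -!mu_realE//; last exact: measurableC.
rewrite -measureU ?setUv//; first exact: measurableC.
by rewrite setICr.
Qed.

Lemma mu_real_itv01 : mu_real setT = mu_real `[0, 1]%classic.
Proof.
rewrite -(@mu_realC `[0, 1]%classic); last exact: measurable_itv.
by have [_ _ C0 _] := mu_itvE fV; rewrite {2}/mu_real C0 addr0.
Qed.

Lemma mu_real_setT_le A : measurable A -> `[0, 1]%classic `<=` A -> mu_real setT <= mu_real A.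
Proof. by move=> mA; rewrite mu_real_itv01; apply: mu_real_le => //; exact: measurable_itv. Qed.

Lemma mu_real_below (G : nat -> set (measurableTypeR R)) e : 0 < e ->
  (forall n, measurable (G n)) -> {homo G : n m / (n <= m)%N >-> n `<=` m} ->
  exists n, mu_real (\bigcup_n G n) < mu_real (G n) + e.
Proof.
move=> e0 mG hG; have mU : measurable (\bigcup_n G n) by exact: bigcup_measurable.
have := @nondecreasing_cvg_mu _ _ _ (mu f) G mG mU.
have H : {homo G : n m / (n <= m)%N >-> (n <= m)%O}.
  by move=> n m nm; apply/subsetPset; exact: hG.
move=> /(_ H) /(_ [set y | ((mu_real (\bigcup_n G n) - e)%:E < y)%E]) [].
  apply: open_nbhs_nbhs; split; first exact: open_ereal_gt_ereal.
  by rewrite /= mu_realE// lte_fin; lra.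
move=> n _ /(_ n (leqnn n)) /=; rewrite mu_realE// lte_fin => h.
exists n; lra.
Qed.

Lemma mu_real_above (G : nat -> set (measurableTypeR R)) e : 0 < e ->
  (forall n, measurable (G n)) -> {homo G : n m / (n <= m)%N >-> m `<=` n} ->
  exists n, mu_real (G n) < mu_real (\bigcap_n G n) + e.
Proof.
move=> e0 mG hG.
have [||n] := @mu_real_below (fun n => ~` G n) e e0.
- by move=> n; exact: measurableC.
- by move=> n m nm; apply: subsetC; exact: hG.
rewrite -setC_bigcap => h; exists n.
have := mu_realC (mG n); rewrite -(@mu_realC (\bigcap_n G n)); first lra.
exact: bigcap_measurable.
Qed.

Lemma mu_real_oc x y : x <= y -> mu_real `]x, y]%classic = mu_cdf f y - mu_cdf f x.
Proof. by move=> xy; rewrite /mu_real mu_oc. Qed.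

Lemma cdf_le_tilde y b : y < b -> 0 <= y -> exists z, [/\ 0 < z, z <= 1, z <= b &
  mu_cdf f y <= fine (mu_tilde f `[0, z])].
Proof.
move=> yb y0; have [y1|y1] := ltP y 1; last first.
  by exists 1; rewrite mu_cdf_ge1//; split=> //; lra.
exists (Num.min 1 b); have yz : y < Num.min 1 b by rewrite lt_min y1.
by split; rewrite ?ge_min ?lexx ?orbT//; [lra|apply: mu_cdf_le_tilde => //; lra].
Qed.

(** The quantity attached to the initial segments of the unit interval is
    subadditive: a fine chain that crosses a point of ]a, b[ splits there into
    a chain before this point and a chain which stays to the right of a. *)
Lemma lower_chain_oc a y b d e : a <= b -> y < b -> 0 < d -> 0 < e ->
  exists s, [/\ chain a b s, short d s & mu_real `]a, y]%classic <= qsum F s + e].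
Proof.
move=> ab yb d0 e0.
have triv : mu_real `]a, y]%classic <= e ->
    exists s, [/\ chain a b s, short d s & mu_real `]a, y]%classic <= qsum F s + e].
  by move=> h; exists [::]; rewrite qsum_nil add0r.
have [ay|ya] := leP a y; last first.
  by apply: triv; rewrite set_itv_ge ?mu_real0 ?ltW// bnd_simp -leNgt ltW.
move: triv; rewrite mu_real_oc// => triv.
have [y0|y0] := ltP y 0.
  by apply: triv; rewrite !mu_cdf_lt0 ?subrr ?ltW//; lra.
have [z [z0 z1 zb yz]] := cdf_le_tilde yb y0.
have zfin := mu_tilde_fin fV z0.
have finez : forall d', 0 < d' -> exists s,
    [/\ chain 0 z s, short d' s & fine (mu_tilde f `[0, z]) - e / 4 < qsum F s].
  move=> d' d'0; apply: lt_fine_sup.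
  apply: (@lt_le_trans _ _ (mu_tilde f `[0, z])).
    by rewrite -{2}(fineK zfin) lte_fin ltrBlDr ltrDl divr_gt0.
  by apply: ereal_inf_lbound; exists d'.
have [a0|a0] := ltP a 0.
  have [s [cs ss qs]] := finez d d0; exists s; split => //.
    exact: chain_weaken (ltW a0) zb cs.
  by rewrite (mu_cdf_lt0 f a0); move: yz qs e0; clear; lra.
have [a1|a1] := leP 1 a.
  by apply: triv; rewrite !mu_cdf_ge1 ?subrr //; lra.
have : (ereal_inf [set mu_tilde f `[0%R, y] | y in `]a, 1%R[] < (mu_cdf f a + e / 8)%:E)%E.
  by rewrite -mu_cdfE// lte_fin ltrDl divr_gt0.
case/ereal_inf_lt => w [x /= + <-] hx; rewrite in_itv /= => /andP[ax x1].
have x0 : 0 < x by exact: le_lt_trans ax.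
have : (mu_tilde f `[0%R, x]%classic < (fine (mu_tilde f `[0%R, x]%classic) + e / 8)%:E)%E.
  by rewrite -{1}(fineK (mu_tilde_fin fV x0)) lte_fin ltrDl divr_gt0.
case/ereal_inf_lt => w' [d1 /= d10 <-] hd1.
have {hd1} hd1 : (fine_sup f `[0%R, x]%classic d1 < (mu_cdf f a + e / 4)%:E)%E.
  apply: lt_le_trans hd1 _; rewrite lee_fin.
  move: hx; rewrite -{1}(fineK (mu_tilde_fin fV x0)) lte_fin; clear; lra.
pose d2 := Num.min d (Num.min d1 (x - a)).
have d20 : 0 < d2 by rewrite !lt_min d0 d10 subr_gt0.
have [s [cs ss qs]] := finez d2 d20.
have q1 : qsum F [seq I <- s | I.2 <= x] <= mu_cdf f a + e / 4.
  rewrite -lee_fin; apply: le_trans (ltW hd1); apply: fine_sup_ge => //; first exact: ltW.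
    apply: chain_sub (chain_filter _ cs) (ltW x0) _ => I.
    by rewrite mem_filter => /andP[I2 Is]; have [] := chain_mem cs Is.
  apply: short_filter; apply: short_le ss; rewrite !ge_min lexx ?orbT //.
exists [seq I <- s | ~~ (I.2 <= x)]; split.
- apply: chain_sub (chain_filter _ cs) ab _ => I; rewrite mem_filter -ltNge => /andP[I2 Is].
  have [_ _ h] := chain_mem cs Is; split; last exact: le_trans zb.
  have : I.2 - I.1 < x - a.
    by apply: lt_le_trans (allP ss _ Is) _; rewrite !ge_min lexx ?orbT.
  by move: I2; clear; lra.
- apply: short_filter; apply: short_le ss; rewrite !ge_min lexx ?orbT //.
- move: (qsum_filterC F (fun I => I.2 <= x) s) q1 qs yz e0.
  rewrite -/d2; clear; lra.
Qed.

(** The distribution function only measures half-open intervals: ]a, b[ is exhausted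
    by the intervals ]a, y] with y < b. *)
Lemma lower_chain a b d e : a <= b -> 0 < d -> 0 < e ->
  exists s, [/\ chain a b s, short d s & mu_real `]a, b[%classic <= qsum F s + e].
Proof.
move=> ab d0 e0; have e2 : 0 < e / 2 by lra.
pose G (n : nat) : set (measurableTypeR R) := `]a, b - n.+1%:R^-1]%classic.
have [||n hn] := @mu_real_below G (e / 2) e2.
- by move=> n; exact: measurable_itv.
- move=> n m nm x; rewrite /G /= !in_itv /= => /andP[-> h] /=; apply: le_trans h _.
  by rewrite lerB// lef_pV2 ?posrE// ler_nat.
have bn : b - n.+1%:R^-1 < b by rewrite ltrBlDr ltrDl invr_gt0.
have [s [cs ss qs]] := lower_chain_oc ab bn d0 e2.
exists s; split => //; apply: le_trans (_ : mu_real (\bigcup_n G n) <= _); last first.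
  by apply: le_trans (ltW hn) _; rewrite /G; lra.
apply: mu_real_le; [exact: measurable_itv| |].
  by apply: bigcup_measurable => k _; exact: measurable_itv.
move=> x; rewrite /= in_itv /= => /andP[ax xb].
have bx : 0 <= (b - x)^-1 by rewrite invr_ge0; lra.
have := archi_boundP bx => h; exists (Num.bound (b - x)^-1) => //.
rewrite /G /= in_itv /= ax /= lerBrDr -lerBrDl -[leRHS]invrK lef_pV2 ?posrE ?invr_gt0
  ?subr_gt0//.
by apply: le_trans (ltW h) _; rewrite ler_nat.
Qed.

Lemma measurable_cov s : measurable (cov s : set (measurableTypeR R)).
Proof.
elim: s => [|I s IH].
  by rewrite (_ : cov [::] = set0)//; apply/seteqP; split => x // /covP[].
rewrite cov_cons; apply: measurableU => //.
rewrite (_ : [set _ | _] = `[I.1, I.2]%classic); first exact: measurable_itv.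
by apply/seteqP; split => x /=; rewrite in_itv.
Qed.

(** Each gap of the chain is an open interval, to which [lower_chain] applies. *)
Lemma fill_chain x y s d e : 0 < d -> 0 < e -> chain x y s -> short d s ->
  exists s', [/\ chain x y s', short d s' &
    qsum F s + mu_real (`]x, y[%classic `\` cov s) <= qsum F s' + e].
Proof.
move=> d0; elim: s x e => [|I s IH] x e e0.
  move=> /= xy _; have [s' [c' s's q']] := lower_chain xy d0 e0.
  exists s'; split => //; rewrite qsum_nil add0r; apply: le_trans q'.
  apply: mu_real_le => [| |z []//]; last exact: measurable_itv.
  by apply: measurableD; [exact: measurable_itv|exact: measurable_cov].
move=> /= /and3P[xI I12 cs] /andP[sI ss]; have e2 : 0 < e / 2 by lra.
have [s2 [c2 ss2 q2]] := IH _ _ e2 cs ss.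
have [s1 [c1 ss1 q1]] := lower_chain xI d0 e2.
exists (s1 ++ I :: s2); split.
- by apply: chain_cat c1 _; rewrite /= lexx I12.
- by rewrite short_cat ss1 /= sI.
rewrite qsum_cat !qsum_cons.
suff : mu_real (`]x, y[%classic `\` cov (I :: s)) <=
   mu_real `]x, I.1[%classic + mu_real (`]I.2, y[%classic `\` cov s) by lra.
have mD : measurable (`]I.2, y[%classic `\` cov s : set (measurableTypeR R)).
  by apply: measurableD; [exact: measurable_itv|exact: measurable_cov].
apply: le_trans (mu_realU _ mD); last exact: measurable_itv.
apply: mu_real_le.
- by apply: measurableD; [exact: measurable_itv|exact: measurable_cov].
- by apply: measurableU => //; exact: measurable_itv.
move=> z [/=]; rewrite in_itv /= => /andP[xz zy]; rewrite cov_cons => h.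
have [zI|Iz] := ltP z I.1; first by left; rewrite /= in_itv /= xz.
right; split; last by move=> cz; apply: h; right.
rewrite /= in_itv /= zy andbT ltNge; apply/negP => zI; apply: h; left => /=.
by rewrite Iz.
Qed.

Lemma mu_real_total e : 0 < e -> exists2 d, 0 < d & forall x y s, chain x y s -> short d s ->
  qsum F s <= mu_real setT + e.
Proof.
move=> e0; have [_ E1 _ _] := mu_itvE fV.
have ET : mu_real setT = fine (mu_tilde f `[0, 1]) by rewrite -E1 mu_real_itv01.
have t1 := mu_tilde_fin fV (@ltr01 R).
have : (mu_tilde f `[0%R, 1%R]%classic < (mu_real setT + e)%:E)%E.
  by rewrite ET -{1}(fineK t1) lte_fin; lra.
case/ereal_inf_lt => w [d /= d0 <-] hd; exists d => // x y s cs ss.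
have [s' [cs' /(_ _ ss) ss' <-]] := clip_chain cs; last exact: ext_clip.
by rewrite -lee_fin; apply: le_trans (ltW hd); apply: fine_sup_ge.
Qed.

(** Filling the complement of a fine chain almost optimally leaves for the chain
    itself no more than the mass of the set that it covers. *)
Lemma upper_chain e : 0 < e -> exists2 d, 0 < d & forall s, chain 0 1 s -> short d s ->
  qsum F s <= mu_real (cov s) + e.
Proof.
move=> e0; have e2 : 0 < e / 2 by lra.
have [d d0 hd] := mu_real_total e2; exists d => // s cs ss.
have cs2 : chain (-1) 2 s by apply: chain_weaken cs; lra.
have [s' [cs' ss' q]] := fill_chain d0 e2 cs2 ss.
have := hd _ _ _ cs' ss'.
suff : mu_real setT <= mu_real (cov s) + mu_real (`](-1), 2[%classic `\` cov s) by lra.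
have mc := measurable_cov s.
have mD : measurable (`](-1), 2[%classic `\` cov s : set (measurableTypeR R)).
  by apply: measurableD => //; exact: measurable_itv.
apply: le_trans (mu_realU mc mD); apply: mu_real_setT_le; first exact: measurableU.
move=> x; rewrite /= in_itv /= => /andP[x0 x1].
have [c|c] := pselect (cov s x); [by left|right; split => //].
by rewrite /= in_itv /=; apply/andP; split; lra.
Qed.

Definition thick (Z : set R) r : set (measurableTypeR R) :=
  [set x | exists2 z : R, Z z & (`|x - z| < r)%R].

Lemma open_thick Z r : open (thick Z r : set R).
Proof.
rewrite openE => x [z Zz xz]; exists (r - `|x - z|) => /=; first lra.
move=> y /= xy; exists z => //.
have := ler_distD x y z; rewrite (distrC y x); lra.
Qed.

Lemma measurable_thick Z r : measurable (thick Z r).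
Proof. by apply: open_measurable; exact: open_thick. Qed.

Lemma thick_le Z r r' : r <= r' -> thick Z r `<=` thick Z r'.
Proof. by move=> rr x [z Zz h]; exists z => //; exact: lt_le_trans rr. Qed.

(** The thickenings of a closed set decrease to this set. *)
Lemma mu_real_thick (Z : set R) e : 0 < e -> closed Z ->
  exists2 r, 0 < r & mu_real (thick Z r) <= mu_real Z + e.
Proof.
move=> e0 cZ.
have [||n hn] := @mu_real_above (fun n => thick Z n.+1%:R^-1) e e0.
- by move=> n; exact: measurable_thick.
- by move=> n m nm; apply: thick_le; rewrite lef_pV2 ?posrE// ler_nat.
exists n.+1%:R^-1; first by rewrite invr_gt0.
apply: le_trans (ltW hn) _; rewrite lerD2r; apply: mu_real_le.
- by apply: bigcap_measurable => // k _; exact: measurable_thick.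
- exact: closed_measurable.
move=> x h; apply: cZ => B [r /= r0 hB].
have := archi_boundP (ltW (_ : 0 < r^-1)); rewrite invr_gt0 => /(_ r0) hr.
have [z Zz xz] := h (Num.bound r^-1) I; exists z; split => //; apply: hB => /=.
apply: lt_le_trans xz _; rewrite -[leRHS]invrK lef_pV2 ?posrE ?invr_gt0//.
by apply: le_trans (ltW hr) _; rewrite ler_nat.
Qed.

End VariationMeasure.

(** * Atoms of the variation measure *)

Section Atoms.
Variables (R : realType) (f : {i01 R} -> R).
Hypothesis fV : (V2norm f < +oo)%E.
Implicit Types (s : seq (R * R)) (l : seq R) (x y z d e : R).

Notation F := (ext f).
Notation m := (mu_real f).
Notation atom t := (mu_real f [set t]).

Lemma set_seq_cons (T : eqType) (t : T) (l : seq T) :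
  [set` t :: l] = [set t] `|` [set` l].
Proof.
apply/seteqP; split => x /=; rewrite inE.
  by move=> /orP[/eqP ->|]; [left|right].
by case=> [->|->]; rewrite ?eqxx ?orbT.
Qed.

Lemma measurable_seq l : measurable ([set` l] : set (measurableTypeR R)).
Proof.
elim: l => [|t l IH]; first by rewrite (_ : [set` _] = set0)//; apply/seteqP; split.
by rewrite set_seq_cons; apply: measurableU => //; exact: measurable_set1.
Qed.

Lemma closed_seq l : closed ([set` l] : set R).
Proof.
elim: l => [|t l IH]; first by rewrite (_ : [set` _] = set0); [exact: closed0|apply/seteqP;
  split].
by rewrite set_seq_cons; apply: closedU => //; exact: closed_eq.
Qed.

Lemma mu_real_seq l : uniq l -> m [set` l] = \sum_(t <- l) atom t.
Proof.
elim: l => [|t l IH] /=.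
  by move=> _; rewrite big_nil -(mu_real0 f); congr m; apply/seteqP; split.
move=> /andP[tl ul]; rewrite big_cons -IH// set_seq_cons.
apply: EFin_inj; rewrite EFinD -!(mu_realE fV)//; first last.
- by apply: measurableU; [exact: measurable_set1|exact: measurable_seq].
- exact: measurable_seq.
- apply: measureU; [exact: measurable_set1|exact: measurable_seq|].
  by apply/seteqP; split => // x [/= ->]; rewrite (negbTE tl).
Qed.

Definition in01 l : bool := all (fun t => 0 <= t <= 1) l.

Lemma mu01_set1 (t : {i01 R}) : mu01 f [set t] = (atom (val01 t))%:E.
Proof. by rewrite /mu01 image_set1 (mu_realE fV). Qed.

Lemma sum_mu01 (k : seq {i01 R}) : uniq k ->
  (\sum_(t \in [set` k]) mu01 f [set t] = (m [set` map (@val01 R) k])%:E)%E.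
Proof.
move=> uk; rewrite -fsbig_seq// mu_real_seq; last first.
  by rewrite map_inj_uniq//; move=> x y; exact: val_inj.
rewrite big_map -sumEFin; apply: eq_bigr => t _; exact: mu01_set1.
Qed.

Definition discrete_mass : R := fine (mu_discrete f setT).
Notation D := discrete_mass.

Lemma mu_discrete_le : (mu_discrete f setT <= (m setT)%:E)%E.
Proof.
apply: ge_ereal_sup => _ [A [/finite_seqP [k ->] _] <-].
have -> : [set` k] = [set` undup k] by apply/seteqP; split => t /=; rewrite mem_undup.
rewrite sum_mu01 ?undup_uniq// lee_fin; apply: (mu_real_le fV) => //; exact: measurable_seq.
Qed.

Lemma mu_discreteE : mu_discrete f setT = D%:E.
Proof.
rewrite /D fineK// ge0_fin_numE; first exact: le_lt_trans mu_discrete_le (ltry _).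
by apply: esum_ge0 => t _; rewrite mu01_set1 lee_fin mu_real_ge0.
Qed.

Lemma discrete_mass_le : D <= m setT.
Proof. by rewrite -lee_fin -mu_discreteE mu_discrete_le. Qed.

Lemma atoms_le l : in01 l -> m [set` l] <= D.
Proof.
move=> /allP l01; pose k := map (@clip01 R) (undup l).
have kE : map (@val01 R) k = undup l.
  rewrite -map_comp -[RHS]map_id; apply/eq_in_map => t; rewrite mem_undup => /l01 /andP[t0 t1].
  by rewrite -[LHS]/(clip t) clip_id.
have uk : uniq k by rewrite -(map_inj_uniq (f := @val01 R)) ?kE ?undup_uniq//; move=> x y;
  exact: val_inj.
have -> : [set` l] = [set` undup l] by apply/seteqP; split => t /=; rewrite mem_undup.
rewrite -lee_fin -mu_discreteE -kE -sum_mu01//.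
apply: ereal_sup_ubound; exists [set` k] => //; split => //; exact: finite_seq.
Qed.

Lemma atoms_approx e : 0 < e -> exists l, [/\ uniq l, in01 l & D - e < m [set` l]].
Proof.
move=> e0; have : ((D - e)%:E < mu_discrete f setT)%E by rewrite mu_discreteE lte_fin; lra.
case/ereal_sup_gt => _ [A [/finite_seqP [k ->] _] <-].
have -> : [set` k] = [set` undup k] by apply/seteqP; split => t /=; rewrite mem_undup.
rewrite sum_mu01 ?undup_uniq// lte_fin => h; exists (map (@val01 R) (undup k)); split => //.
  by rewrite map_inj_uniq ?undup_uniq//; move=> x y; exact: val_inj.
by apply/allP => _ /mapP[t _ ->]; rewrite val01_ge0 val01_le1.
Qed.

Lemma atoms_size (l : seq R) th : uniq l -> {in l, forall t, th <= atom t} ->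
  (size l)%:R * th <= m [set` l].
Proof.
move=> ul h; rewrite mu_real_seq//.
have -> : (size l)%:R * th = \sum_(t <- l) th.
  by rewrite big_const_seq count_predT iter_addr_0 mulr_natl.
by rewrite !big_seq; apply: ler_sum.
Qed.

(** The atoms of mass larger than th are so few that th times their number is
    small with th: up to a fixed finite set, they carry a small mass. *)
Lemma large_atoms (k0 : nat) e : 0 < e -> exists th A, [/\ 0 < th, uniq A, in01 A,
  (k0 + size A)%:R * th <= e &
  forall t, 0 <= t <= 1 -> t \notin A -> atom t <= th].
Proof.
move=> e0; have e2 : 0 < e / 2 by lra.
have [A1 [u1 i1 h1]] := atoms_approx e2.
pose c : R := (k0 + size A1).+1%:R; have c0 : 0 < c by rewrite ltr0n.
pose th := (e / 2) / c; have th0 : 0 < th by rewrite divr_gt0.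
pose P n := `[< exists A2, [/\ uniq (A1 ++ A2), in01 A2, size A2 = n &
  {in A2, forall t, th <= atom t}] >].
have sz A2 : uniq (A1 ++ A2) -> in01 A2 -> {in A2, forall t, th <= atom t} ->
    (size A2)%:R * th <= e / 2.
  move=> u12 i2 h2; have := u12; rewrite cat_uniq => /and3P[_ _ u2].
  have := atoms_size u2 h2; have : m [set` A1 ++ A2] <= D by apply: atoms_le; rewrite /in01
    all_cat -!/(in01 _) i1.
  rewrite !mu_real_seq// big_cat /= -!mu_real_seq//; lra.
have exP : exists n, P n by exists 0%N; apply/asboolP; exists [::]; split; rewrite ?cats0.
have ubP n : P n -> (n <= Num.bound (e / 2 / th))%N.
  move=> /asboolP[A2 [u2 i2 <- h2]]; have := sz _ u2 i2 h2.
  rewrite -ler_pdivlMr// => h; rewrite -(ler_nat R); apply: le_trans h _.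
  by apply: ltW; apply: archi_boundP; apply: divr_ge0; lra.
have [n /asboolP [A2 [u2 i2 s2 h2]] max] := ex_maxnP exP ubP.
exists th, (A1 ++ A2); split => //.
- by rewrite /in01 all_cat -!/(in01 _) i1.
- rewrite size_cat addnA natrD mulrDl; have := sz _ u2 i2 h2.
  suff : (k0 + size A1)%:R * th <= e / 2 by lra.
  rewrite /th mulrA ler_pdivrMr// mulrC ler_wpM2l ?(ltW e2)// ler_nat; lia.
- move=> t t01 tA; rewrite leNgt; apply/negP => ht.
  have /max : P n.+1; last by rewrite ltnn.
  apply/asboolP; exists (rcons A2 t); split; rewrite ?size_rcons ?s2//.
  + by rewrite -rcons_cat rcons_uniq tA.
  + by rewrite /in01 all_rcons t01.
  + by move=> z; rewrite mem_rcons inE => /orP[/eqP->|/h2//]; exact: ltW.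
Qed.

(** [upper_chain] for the single interval between t and x, which lies in a small
    thickening of the point t. *)
Lemma small_jump t c : 0 <= t <= 1 -> atom t < c -> exists2 r, 0 < r &
  forall x, 0 <= x <= 1 -> `|x - t| < r -> (F x - F t) ^+ 2 <= c.
Proof.
move=> /andP[t0 t1] tc; have e0 : 0 < (c - atom t) / 2 by lra.
have [d d0 hd] := upper_chain fV e0.
have ct : closed [set t] by exact: closed_eq.
have [r r0 hr] := mu_real_thick fV e0 ct.
exists (Num.min d r); first by rewrite lt_min d0.
move=> x /andP[x0 x1]; rewrite lt_min => /andP[xd xr].
pose I := (Num.min x t, Num.max x t).
have -> : (F x - F t) ^+ 2 = qsum F [:: I].
  rewrite /qsum big_seq1 /I /=; case: (leP x t) => _ //=.
  by rewrite -sqrrN opprB.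
apply: le_trans (hd [:: I] _ _) _.
- rewrite /= /I /= le_min ge_max !ge_min !le_max x0 t0 x1 t1 lexx /=.
  by case: (leP x t).
- rewrite /short /= andbT /I /=; move: xd; rewrite ltr_norml; case: (leP x t); lra.
have : m (cov [:: I]) <= m (thick [set t] r).
  apply: (mu_real_le fV); [exact: measurable_cov|exact: measurable_thick|].
  move=> y /covP[J]; rewrite inE => /eqP-> {J} h; exists t => //.
  move: xr h; rewrite !ltr_norml /I /=; case: (leP x t); lra.
lra.
Qed.

(** In a fine chain that is almost optimal on the whole line, the intervals that
    leave U lie in a small thickening of the complement of U; by [upper_chain] they
    carry hardly more than the mass of this complement. *)
Lemma open_chain (U : set R) th d : open U -> 0 < d -> th < m U ->
  exists s, [/\ chain 0 1 s, short d s,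
    {in s, forall I x, I.1 <= x <= I.2 -> U x} & th < qsum F s].
Proof.
move=> oU d0 hth; have e0 : 0 < (m U - th) / 4 by lra.
have mU : measurable (U : set (measurableTypeR R)) by exact: open_measurable.
have [d1 d10 h1] := upper_chain fV e0.
have cU : closed (~` U) by exact: open_closedC.
have [r r0 hr] := mu_real_thick fV e0 cU.
pose d2 := Num.min d (Num.min d1 r).
have d20 : 0 < d2 by rewrite !lt_min d0 d10.
have m12 : (-1 : R) <= 2 by lra.
have [s0 [c0 ss0 q0]] := lower_chain fV m12 d20 e0.
have [s [cs /(_ _ ss0) ss qs]] := clip_chain c0.
pose p := fun I : R * R => `[< forall x, I.1 <= x <= I.2 -> U x >].
exists [seq I <- s | p I]; split.
- exact: chain_filter.
- by apply: short_filter; apply: short_le ss; rewrite ge_min lexx.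
- by move=> I; rewrite mem_filter => /andP[/asboolP].
have -> : th = m U - 4 * ((m U - th) / 4) by lra.
have hT : m setT <= m `](-1), 2[%classic.
  apply: (mu_real_setT_le fV); first exact: measurable_itv.
  by move=> x /=; rewrite !in_itv /=; lra.
have hout : qsum F [seq I <- s | ~~ p I] <= m (~` U) + (m U - th) / 4 + (m U - th) / 4.
  apply: le_trans (h1 _ (chain_filter _ cs) _) _.
    by apply: short_filter; apply: short_le ss; rewrite !ge_min lexx ?orbT.
  rewrite lerD2r; apply: le_trans hr.
  apply: (mu_real_le fV); [exact: measurable_cov|exact: measurable_thick|].
  move=> x /covP [I]; rewrite mem_filter => /andP[/asboolPn nI Is] xI.
  have [y [yI nUy]] : exists y, I.1 <= y <= I.2 /\ ~ U y.
    by apply: contrapT => H; apply: nI => y yI; apply: contrapT => nU; apply: H; exists y.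
  exists y => //; have : I.2 - I.1 < r.
    by apply: lt_le_trans (allP ss _ Is) _; rewrite !ge_min lexx ?orbT.
  rewrite ltr_norml; lra.
have := qsum_filterC F p s; rewrite (qs _ (@ext_clip _ f)); have := mu_realC fV mU; lra.
Qed.

Lemma mu_real_total_le N : 0 <= N -> (V2norm f <= N%:E)%E -> m setT <= N ^+ 2.
Proof.
move=> N0 hN; apply/ler_addgt0Pr => e e0.
have m12 : (-1 : R) <= 2 by lra.
have [s [cs _ q]] := lower_chain fV m12 ltr01 e0.
have := V2norm_ge N0 hN cs.
suff : m setT <= m `](-1), 2[%classic by lra.
apply: (mu_real_setT_le fV); first exact: measurable_itv.
by move=> x /=; rewrite !in_itv /=; lra.
Qed.

End Atoms.

(** * Partitions of small quadratic variation *)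

Section Halving.
Variable R : realType.
Implicit Types (F : R -> R) (s : seq (R * R)) (l : seq R) (x y z d e a b th : R).

Definition osc_le F th a b := forall t, a <= t <= b -> exists2 r, 0 < r &
  forall x, a <= x <= b -> `|x - t| < r -> `|F x - F t| <= th.

(** The last point where F is below the middle value is within th of it, since F
    crosses this value there. *)
Lemma approx_ivt_le F th a b : a <= b -> osc_le F th a b -> F a <= F b ->
  exists2 c, a <= c <= b & `|F c - (F a + F b) / 2| <= th.
Proof.
move=> ab h Fab; pose m := (F a + F b) / 2.
pose E := [set t | a <= t <= b /\ F t <= m].
have Ea : E a by split; rewrite ?lexx//= /m; lra.
have hE : has_sup E by split; [exists a|exists b => t [/andP[]]].
pose c := sup E.
have ac : a <= c by apply: ub_le_sup => //; case: hE.
have cb : c <= b by apply: ge_sup; [exists a|move=> t [/andP[]]].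
have cI : a <= c <= b by rewrite ac.
exists c => //; have [r r0 hr] := h c cI.
have [t Et tc] := sup_adherent r0 hE.
have tc' : t <= c by apply: ub_le_sup => //; case: hE.
have [tI Ft] := Et.
have := hr t tI; rewrite ltr_norml ler_norml => /(_ _) h1.
have {}h1 : - th <= F t - F c <= th by apply: h1; rewrite -/c in tc; lra.
rewrite ler_norml; apply/andP; split; last by move: h1 Ft; rewrite /m; lra.
move: cb; rewrite le_eqVlt => /orP[/eqP cb|cb].
  have th0 : 0 <= th by apply: le_trans (hr c cI _); rewrite // subrr normr0.
  rewrite cb; lra.
pose x := Num.min b (c + r / 2).
have cx : c < x by rewrite lt_min cb; lra.
have xb : x <= b by rewrite ge_min lexx.
have xr : x <= c + r / 2 by rewrite ge_min lexx orbT.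
have Fx : m < F x.
  rewrite ltNge; apply/negP => Fx; suff : x <= c by lra.
  by apply: ub_le_sup; [case: hE|split => //; rewrite xb andbT; lra].
have : `|F x - F c| <= th.
  by apply: hr; [rewrite xb andbT; lra|rewrite ltr_norml; lra].
rewrite ler_norml; move: Fx; rewrite /m; lra.
Qed.

Lemma approx_ivt F th a b : a <= b -> osc_le F th a b ->
  exists2 c, a <= c <= b & `|F c - (F a + F b) / 2| <= th.
Proof.
move=> ab h; have [Fab|/ltW Fab] := leP (F a) (F b); first exact: approx_ivt_le.
have [||c cI hc] := @approx_ivt_le (fun x => - F x) th a b ab; last 1 first.
- exists c => //; move: hc; rewrite !ler_norml; lra.
- move=> t /h [r r0 hr]; exists r => // x xI xt; have := hr x xI xt.
  by rewrite !ler_norml; lra.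
- by rewrite lerN2.
Qed.

(** After k halvings every increment is about 2^-k times the original one, up to
    the jumps that the intermediate value property misses. *)
Lemma halving F th d k a b : 0 <= th -> a <= b -> b < a + d -> osc_le F th a b ->
  exists l, [/\ path (step d) a l, last a l = b, size l = (2 ^ k)%N &
    {in steps a l, forall I,
      `|F I.2 - F I.1| <= (`|F b - F a| - 2 * th) / 2 ^+ k + 2 * th}].
Proof.
move=> th0; elim: k a b => [|k IH] a b ab bd h.
  exists [:: b]; split => //=; first by rewrite /step ab bd.
  by move=> I; rewrite /steps /= inE => /eqP -> /=; lra.
have [c /andP[ac cb] hc] := approx_ivt ab h.
have [||l1 [p1 e1 s1 h1]] := IH a c ac; first lra.
  move=> t /andP[at_ tc]; have [|r r0 hr] := h t; first by rewrite at_ (le_trans tc).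
  by exists r => // x /andP[ax xc]; apply: hr; rewrite ax (le_trans xc).
have [||l2 [p2 e2 s2 h2]] := IH c b cb; first lra.
  move=> t /andP[at_ tc]; have [|r r0 hr] := h t; first by rewrite tc andbT (le_trans ac).
  by exists r => // x /andP[ax xc]; apply: hr; rewrite xc andbT (le_trans ac).
exists (l1 ++ l2); split.
- by rewrite cat_path p1 e1.
- by rewrite last_cat e1.
- by rewrite size_cat s1 s2 expnS mul2n addnn.
have aux u v : `|F v - F u| <= `|F b - F a| / 2 + th ->
    (`|F v - F u| - 2 * th) / 2 ^+ k <= (`|F b - F a| - 2 * th) / 2 ^+ k.+1.
  move=> H; rewrite exprS invfM mulrA ler_wpM2r ?invr_ge0 ?exprn_ge0//; lra.
have half u : `|F u - (F a + F b) / 2| = `|F u - F a - (F b - F a) / 2|.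
  by congr `|_|; lra.
have hb : `|(F b - F a) / 2| = `|F b - F a| / 2.
  by rewrite normrM [X in _ * X]ger0_norm//; lra.
move=> I; rewrite steps_cat mem_cat e1 => /orP[/h1|/h2] H; apply: le_trans H _;
  rewrite lerD2r; apply: aux; rewrite -hb; apply: le_trans _ (lerD (lexx _) hc).
- rewrite (_ : F c - F a = (F b - F a) / 2 + (F c - (F a + F b) / 2)); last lra.
  exact: ler_normD.
- rewrite (_ : F b - F c = (F b - F a) / 2 - (F c - (F a + F b) / 2)); last lra.
  exact: ler_normB.
Qed.

Lemma halving_qsum F th d k a b : 0 <= th -> a <= b -> b < a + d -> osc_le F th a b ->
  exists l, [/\ path (step d) a l, last a l = b &
    qsum F (steps a l) <= 2 / 2 ^+ k * (F b - F a) ^+ 2 + 8 * 2 ^+ k * th ^+ 2].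
Proof.
move=> th0 ab bd h; have [l [pl el sl hl]] := halving k th0 ab bd h.
exists l; split => //.
set L := `|F b - F a| in hl; have k0 : (0 : R) < 2 ^+ k by rewrite exprn_gt0.
apply: (@le_trans _ _ (\sum_(I <- steps a l) (2 * (L / 2 ^+ k) ^+ 2 + 8 * th ^+ 2))).
  rewrite /qsum !big_seq; apply: ler_sum => I /hl H.
  have {}H : `|F I.2 - F I.1| <= L / 2 ^+ k + 2 * th.
    apply: le_trans H _; rewrite lerD2r ler_wpM2r ?invr_ge0 ?(ltW k0)//; lra.
  rewrite -real_normK ?num_real//.
  apply: (@le_trans _ _ ((L / 2 ^+ k + 2 * th) ^+ 2)).
    by rewrite ler_pXn2r ?nnegrE//; apply: le_trans H.
  set q := L / 2 ^+ k; have := sqr_ge0 (q - 2 * th); rewrite !expr2; lra.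
rewrite big_const_seq count_predT iter_addr_0 size_zip /= (minn_idPr _)// sl.
rewrite -[X in X <= _]mulr_natl natrX mulrDr [in leRHS]mulrAC.
rewrite -[(F b - F a) ^+ 2](real_normK (num_real _)) -/L.
have -> : 2 ^+ k * (2 * (L / 2 ^+ k) ^+ 2) = 2 * L ^+ 2 / 2 ^+ k.
  by field; rewrite gt_eqF.
lra.
Qed.

Definition gap d : rel R := fun u v => (u < v) && (v < u + d).
Definition wide r d : rel R := fun u v => (u + 2 * r < v) && (v < u + d).

Lemma path_wide d x l : path (gap d) x l ->
  exists2 r0, 0 < r0 & forall r, r <= r0 -> path (wide r d) x l.
Proof.
elim: l x => [|y l IH] x /=; first by exists 1.
case/andP=> /andP[xy yd] /IH[r0 r00 hr].
exists (Num.min r0 ((y - x) / 4)); first by rewrite lt_min r00; lra.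
move=> r; rewrite le_min => /andP[r1 r2]; rewrite hr// andbT /wide yd andbT; lra.
Qed.

Lemma gap_mem d x l t : path (gap d) x l -> t \in l -> x < t.
Proof.
elim: l x => // y l IH x /= /andP[/andP[xy _] /IH h]; rewrite inE => /orP[/eqP->//|/h].
exact: lt_trans.
Qed.

Lemma wide_gap r d x l : 0 <= r -> path (wide r d) x l -> path (gap d) x l.
Proof. by move=> r0; apply: sub_path => u v /andP[h1 h2]; rewrite /gap h2 andbT; lra. Qed.

Lemma insert_point d x l t : path (gap d) x l -> x <= t <= last x l ->
  exists l', [/\ path (gap d) x l', last x l' = last x l,
    {subset t :: l <= x :: l'} & (size l' <= (size l).+1)%N].
Proof.
elim: l x => [|y l IH] x /=.
  by move=> _ h; exists [::]; split => // z; rewrite !inE => /eqP->; apply/eqP; lra.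
case/andP=> /andP[xy yd] pl /andP[xt tl].
have [->|tx] := eqVneq t x.
  exists (y :: l); split => //=; first by rewrite /gap xy yd.
have {tx}xt : x < t by rewrite lt_neqAle eq_sym tx.
have [ty|yt] := ltP t y.
  exists (t :: y :: l); split => //=.
    rewrite pl /gap xt ty /= andbT; lra.
  by move=> z; rewrite !inE => ->; rewrite orbT.
have [|l' [p' e' sub sz]] := IH y pl; first by rewrite yt.
exists (y :: l'); split => //=; first by rewrite /gap xy yd.
move=> z; rewrite inE => /orP[/eqP->|]; first by rewrite inE sub ?orbT// mem_head.
by rewrite inE => /orP[/eqP->|zl]; rewrite inE ?mem_head ?orbT// sub ?orbT// inE zl orbT.
Qed.

Lemma insert_points d x l k : path (gap d) x l -> all (fun t => x <= t <= last x l) k ->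
  exists l', [/\ path (gap d) x l', last x l' = last x l,
    {subset k ++ l <= x :: l'} & (size l' <= size l + size k)%N].
Proof.
move=> pl; elim: k => [|t k IH] /=.
  by move=> _; exists l; split => //; rewrite ?addn0// => z zl; rewrite inE zl orbT.
case/andP=> tI /IH [l1 [p1 e1 sub1 s1]].
have [|l2 [p2 e2 sub2 s2]] := insert_point (t := t) p1; first by rewrite e1.
exists l2; split => //; [by rewrite e2| |by rewrite addnS (leq_trans s2)].
move=> z; rewrite inE => /orP[/eqP->|/sub1]; first by rewrite sub2 ?mem_head.
by rewrite inE => /orP[/eqP->|zl]; [rewrite mem_head|rewrite sub2// inE zl orbT].
Qed.

(** Between two consecutive points u < v of a partition containing all the large
    jumps: the short intervals [u, u + r] and [v - r, v] account for the jumps at u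
    and v, and the halving takes place between u + r and v - r. *)
Lemma refine_partition F th r d k x l : 0 <= th -> 0 < r -> path (wide r d) x l ->
  (forall t, x <= t <= last x l -> t \notin x :: l -> exists2 q, 0 < q &
     forall y, x <= y <= last x l -> `|y - t| < q -> `|F y - F t| <= th) ->
  exists Q s1 s2, [/\ path (step d) x Q, last x Q = last x l, {subset l <= Q},
    [/\ chain x (last x l) s1, short (2 * r) s1 & cov s1 `<=` thick [set` x :: l] (2 * r)] &
    chain x (last x l) s2 /\
    qsum F (steps x Q) <= qsum F s1 + 2 / 2 ^+ k * qsum F s2 +
      (size l)%:R * (8 * 2 ^+ k * th ^+ 2)].
Proof.
move=> th0 r0; elim: l x => [|y l IH] x /=.
  move=> _ _; exists [::], [::], [::]; split => //; last first.
    by rewrite /steps /= lexx !qsum_nil; split => //; lra.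
  by split => //=; move=> z /covP[].
move=> /andP[/andP[xy yd] pl] h.
have pg := wide_gap (ltW r0) pl.
have yl : y <= last y l by apply: (@path_step_le _ d); apply: sub_path pg => u v /andP[/ltW];
  rewrite /step => -> ->.
have [|Q [s1 [s2 [pQ eQ subQ [c1 ss1 cov1] [c2 q2]]]]] := IH y pl.
  move=> t /andP[yt tl] tn; have [||q q0 hq] := h t.
  - by rewrite tl andbT; lra.
  - by rewrite inE negb_or tn andbT; apply/eqP; lra.
  exists q => // z /andP[yz zl]; apply: hq; rewrite zl andbT; lra.
have [|||l1 [p1 e1 q1]] := @halving_qsum F th d k (x + r) (y - r) th0; try lra.
  move=> t /andP[xt ty]; have [||q q0 hq] := h t.
  - by apply/andP; split; lra.
  - rewrite !inE !negb_or; apply/and3P; split; try by apply/eqP; lra.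
    by apply/negP => /(gap_mem pg); lra.
  exists q => // z /andP[yz zl]; apply: hq; apply/andP; split; lra.
exists ((x + r) :: l1 ++ y :: Q), ((x, x + r) :: (y - r, y) :: s1), ((x + r, y - r) :: s2).
split.
- rewrite /= cat_path p1 e1 /= pQ /step !andbT /=; apply/andP; split; apply/andP; split; lra.
- by rewrite /= last_cat /= eQ.
- move=> z; rewrite inE => /orP[/eqP->|/subQ zQ].
    by rewrite inE mem_cat mem_head !orbT.
  by rewrite inE mem_cat inE zQ !orbT.
- split.
  + by rewrite /= c1 !lexx /= !andbT; do ?[apply/andP; split]; lra.
  + by rewrite /= ss1 andbT; apply/andP; split; lra.
  + move=> z /covP[I]; rewrite !inE => /or3P[/eqP->|/eqP->|Is] /= hz.
    * exists x; rewrite /= ?mem_head// ltr_norml; lra.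
    * exists y; rewrite /= ?inE ?eqxx ?orbT// ltr_norml; lra.
    * have [|w wl hw] := cov1 z; first by apply/covP; exists I.
      by exists w => //; rewrite /= inE; apply/orP; right.
- split.
    rewrite /= (chain_weaken _ (lexx _) c2) ?andbT; last lra.
    by apply/andP; split; lra.
  rewrite /steps /= !qsum_cons -!/(steps _ _) steps_cat qsum_cat e1 /steps /= qsum_cons
    -!/(steps _ _) /=.
  rewrite -natr1 !mulrDr !mulrDl; lra.
Qed.

End Halving.

Section SmallPartition.
Variables (R : realType) (f : {i01 R} -> R).
Hypothesis fV : (V2norm f < +oo)%E.
Notation F := (ext f).
Notation D := (discrete_mass f).

Lemma V2norm_ge0 (g : {i01 R} -> R) : (0 <= V2norm g)%E.
Proof.
rewrite leNgt; apply/negP => h.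
have [p [t [sd _ _ _]]] := subdivision_of_chain (@ltr01 R) (lexx 0) ltr01 (lexx 1)
   (ler01 : chain 0 1 [::]) (isT : short 1 [::]).
have : ((v2 g p t)%:E <= V2norm g)%E by apply: ereal_sup_ubound; exists (p, t).
by move=> /le_lt_trans/(_ h); rewrite lte_fin ltNge sqrtr_ge0.
Qed.

Lemma V2norm_fine : (V2norm f)%E = (fine (V2norm f))%:E.
Proof. by rewrite fineK// ge0_fin_numE// V2norm_ge0. Qed.

(** Between the large jumps the quadratic variation of F along a partition can be
    made to vanish by halving, so that only the squares of the jumps remain, and these
    are controlled by the atoms. The number k of halvings is fixed first; the threshold
    th for the atoms comes next, and is so small that the errors th made at each of the
    intermediate points stay negligible after k halvings. *)
Lemma small_partition (eta d : R) (R0 : seq R) : 0 < eta -> 0 < d ->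
  exists Q, [/\ path (step d) 0 Q, last 0 Q = 1,
    (forall t, t \in R0 -> 0 <= t <= 1 -> t \in 0 :: Q) &
    qsum F (steps 0 Q) <= D + eta].
Proof.
move=> eta0 d0; pose N := fine (V2norm f).
have N0 : 0 <= N by rewrite fine_ge0// V2norm_ge0.
have hN : (V2norm f <= N%:E)%E by rewrite -V2norm_fine.
have [l0 [/step_strict [l1 [p1 e1 _ _]] e0]] := grid d0 (@ler01 R).
rewrite e0 in e1.
have [|l2 [p2 e2 sub2 _]] := insert_points (k := [seq t <- R0 | 0 <= t <= 1]) (p1 : path (gap
  d) 0 l1).
  by apply/allP => t; rewrite mem_filter e1 => /andP[].
rewrite e1 in e2.
have [k hk] : exists k : nat, 2 / 2 ^+ k * N ^+ 2 <= eta / 4.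
  exists (Num.bound (8 * N ^+ 2 / eta)).
  set k := Num.bound _; have k0 : (0 : R) < 2 ^+ k by rewrite exprn_gt0.
  rewrite mulrAC ler_pdivrMr//.
  have h0 : 0 <= 8 * N ^+ 2 / eta by apply: divr_ge0 (ltW eta0); rewrite mulr_ge0 ?sqr_ge0.
  have := archi_boundP h0; rewrite -/k ltr_pdivrMr// => h1.
  have h2 : k%:R * eta <= 2 ^+ k * eta.
    by rewrite ler_wpM2r ?(ltW eta0)// -natrX ler_nat ltnW// ltn_expl.
  move: h1 h2; clear; move: (2 ^+ k) (k%:R) (N ^+ 2) => P q n2; lra.
have k0 : (0 : R) < 2 ^+ k by rewrite exprn_gt0.
have e'0 : 0 < eta / (128 * 2 ^+ k) by rewrite divr_gt0 ?mulr_gt0.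
have [th [A [th0 uA iA sA hA]]] := large_atoms fV (size l2) e'0.
have [|l3 [p3 e3 sub3 sz3]] := insert_points (k := A) p2; first by rewrite e2.
rewrite e2 in e3.
have [r0 r00 hr0] := path_wide p3.
have eta4 : 0 < eta / 4 by lra.
have [d1 d10 hd1] := upper_chain fV eta4.
have cZ : closed [set` 0 :: l3] by exact: closed_seq.
have [r1 r10 hr1] := mu_real_thick fV eta4 cZ.
pose r := Num.min r0 (Num.min (d1 / 2) (r1 / 2)).
have r_gt0 : 0 < r by rewrite !lt_min r00; apply/andP; split; lra.
have [rr0 rd1 rr1] : [/\ r <= r0, 2 * r <= d1 & 2 * r <= r1].
  have a1 : r <= d1 / 2 by rewrite !ge_min lexx !orbT.
  have a2 : r <= r1 / 2 by rewrite !ge_min lexx !orbT.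
  by split; [rewrite ge_min lexx| |]; lra.
(* Atoms of mass at most th produce oscillations of size at most 2 sqrt th. *)
pose th' := 2 * Num.sqrt th.
have th'2 : th' ^+ 2 = 4 * th by rewrite exprMn sqr_sqrtr ?ltW// -natrX.
have th'0 : 0 <= th' by rewrite mulr_ge0 ?sqrtr_ge0.
have in01l t : t \in 0 :: l3 -> 0 <= t <= 1.
  have p3' : path (step d) 0 l3 by apply: sub_path p3 => u v /andP[/ltW]; rewrite /step => ->
    ->.
  rewrite inE => /orP[/eqP->|tl]; first by rewrite lexx ler01.
  rewrite (ltW (gap_mem p3 tl)) /= -e3.
  case/splitPr: tl p3' => a b; rewrite last_cat /= cat_path /= => /andP[_ /andP[_ ]].
  exact: path_step_le.
have [|Q [s1 [s2 [pQ eQ subQ [c1 ss1 cov1] [c2 q2]]]]] :=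
    refine_partition k th'0 r_gt0 (hr0 _ rr0) (F := F).
  rewrite e3 => t t01 tl.
  have tA : t \notin A by apply: contra tl => tA; apply: sub3; rewrite mem_cat tA.
  have [|q q0 hq] := @small_jump _ _ fV t (4 * th) t01.
    by apply: le_lt_trans (hA _ t01 tA) _; lra.
  exists q => // y y01 yt; have := hq y y01 yt.
  by rewrite -th'2 -[X in X <= _]real_normK ?num_real// ler_pXn2r ?nnegrE.
rewrite e3 in eQ c1 c2.
exists Q; split => //.
- move=> t tR t01; have : t \in 0 :: l2 by apply: sub2; rewrite mem_cat mem_filter t01 tR.
  rewrite inE => /orP[/eqP->|tl]; first by rewrite mem_head.
  have : t \in 0 :: l3 by apply: sub3; rewrite mem_cat tl orbT.
  by rewrite !inE => /orP[->//|/subQ ->]; rewrite orbT.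
- have Q1 : qsum F s1 <= D + eta / 4 + eta / 4.
    apply: le_trans (hd1 s1 c1 (short_le rd1 ss1)) _; rewrite lerD2r.
    have : mu_real f [set` 0 :: l3] <= D by apply: atoms_le => //; apply/allP => t; exact:
      in01l.
    suff : mu_real f (cov s1) <= mu_real f (thick [set` 0 :: l3] r1) by lra.
    apply: mu_real_le => //; [exact: measurable_cov|exact: measurable_thick|].
    by apply: subset_trans cov1 _; exact: thick_le.
  have Q2 : 2 / 2 ^+ k * qsum F s2 <= eta / 4.
    apply: le_trans hk; rewrite ler_wpM2l ?divr_ge0 ?(ltW k0)//.
    exact: V2norm_ge c2.
  have Q3 : (size l3)%:R * (8 * 2 ^+ k * th' ^+ 2) <= eta / 4.
    rewrite th'2; have s3 : (size l3)%:R * th <= eta / (128 * 2 ^+ k).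
      by apply: le_trans sA; rewrite ler_wpM2r ?(ltW th0)// ler_nat.
    have := ler_wpM2l (ltW k0) s3.
    have -> : 2 ^+ k * (eta / (128 * 2 ^+ k)) = eta / 128 by field; rewrite gt_eqF.
    have -> : (size l3)%:R * (8 * 2 ^+ k * (4 * th)) = 32 * (2 ^+ k * ((size l3)%:R * th)) by
      ring.
    lra.
  lra.
Qed.

End SmallPartition.

(** * Interpolation along a partition *)

Section Sequences.
Variable R : realType.
Implicit Types (a : nat -> R) (g : nat -> nat).

Fixpoint running_min a n : R :=
  if n is n'.+1 then Num.min (running_min a n') (a n) else a 0%N.

Lemma running_min_le a i j : (i <= j)%N -> running_min a j <= running_min a i.
Proof.
move/subnK => <-; elim: (j - i)%N => [//|k IH]; rewrite addSn /=.
by apply: le_trans IH; rewrite ge_min lexx.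
Qed.

Lemma running_min_leq a n : running_min a n <= a n.
Proof. by case: n => [//|n] /=; rewrite ge_min lexx orbT. Qed.

Lemma running_min_gt0 a : (forall n, 0 < a n) -> forall n, 0 < running_min a n.
Proof. by move=> h; elim=> [|n IH] /=; [exact: h|rewrite lt_min IH h]. Qed.

Definition increasing g := forall i j, (i < j)%N -> (g i < g j)%N.

Lemma increasingS g : (forall i, (g i < g i.+1)%N) -> increasing g.
Proof.
move=> h i j; elim: j => [//|j IH]; rewrite ltnS leq_eqVlt => /orP[/eqP->//|/IH].
by move=> /ltn_trans; apply.
Qed.

Lemma increasing_ge g n : increasing g -> (n <= g n)%N.
Proof.
by move=> h; elim: n => [//|n IH]; apply: leq_ltn_trans IH (h _ _ (ltnSn _)).
Qed.

Lemma increasing_comp g g' : increasing g -> increasing g' -> increasing (g \o g').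
Proof. by move=> h h' i j ij; apply: h; exact: h'. Qed.

Lemma bolzano_weierstrass01 (y : nat -> R) : (forall n, 0 <= y n <= 1) ->
  exists g t, [/\ increasing g, 0 <= t <= 1 &
    forall r, 0 < r -> exists N, forall n, (N <= n)%N -> `|y (g n) - t| < r].
Proof.
move=> y01.
have [|g ig cg] := @bolzano_weierstrass R y.
  exists 1; split => // M M1 n _; have /andP[h0 h1] := y01 n.
  by rewrite /= ger0_norm// (le_trans h1)// ltW.
exists g, (limn (y \o g)); split.
- by move=> i j; rewrite !ltnNge; have := ig j i; rewrite !leEnat => ->.
- apply/andP; split.
    by apply: limr_ge => //; near=> n; case/andP: (y01 (g n)).
  by apply: limr_le => //; near=> n; case/andP: (y01 (g n)).
- move=> r r0; move/cvgrPdist_lt: cg => /(_ r r0) [N _ hN]; exists N => n Nn.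
  by rewrite distrC; exact: hN.
Unshelve. all: by end_near. Qed.

End Sequences.

Section Interpolation.
Variable R : realType.
Implicit Types (F : R -> R) (s : seq (R * R)) (l Z : seq R) (x y z d a b t u v : R).

Definition ramp u v t : R := clip ((t - u) / (v - u)).

Lemma ramp_le0 u v t : u <= v -> t <= u -> ramp u v t = 0.
Proof.
move=> uv tu; rewrite /ramp /clip max_l// ge_min; apply/orP; right.
by rewrite mulr_le0_ge0 ?subr_le0// invr_ge0 subr_ge0.
Qed.

Lemma ramp_ge1 u v t : u < v -> v <= t -> ramp u v t = 1.
Proof.
move=> uv vt; have h : 1 <= (t - u) / (v - u) by rewrite ler_pdivlMr; lra.
by rewrite /ramp /clip min_l// max_r.
Qed.

Lemma ramp_homo u v : u <= v -> {homo ramp u v : a b / a <= b}.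
Proof.
move=> uv a b ab; apply: clip_homo; rewrite ler_wpM2r ?invr_ge0 ?subr_ge0//; lra.
Qed.

Lemma ramp01 u v t : 0 <= ramp u v t <= 1.
Proof. by rewrite clip_ge0 clip_le1. Qed.

(** A sum of ramps is constant outside the partition and Lipschitz everywhere, and
    the quadratic variation of F along the partition is the total increase of the
    corresponding sum of squares, [energy]. *)
Definition interp F x l t : R :=
  F x + \sum_(I <- steps x l) (F I.2 - F I.1) * ramp I.1 I.2 t.

Definition energy F x l t : R :=
  \sum_(I <- steps x l) (F I.2 - F I.1) ^+ 2 * ramp I.1 I.2 t.

Lemma interp_cons F x y l t : interp F x (y :: l) t =
  F x - F y + (F y - F x) * ramp x y t + interp F y l t.
Proof. by rewrite /interp /steps /= big_cons -/(steps _ _) /=; lra. Qed.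

Lemma energy_cons F x y l t : energy F x (y :: l) t =
  (F y - F x) ^+ 2 * ramp x y t + energy F y l t.
Proof. by rewrite /energy /steps /= big_cons. Qed.

Lemma path_left d x l t : path (step d) x l -> t \in x :: l -> x <= t.
Proof.
elim: l x => [|y l IH] x /=; first by rewrite inE => _ /eqP->.
move=> /andP[/andP[xy _] /IH h]; rewrite inE => /orP[/eqP->//|/h]; exact: le_trans.
Qed.

Lemma interp_left F d x l t : path (step d) x l -> t <= x -> interp F x l t = F x.
Proof.
elim: l x => [|y l IH] x /=; first by rewrite /interp /steps /= big_nil addr0.
by move=> /andP[/andP[xy _] p] tx; rewrite interp_cons ramp_le0// IH ?(le_trans tx)//; lra.
Qed.

Lemma energy_left F d x l t : path (step d) x l -> t <= x -> energy F x l t = 0.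
Proof.
elim: l x => [|y l IH] x /=; first by rewrite /energy /steps /= big_nil.
by move=> /andP[/andP[xy _] p] tx; rewrite energy_cons ramp_le0// IH ?(le_trans tx)//; lra.
Qed.

Lemma ramp_right F x y t : x <= y -> y <= t -> (F y - F x) * ramp x y t = F y - F x.
Proof.
rewrite le_eqVlt => /orP[/eqP->|xy] yt; first by rewrite subrr mul0r.
by rewrite ramp_ge1// mulr1.
Qed.

Lemma interp_right F d x y l t : path (step d) x (y :: l) -> y <= t ->
  interp F x (y :: l) t = interp F y l t.
Proof.
by move=> /= /andP[/andP[xy _] _] yt; rewrite interp_cons ramp_right//; lra.
Qed.

Lemma interp_knot F d x l t : path (step d) x l -> t \in x :: l -> interp F x l t = F t.
Proof.
elim: l x => [|y l IH] x p.
  by rewrite inE => /eqP->; rewrite (interp_left F p).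
rewrite inE => /orP[/eqP->|tl]; first by rewrite (interp_left F p).
have /andP[_ p'] := p.
by rewrite (interp_right F p) ?IH// (path_left p').
Qed.

Lemma energy_homo F d x l : path (step d) x l -> {homo energy F x l : a b / a <= b}.
Proof.
elim: l x => [|y l IH] x /=; first by move=> _ a b _; rewrite /energy /steps /= !big_nil.
move=> /andP[/andP[xy _] p] a b ab; rewrite !energy_cons lerD ?IH//.
by rewrite ler_wpM2l ?sqr_ge0// ramp_homo.
Qed.

Lemma energy_ge0 F x l t : 0 <= energy F x l t.
Proof.
by apply: sumr_ge0 => I _; rewrite mulr_ge0 ?sqr_ge0//; case/andP: (ramp01 I.1 I.2 t).
Qed.

Lemma energy_le F x l t : energy F x l t <= qsum F (steps x l).
Proof.
apply: ler_sum => I _; rewrite ler_piMr ?sqr_ge0//; by case/andP: (ramp01 I.1 I.2 t).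
Qed.

Definition knot_free Z a b := forall z, z \in Z -> ~~ (a < z < b).

(** Inside a cell a single ramp moves, by an amount in [0, 1], which is at least its
    square. *)
Lemma interp_cell F d x l a b : path (step d) x l -> a <= b -> knot_free (x :: l) a b ->
  (interp F x l b - interp F x l a) ^+ 2 <= energy F x l b - energy F x l a.
Proof.
elim: l x => [|y l IH] x.
  by move=> _ _ _; rewrite /interp /energy /steps /= !big_nil !subrr expr0n.
move=> /= /andP[/andP[xy _] p] ab fr.
have [ya|ay] := leP y a.
  rewrite !interp_cons !energy_cons.
  have := IH y p ab; rewrite (ramp_right F xy ya) (ramp_right F xy (le_trans ya ab)).
  have : forall t, y <= t -> (F y - F x) ^+ 2 * ramp x y t = (F y - F x) ^+ 2.
    by move=> t yt; rewrite expr2 -mulrA ramp_right.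
  move=> h; rewrite !h ?(le_trans ya)//.
  have fr' : knot_free (y :: l) a b by move=> z zl; apply: fr; rewrite inE zl orbT.
  move=> /(_ fr').
  rewrite (_ : _ - (F x - F y + (F y - F x) + _) = interp F y l b - interp F y l a); last by
    lra.
  by move=> h'; apply: le_trans h' _; lra.
have yb : b <= y.
  have := fr y; rewrite !inE eqxx orbT => /(_ isT); rewrite ay /= -leNgt //.
rewrite !interp_cons !energy_cons !(interp_left F p) ?(energy_left F p)//; try by rewrite ltW.
set ra := ramp x y a; set rb := ramp x y b.
have rab : ra <= rb by exact: ramp_homo.
have /andP[ra0 _] := ramp01 x y a; have /andP[_ rb1] := ramp01 x y b.
rewrite (_ : _ - _ = (F y - F x) * (rb - ra)); last by lra.
rewrite exprMn (_ : (F y - F x) ^+ 2 * rb + 0 - _ = (F y - F x) ^+ 2 * (rb - ra)); last by lra.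
rewrite ler_wpM2l ?sqr_ge0// expr2 ler_piMr; rewrite -/ra -/rb in ra0 rb1; lra.
Qed.

Lemma chain_telescope (P : R -> R) x y s : {homo P : a b / a <= b} -> chain x y s ->
  \sum_(I <- s) (P I.2 - P I.1) <= P y - P x.
Proof.
move=> hP; elim: s x => [|I s IH] x /=; first by move=> /hP; rewrite big_nil subr_ge0.
move=> /and3P[/hP xI _ /IH]; rewrite big_cons; lra.
Qed.

(** The squared increments are dominated by those of the monotone function [energy],
    which telescope. *)
Lemma qsum_interp F d x l a b s : path (step d) x l -> chain a b s ->
  {in s, forall I, knot_free (x :: l) I.1 I.2} -> qsum (interp F x l) s <= qsum F (steps x l).
Proof.
move=> p cs fr; apply: (@le_trans _ _ (energy F x l b - energy F x l a)).
  apply: le_trans (chain_telescope (energy_homo F p) cs).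
  rewrite /qsum !big_seq; apply: ler_sum => I Is.
  by apply: (interp_cell F p) (fr _ Is); have [] := chain_mem cs Is.
have := energy_ge0 F x l a; have := energy_le F x l b; lra.
Qed.

Lemma interp_lipschitz F d x l : path (step d) x l -> exists2 K, 0 <= K &
  forall a b, a <= b -> `|interp F x l b - interp F x l a| <= K * (b - a).
Proof.
elim: l x => [|y l IH] x /=.
  move=> _; exists 0 => // a b _; rewrite /interp /steps /= !big_nil subrr normr0; lra.
move=> /andP[/andP[xy _] /IH [K K0 hK]].
pose L := `|F y - F x| / (y - x).
have L0 : 0 <= L by rewrite divr_ge0 ?subr_ge0.
exists (L + K); first by rewrite addr_ge0.
move=> a b ab; rewrite [leRHS]mulrDl !interp_cons.
set A := F x - F y + _ + _; set B := F x - F y + _ + _.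
have -> : A - B = (F y - F x) * (ramp x y b - ramp x y a) + (interp F y l b - interp F y l a).
  by rewrite /A /B; lra.
apply: le_trans (ler_normD _ _) _; apply: lerD (hK _ _ ab).
rewrite normrM /L -mulrA ler_wpM2l// ger0_norm; last by rewrite subr_ge0 ramp_homo.
apply: le_trans (clip_contract _) _; last by rewrite -mulrBl mulrC [X in X <= _](_ : _ = (y -
  x)^-1 * (b - a)) //; congr (_ * _); lra.
by rewrite ler_wpM2r ?invr_ge0 ?subr_ge0//; lra.
Qed.

Lemma sq_abs_cont_lipschitz (G : R -> R) K : 0 <= K ->
  (forall a b, a <= b -> `|G b - G a| <= K * (b - a)) -> sq_abs_cont G.
Proof.
move=> K0 h e e0; pose d := e / (K ^+ 2 + 1).
have K21 : 0 < K ^+ 2 + 1 by have := sqr_ge0 K; lra.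
have d0 : 0 < d by rewrite divr_gt0.
exists d => // s cs ss.
apply: (@le_trans _ _ (\sum_(I <- s) (K ^+ 2 * d) * (I.2 - I.1))).
  rewrite /qsum !big_seq; apply: ler_sum => I Is; have [_ I12 _] := chain_mem cs Is.
  have Id := allP ss _ Is.
  rewrite -real_normK ?num_real//; apply: (@le_trans _ _ ((K * (I.2 - I.1)) ^+ 2)).
    by rewrite ler_pXn2r ?nnegrE ?mulr_ge0 ?subr_ge0// h.
  rewrite exprMn -mulrA ler_wpM2l ?sqr_ge0// expr2 ler_wpM2r ?subr_ge0// ltW//.
rewrite -mulr_sumr; have hs : \sum_(I <- s) (I.2 - I.1) <= 1.
  by apply: le_trans (chain_telescope (P := id) (fun _ _ h => h) cs) _; rewrite subr0.
apply: (@le_trans _ _ (K ^+ 2 * d)).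
  by rewrite ler_piMr// mulr_ge0 ?sqr_ge0 ?(ltW d0).
rewrite /d mulrA ler_pdivrMr// mulrC ler_wpM2l ?(ltW e0)//; lra.
Qed.

Lemma qsum_lipschitz (G : R -> R) K : 0 <= K ->
  (forall a b, a <= b -> `|G b - G a| <= K * (b - a)) ->
  forall s, chain 0 1 s -> qsum G s <= K ^+ 2.
Proof.
move=> K0 h s cs.
apply: (@le_trans _ _ (\sum_(I <- s) K ^+ 2 * (I.2 - I.1))).
  rewrite /qsum !big_seq; apply: ler_sum => I Is; have [I0 I12 I1] := chain_mem cs Is.
  rewrite -real_normK ?num_real//; apply: (@le_trans _ _ ((K * (I.2 - I.1)) ^+ 2)).
    by rewrite ler_pXn2r ?nnegrE ?mulr_ge0 ?subr_ge0// h.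
  rewrite exprMn ler_wpM2l ?sqr_ge0// expr2 ler_piMr ?subr_ge0//; lra.
rewrite -mulr_sumr; have hs : \sum_(I <- s) (I.2 - I.1) <= 1.
  by apply: le_trans (chain_telescope (P := id) (fun _ _ h => h) cs) _; rewrite subr0.
by rewrite ler_piMr ?sqr_ge0.
Qed.

Lemma interp_between F d x l t : 0 < d -> path (step d) x l -> x <= t <= last x l ->
  exists u v k, [/\ u \in x :: l, v \in x :: l, u <= t <= v, v < u + d &
    0 <= k <= 1 /\ interp F x l t = (1 - k) * F u + k * F v].
Proof.
move=> d0; elim: l x => [|y l IH] x p.
  move=> /= xt; exists x, x, 0; rewrite mem_head; split => //; first lra.
  rewrite lexx ler01 (interp_left F p); [split => //; lra|by case/andP: xt].
move: (p) => /= /andP[/andP[xy yd] p'] /andP[xt tl].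
have [ty|yt] := leP t y.
  exists x, y, (ramp x y t); rewrite !inE !eqxx orbT xt ty ramp01; split => //; split => //.
  by rewrite interp_cons (interp_left F p')//; lra.
have [|u [v [k [ul vl uv vd [k01 e]]]]] := IH y p'; first by rewrite (ltW yt).
exists u, v, k; split => //; [by rewrite inE ul orbT|by rewrite inE vl orbT|split => //].
by rewrite (interp_right F p) ?(ltW yt).
Qed.

(** The case p = q covers the intervals that contain no point of Z. *)
Lemma first_last Z a b : a <= b -> exists p q, [/\ a <= p, p <= q, q <= b,
  forall z, z \in Z -> a <= z <= b -> p <= z <= q & p = q \/ (p \in Z /\ q \in Z)].
Proof.
move=> ab; suff : (exists p q, [/\ a <= p, p <= q, q <= b,
  forall z, z \in Z -> a <= z <= b -> p <= z <= q & p \in Z /\ q \in Z]) \/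
  (forall z, z \in Z -> ~~ (a <= z <= b)).
  case=> [[p [q [h1 h2 h3 h4 h5]]]|h]; first by exists p, q; split => //; right.
  exists b, b; split => //; [by move=> z /h /negP|by left].
elim: Z => [|y Z [[p [q [ap pq qb h [pZ qZ]]]]|h]]; first by right.
- have [/andP[ay yb]|yab] := boolP (a <= y <= b).
    left; exists (Num.min p y), (Num.max q y); split.
    + by rewrite le_min ap.
    + by rewrite ge_min le_max pq.
    + by rewrite ge_max qb.
    + move=> z; rewrite inE ge_min le_max => /orP[/eqP->|/h H /H /andP[-> ->]//].
      by rewrite lexx !orbT.
    + by split; [case: (leP p y)|case: (leP q y)]; rewrite inE ?eqxx ?pZ ?qZ ?orbT.
  left; exists p, q; split => //; last by rewrite !inE pZ qZ !orbT.
  by move=> z; rewrite inE => /orP[/eqP->|/h//]; rewrite (negbTE yab).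
- have [yab|yab] := boolP (a <= y <= b).
    left; exists y, y; case/andP: (yab) => ay yb; split => //; last by rewrite mem_head.
    by move=> z; rewrite inE => /orP[/eqP-> _|/h /negP//]; rewrite lexx.
  by right => z; rewrite inE => /orP[/eqP->|/h].
Qed.

Lemma free_short_right d l p p' : 0 < d -> path (step d) 0 l -> last 0 l = 1 ->
  0 <= p -> p <= p' -> p' <= 1 -> (forall z, z \in 0 :: l -> ~~ (p <= z < p')) ->
  p' - p < d.
Proof.
move=> d0 pl el p0 pp p1 h.
have [|u [v [k [ul vl /andP[up pv] vd _]]]] := interp_between (t := p) id d0 pl.
  by rewrite el p0 (le_trans pp).
have := h v vl; rewrite pv /= -leNgt; lra.
Qed.

Lemma free_short_left d l p p' : 0 < d -> path (step d) 0 l -> last 0 l = 1 ->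
  0 <= p -> p <= p' -> p' <= 1 -> (forall z, z \in 0 :: l -> ~~ (p < z <= p')) ->
  p' - p < d.
Proof.
move=> d0 pl el p0 pp p1 h.
have [|u [v [k [ul vl /andP[up pv] vd _]]]] := interp_between (t := p') id d0 pl.
  by rewrite el p1 (le_trans p0).
have := h u ul; rewrite up andbT -leNgt; lra.
Qed.

(** The interval [a, b] is cut at the extreme knots p <= q of the finer partition, and
    [p, q] at the extreme knots p' <= q' of the coarser one. Both interpolations
    agree with F at their own knots, so that the increments over [p', q'] cancel
    and only four increments within cells and two short increments of F remain. *)
Lemma split_chain F di dj li lj s : 0 < di -> 0 < dj ->
  path (step di) 0 li -> last 0 li = 1 -> path (step dj) 0 lj -> last 0 lj = 1 ->
  {subset 0 :: li <= 0 :: lj} -> chain 0 1 s ->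
  exists s1 s2 s3, [/\ chain 0 1 s1 /\ {in s1, forall I, knot_free (0 :: lj) I.1 I.2},
    chain 0 1 s2 /\ {in s2, forall I, knot_free (0 :: li) I.1 I.2},
    [/\ chain 0 1 s3, short di s3 & cov s3 `<=` cov s] &
    qsum (fun t => interp F 0 lj t - interp F 0 li t) s <=
      8 * qsum (interp F 0 lj) s1 + 8 * qsum (interp F 0 li) s2 + 4 * qsum F s3].
Proof.
move=> di0 dj0 pi ei pj ej sub.
set wi := interp F 0 li; set wj := interp F 0 lj.
suff H x : 0 <= x -> chain x 1 s -> exists s1 s2 s3,
    [/\ chain x 1 s1 /\ {in s1, forall I, knot_free (0 :: lj) I.1 I.2},
      chain x 1 s2 /\ {in s2, forall I, knot_free (0 :: li) I.1 I.2},
      [/\ chain x 1 s3, short di s3 & cov s3 `<=` cov s] &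
      qsum (fun t => wj t - wi t) s <= 8 * qsum wj s1 + 8 * qsum wi s2 + 4 * qsum F s3].
  exact: H.
elim: s x => [|[a b] s IH] x x0 cs.
  exists [::], [::], [::]; rewrite !qsum_nil; split => //.
move: cs => /= /and3P[xa ab cs]; have b1 := chain_le cs.
have b0 : 0 <= b by lra.
have [s1 [s2 [s3 [[c1 f1] [c2 f2] [c3 ss3 v3] Q]]]] := IH b b0 cs.
have [p [q [ap pq qb hpq kpq]]] := first_last (0 :: lj) ab.
have [p' [q' [pp' pq' qq' hpq' kpq']]] := first_last (0 :: li) pq.
have Ej : wj q - wj p = F q - F p.
  by case: kpq => [->|[kp kq]]; rewrite ?subrr// /wj !(interp_knot F pj).
have Ei : wi q' - wi p' = F q' - F p'.
  by case: kpq' => [->|[kp kq]]; rewrite ?subrr// /wi !(interp_knot F pi).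
have hij z : z \in 0 :: li -> a <= z <= b -> p' <= z <= q'.
  by move=> zl zab; apply: hpq' => //; apply: hpq => //; exact: sub.
exists ((a, p) :: (q, b) :: s1), ((a, p') :: (q', b) :: s2), ((p, p') :: (q', q) :: s3).
split.
- split; first by rewrite /= c1 xa ap pq qb.
  move=> I; rewrite !inE => /or3P[/eqP->|/eqP->|/f1//] z zl /=; apply/negP => hz.
    have := hpq z zl; rewrite (_ : a <= z <= b); [move/(_ isT)|]; lra.
  have := hpq z zl; rewrite (_ : a <= z <= b); [move/(_ isT)|]; lra.
- split; first by rewrite /= c2 xa /= (le_trans ap pp') pq' (le_trans qq' qb).
  move=> I; rewrite !inE => /or3P[/eqP->|/eqP->|/f2//] z zl /=; apply/negP => hz.
    have := hij z zl; rewrite (_ : a <= z <= b); [move/(_ isT)|]; lra.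
  have := hij z zl; rewrite (_ : a <= z <= b); [move/(_ isT)|]; lra.
- split.
  + rewrite /= (chain_weaken qb (lexx _) c3) pp' pq' qq' /=; lra.
  + rewrite /= ss3 andbT; apply/andP; split.
      apply: (free_short_right di0 pi ei) => //; [lra|lra|] => z zl; apply/negP => hz.
      have := hij z zl; rewrite (_ : a <= z <= b); [move/(_ isT)|]; lra.
    apply: (free_short_left di0 pi ei) => //; [lra|lra|] => z zl; apply/negP => hz.
    have := hij z zl; rewrite (_ : a <= z <= b); [move/(_ isT)|]; lra.
  + by rewrite !cov_cons => z [/= h|[/= h|/v3 h]]; [left; rewrite /=; lra|left; rewrite /=;
    lra|right].
- rewrite !qsum_cons /=.
  set A1 := wj p - wj a; set A2 := wj b - wj q; set A3 := wi p' - wi a; set A4 := wi b - wi q'.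
  set B1 := F p' - F p; set B2 := F q - F q'.
  have -> : wj b - wi b - (wj a - wi a) = (A1 + A2 - A3 - A4) + (B1 + B2).
    by rewrite /A1 /A2 /A3 /A4 /B1 /B2; lra.
  suff : ((A1 + A2 - A3 - A4) + (B1 + B2)) ^+ 2 <=
     8 * (A1 ^+ 2 + A2 ^+ 2) + 8 * (A3 ^+ 2 + A4 ^+ 2) + 4 * (B1 ^+ 2 + B2 ^+ 2) by lra.
  have := sqr_ge0 (A1 + A2 - A3 - A4 - (B1 + B2)); have := sqr_ge0 (B1 - B2).
  have := sqr_ge0 (A1 + A2 + A3 + A4); have := sqr_ge0 (A1 - A2); have := sqr_ge0 (A3 - A4).
  by rewrite !expr2; lra.
Qed.

Lemma conv_abs (k a b c : R) : 0 <= k <= 1 -> `|a| <= c -> `|b| <= c ->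
  `|(1 - k) * a + k * b| <= c.
Proof.
move=> /andP[k0 k1] ha hb; apply: le_trans (ler_normD _ _) _.
rewrite !normrM (ger0_norm k0) (@ger0_norm _ (1 - k)) ?subr_ge0//.
have h1 := ler_wpM2l k0 hb; have k1' : 0 <= 1 - k by lra.
have h2 := ler_wpM2l k1' ha; lra.
Qed.

End Interpolation.

(** * An explicit approximating sequence *)

Section Good.
Variables (R : realType) (f : {i01 R} -> R).
Hypothesis fV : (V2norm f < +oo)%E.
Implicit Types (s : seq (R * R)) (x y z t d e : R).
Notation F := (ext f).
Notation D := (discrete_mass f).

(** Otherwise pairs of points violating the bound would accumulate at a point t, and
    both values would be within d0 + e / 2 of F t. *)
Lemma osc_uniform d0 e : (supnorm (osc f) <= d0%:E)%E -> 0 < e ->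
  exists2 d, 0 < d & forall x y, 0 <= x <= 1 -> 0 <= y <= 1 -> `|x - y| < d ->
    `|F x - F y| <= 2 * d0 + e.
Proof.
move=> hd e0; apply: contrapT => H.
have bad n : exists xy : R * R, [/\ 0 <= xy.1 <= 1, 0 <= xy.2 <= 1,
    `|xy.1 - xy.2| < n.+1%:R^-1 & 2 * d0 + e < `|F xy.1 - F xy.2| ].
  apply: contrapT => G; apply: H; exists n.+1%:R^-1; first by rewrite invr_gt0.
  move=> x y x01 y01 xy; rewrite leNgt; apply/negP => h.
  by apply: G; exists (x, y).
have [xy hxy] := choice bad.
have x01 n : 0 <= (xy n).1 <= 1 by have [] := hxy n.
have [g [t [ig t01 ht]]] := bolzano_weierstrass01 x01.
case/andP: (t01) => t0 t1.
have : (osc f (clip01 t) < (d0 + e / 2)%:E)%E.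
  apply: (@le_lt_trans _ _ d0%:E); last by rewrite lte_fin; lra.
  apply: le_trans hd; apply: le_trans (lee_abs _) _.
  by apply: ereal_sup_ubound; exists (clip01 t).
case/ereal_inf_lt => _ [V [[U oU ->] /= Ut] <-] hV.
have hV' x : 0 <= x <= 1 -> U x -> `|F x - F t| <= d0 + e / 2.
  move=> /andP[x0 x1] Ux; rewrite -lee_fin; apply: le_trans (ltW hV).
  by apply: ereal_sup_ubound; exists (clip01 x) => //=; rewrite clip_id.
rewrite clip_id// in Ut.
have [r /= r0 hr] := oU _ Ut.
have [N hN] := ht (r / 2) ltac:(by lra).
pose n := maxn N (Num.bound (r / 2)^-1).
have [_ y01 xyn hn] := hxy (g n).
have xt : `|(xy (g n)).1 - t| < r / 2 by apply: hN; rewrite leq_maxl.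
have yr : `|(xy (g n)).1 - (xy (g n)).2| < r / 2.
  apply: lt_le_trans xyn _; rewrite -[leRHS]invrK lef_pV2 ?posrE ?invr_gt0//; last lra.
  have r2 : 0 <= (r / 2)^-1 by rewrite invr_ge0; lra.
  apply: le_trans (ltW (archi_boundP r2)) _; rewrite ler_nat.
  by apply: leqW; apply: leq_trans (increasing_ge _ ig); rewrite leq_maxr.
have h1 : `|F (xy (g n)).1 - F t| <= d0 + e / 2.
  by apply: hV' => //; apply: hr => /=; rewrite distrC; lra.
have h2 : `|F (xy (g n)).2 - F t| <= d0 + e / 2.
  apply: hV' => //; apply: hr => /=; rewrite distrC.
  have := ler_distD (xy (g n)).1 (xy (g n)).2 t; rewrite (distrC (xy (g n)).2 (xy (g n)).1);
    lra.
have := ler_distD (F t) (F (xy (g n)).1) (F (xy (g n)).2).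
rewrite (distrC (F t) (F (xy (g n)).2)); lra.
Qed.

Lemma path_right d x l z : path (step d) x l -> z \in x :: l -> z <= last x l.
Proof.
elim: l x => [|y l IH] x p; first by rewrite inE => /eqP->.
rewrite inE => /orP[/eqP->|zl]; first exact: (path_step_le p).
by case/andP: p => _ p; exact: IH.
Qed.

Lemma qsum_eq01 (G H : R -> R) s : (forall t, 0 <= t <= 1 -> G t = H t) -> chain 0 1 s ->
  qsum G s = qsum H s.
Proof.
move=> h cs; rewrite /qsum !big_seq; apply: eq_bigr => I Is.
have [h0 h1 h2] := chain_mem cs Is.
by rewrite !h// ?h0 ?h2 ?(le_trans h0)// ?(le_trans h1).
Qed.

Lemma qsum_bounded01 (G : R -> R) C : clipped G -> (forall s, chain 0 1 s -> qsum G s <= C) ->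
  qsum_bounded G C.
Proof. by move=> cG h x y s /clip_chain[s' [cs' _ <-]]//; exact: h. Qed.

(** At each stage [small_partition] is made to include the previous partition and the
    finitely many atoms that have become large. *)
Lemma nested_partitions (d : nat -> R) (eta : nat -> R) :
  (forall n, 0 < d n) -> (forall n, 0 < eta n) ->
  exists Q : nat -> seq R, forall n, [/\ path (step (d n)) 0 (Q n), last 0 (Q n) = 1,
    {subset 0 :: Q n <= 0 :: Q n.+1},
    forall t, 0 <= t <= 1 -> n.+1%:R^-1 < mu_real f [set t] -> t \in 0 :: Q n &
    qsum F (steps 0 (Q n)) <= D + eta n].
Proof.
move=> d0 eta0.
pose P (nR : nat * seq R) Q := [/\ path (step (d nR.1)) 0 Q, last 0 Q = 1,
    forall t, t \in nR.2 -> 0 <= t <= 1 -> t \in 0 :: Q,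
    forall t, 0 <= t <= 1 -> nR.1.+1%:R^-1 < mu_real f [set t] -> t \in 0 :: Q &
    qsum F (steps 0 Q) <= D + eta nR.1].
have exQ nR : exists Q, P nR Q.
  case: nR => n R0.
  have n0 : 0 < n.+1%:R^-1 :> R by rewrite invr_gt0.
  have [th [A [th0 _ _ sA hA]]] := large_atoms fV 1 n0.
  have [Q [p e sub q]] := small_partition fV (A ++ R0) (eta0 n) (d0 n).
  exists Q; split => //.
    by move=> t tR; apply: sub; rewrite mem_cat tR orbT.
  move=> t t01 ht; apply: sub => //; rewrite mem_cat; apply/orP; left.
  apply: contraLR ht => /(hA t t01) ht; rewrite -leNgt; apply: le_trans ht _.
  apply: le_trans sA; rewrite natrD mulrDl mul1r lerDl.
  by rewrite mulr_ge0// ltW.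
have [g hg] := choice exQ.
pose fix Q (n : nat) : seq R := g (n, if n is m.+1 then Q m else [::]).
have QE n : Q n = g (n, if n is m.+1 then Q m else [::]) by case: n.
exists Q => n.
have [p e _ a q] := hg (n, if n is m.+1 then Q m else [::]); rewrite -QE in p e a q.
split => // z zQ.
have [_ _ sub _ _] := hg (n.+1, Q n); rewrite -(QE n.+1) /= in sub.
have z01 : 0 <= z <= 1 by rewrite (path_left p zQ) -e (path_right p zQ).
move: zQ; rewrite inE => /orP[/eqP->|zQ]; first by rewrite mem_head.
exact: sub.
Qed.

(** The interpolations of F along nested partitions of small quadratic variation. By
    [split_chain], the squared increments of k j - k i over a chain are at most 8 times
    those of k j and of k i inside cells, that is twice 8 D up to an error, plus 4 times
    short squared increments of F, which are bounded by the mass of the chain. At a point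
    t the sequence converges because t is eventually a point of the partitions, or else
    carries no atom and is a point of continuity of F. *)
Lemma approximating_sequence (d0 : R) (eta : nat -> R) : (supnorm (osc f) <= d0%:E)%E ->
  (forall n, 0 < eta n) -> (forall i j, (i <= j)%N -> eta j <= eta i) ->
  exists (k : nat -> {i01 R} -> R) C,
  [/\ (forall n, k n (zero01 R) = f (zero01 R)),
      (forall n, sq_abs_cont (ext (k n))) /\ (forall n, qsum_bounded (ext (k n)) C),
      (forall (t : {i01 R}) e, 0 < e -> exists N, forall n, (N <= n)%N -> `|k n t - f t| <= e),
      (forall i j, (i < j)%N -> forall t : {i01 R}, `|k j t - k i t| <= 2 * d0 + eta i) &
      (forall i j, (i < j)%N -> forall s, chain 0 1 s ->
        qsum (ext (k j \- k i)) s <= 4 * mu_real f (cov s) + 16 * D + eta i)].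
Proof.
move=> hd0 eta0 eta_le.
have exd n : exists d, [/\ 0 < d, d <= n.+1%:R^-1,
    forall s, chain 0 1 s -> short d s -> qsum F s <= mu_real f (cov s) + eta n / 20 &
    forall x y, 0 <= x <= 1 -> 0 <= y <= 1 -> `|x - y| < 2 * d -> `|F x - F y| <= 2 * d0 + eta
      n].
  have e20 : 0 < eta n / 20 by have := eta0 n; lra.
  have [d1 d10 h1] := upper_chain fV e20.
  have [d2 d20 h2] := osc_uniform hd0 (eta0 n).
  exists (Num.min n.+1%:R^-1 (Num.min d1 (d2 / 2))); split.
  - by rewrite !lt_min invr_gt0 ltr0n d10 /=; lra.
  - by rewrite ge_min lexx.
  - by move=> s cs ss; apply: h1 => //; apply: short_le ss; rewrite !ge_min lexx orbT.
  - move=> x y x01 y01 xy; apply: h2 => //; apply: lt_le_trans xy _.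
    have : Num.min n.+1%:R^-1 (Num.min d1 (d2 / 2)) <= d2 / 2 by rewrite !ge_min lexx !orbT.
    lra.
have [d hd] := choice exd.
have dpos n : 0 < d n by have [] := hd n.
pose d' := running_min d.
have d'0 n : 0 < d' n := running_min_gt0 dpos n.
have d'le i j : (i <= j)%N -> d' j <= d i.
  by move=> ij; apply: le_trans (running_min_le d ij) (running_min_leq d i).
have eta20 n : 0 < eta n / 20 by have := eta0 n; lra.
have [Q hQ] := nested_partitions d'0 eta20.
have pQ n : path (step (d' n)) 0 (Q n) by have [] := hQ n.
have eQ n : last 0 (Q n) = 1 by have [] := hQ n.
have qQ n : qsum F (steps 0 (Q n)) <= D + eta n / 20 by have [] := hQ n.
have subQ i j : (i <= j)%N -> {subset 0 :: Q i <= 0 :: Q j}.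
  move/subnK => <-; elim: (j - i)%N => [//|m IH] z /IH; rewrite addSn.
  by have [_ _ sub _ _] := hQ (m + i)%N; exact: sub.
have inQ n z : z \in 0 :: Q n -> 0 <= z <= 1.
  by move=> zQ; rewrite (path_left (pQ n) zQ) -(eQ n) (path_right (pQ n) zQ).
pose w n := interp F 0 (Q n).
pose k n : {i01 R} -> R := fun t : {i01 R} => w n (val01 t).
have kE n t : 0 <= t <= 1 -> ext (k n) t = w n t.
  by move=> /andP[t0 t1]; rewrite /ext /k val01_clip clip_id.
have D0 : 0 <= D by apply: fine_ge0; apply: esum_ge0 => t _; rewrite mu01_set1// lee_fin
  mu_real_ge0.
have pair i j : (i < j)%N -> forall s, chain 0 1 s ->
    qsum (ext (k j \- k i)) s <= 4 * mu_real f (cov s) + 16 * D + eta i.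
  move=> ij s cs.
  have [s1 [s2 [s3 [[c1 f1] [c2 f2] [c3 ss3 v3] q]]]] :=
    split_chain F (d'0 i) (d'0 j) (pQ i) (eQ i) (pQ j) (eQ j) (subQ _ _ (ltnW ij)) cs.
  rewrite (qsum_eq01 (H := fun t => w j t - w i t) _ cs); last first.
    by move=> t t01; rewrite -!kE.
  apply: le_trans q _.
  have q1 := le_trans (qsum_interp F (pQ j) c1 f1) (qQ j).
  have q2 := le_trans (qsum_interp F (pQ i) c2 f2) (qQ i).
  have [_ _ up _] := hd i.
  have q3 := up s3 c3 (short_le (d'le i i (leqnn i)) ss3).
  have q4 : mu_real f (cov s3) <= mu_real f (cov s) by apply: mu_real_le => //; exact:
    measurable_cov.
  have := eta_le _ _ (ltnW ij); have := eta0 i; lra.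
have cell n t : 0 <= t <= 1 -> exists u v c, [/\ 0 <= u <= 1, 0 <= v <= 1,
    `|u - t| < d' n, `|v - t| < d' n & 0 <= c <= 1 /\ w n t = (1 - c) * F u + c * F v].
  move=> t01; have [|u [v [c [uQ vQ utv vd [c01 e]]]]] := interp_between F (t := t) (d'0 n) (pQ
    n).
    by rewrite eQ.
  by exists u, v, c; split; [exact: (inQ n)|exact: (inQ n)|rewrite ltr_norml; lra|rewrite
    ltr_norml; lra|split].
have [K K0 hK] := interp_lipschitz F (pQ 0%N).
pose T := mu_real f setT.
(* k n is compared with the Lipschitz function k 0. *)
exists k, (2 * (4 * T + 16 * D + eta 0%N) + 2 * K ^+ 2); split.
- move=> n; rewrite /k /w (interp_knot F (pQ n)) ?mem_head//.
  by rewrite -[X in F X]/(val01 (zero01 R)) ext_val.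
- split=> n.
    have [Kn Kn0 hKn] := interp_lipschitz F (pQ n).
    move=> e e0; have [dd dd0 hdd] := sq_abs_cont_lipschitz Kn0 hKn e0.
    by exists dd => // s cs ss; rewrite (qsum_eq01 (kE n) cs); exact: hdd.
  apply: qsum_bounded01 => [|s cs]; first exact: ext_clip.
  have B0 : qsum (ext (k 0%N)) s <= K ^+ 2.
    by rewrite (qsum_eq01 (kE 0%N) cs); exact: qsum_lipschitz.
  have T0 : 0 <= T by exact: mu_real_ge0.
  case: n => [|n].
    by have := eta0 0%N; have := sqr_ge0 K; lra.
  have := pair 0%N n.+1 isT s cs.
  have : mu_real f (cov s) <= T by apply: mu_real_le => //; exact: measurable_cov.
  suff : qsum (ext (k n.+1)) s <= 2 * qsum (ext (k n.+1 \- k 0%N)) s + 2 * qsum (ext (k 0%N)) s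
    by lra.
  rewrite /qsum !mulr_sumr -big_split /=; apply: ler_sum => I _.
  rewrite /ext /=; set a := k n.+1 _; set b := k n.+1 _; set a' := k 0%N _; set b' := k 0%N _.
  have := sqr_ge0 ((a - a' - (b - b')) - (a' - b')); rewrite !expr2; lra.
- move=> t e e0; set x := val01 t.
  have x01 : 0 <= x <= 1 by rewrite val01_ge0 val01_le1.
  have fE : f t = F x by rewrite ext_val.
  have [a0|a0] := ltP 0 (mu_real f [set x]).
    exists (Num.bound (mu_real f [set x])^-1) => n Nn; rewrite fE /k /w (interp_knot F (pQ n)).
      by rewrite subrr normr0 ltW.
    have [_ _ _ h _] := hQ n; apply: h => //.
    rewrite -[ltRHS]invrK ltf_pV2 ?posrE ?invr_gt0//.
    have a1 : 0 <= (mu_real f [set x])^-1 by rewrite invr_ge0 ltW.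
    by apply: lt_le_trans (archi_boundP a1) _; rewrite ler_nat leqW.
  have e20 : 0 < e ^+ 2 by rewrite exprn_gt0.
  have [r r0 hr] := small_jump fV x01 (le_lt_trans a0 e20).
  have r1 : 0 <= r^-1 by rewrite invr_ge0 ltW.
  exists (Num.bound r^-1) => n Nn.
  have dr : d' n <= r.
    apply: le_trans (d'le n n (leqnn n)) _; have [_ dn _ _] := hd n; apply: le_trans dn _.
    rewrite -[leRHS]invrK lef_pV2 ?posrE ?invr_gt0//.
    by apply: le_trans (ltW (archi_boundP r1)) _; rewrite ler_nat leqW.
  have [u [v [c [u01 v01 ut vt [c01 e1]]]]] := cell n x x01.
  have hF y : 0 <= y <= 1 -> `|y - x| < d' n -> `|F y - F x| <= e.
    move=> y01 yx; have := hr y y01 (lt_le_trans yx dr).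
    by rewrite -[X in X <= _]real_normK ?num_real// ler_pXn2r ?nnegrE ?(ltW e0).
  rewrite fE /k e1 (_ : _ - _ = (1 - c) * (F u - F x) + c * (F v - F x)); last lra.
  by apply: conv_abs => //; apply: hF.
- move=> i j ij t; set x := val01 t.
  have x01 : 0 <= x <= 1 by rewrite val01_ge0 val01_le1.
  have [u [v [c [u01 v01 ux vx [c01 e1]]]]] := cell i x x01.
  have [u' [v' [c' [u'01 v'01 u'x v'x [c'01 e1']]]]] := cell j x x01.
  have hF y y' : 0 <= y <= 1 -> 0 <= y' <= 1 -> `|y - x| < d' i -> `|y' - x| < d' j ->
      `|F y' - F y| <= 2 * d0 + eta i.
    move=> y01 y'01 yx y'x; have [_ _ _ h] := hd i; apply: h => //.
    have h1 := d'le i i (leqnn i); have h2 := d'le i j (ltnW ij).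
    have := ler_distD x y' y; rewrite (distrC x y); lra.
  rewrite /k -/x e1 e1'.
  have -> : (1 - c') * F u' + c' * F v' - ((1 - c) * F u + c * F v) =
     (1 - c') * ((1 - c) * (F u' - F u) + c * (F u' - F v)) +
     c' * ((1 - c) * (F v' - F u) + c * (F v' - F v)) by ring.
  by apply: conv_abs => //; apply: conv_abs => //; apply: hF.
- exact: pair.
Qed.

End Good.

(** * Convex combinations of small variation *)

Section Weights.
Variable R : realType.
Implicit Types (c : nat -> R) (x : nat -> R -> R) (s : seq (R * R)) (N K M : nat).

Definition weights N K c := [/\ forall i, 0 <= c i,
  forall i, ~~ (N <= i < K)%N -> c i = 0 & \sum_(i < K) c i = 1].

Definition comb K c x : R -> R := fun t => \sum_(i < K) c i * x i t.

Lemma jensen_sqr K (c a : 'I_K -> R) : (forall i, 0 <= c i) -> \sum_i c i = 1 ->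
  (\sum_i c i * a i) ^+ 2 <= \sum_i c i * a i ^+ 2.
Proof.
move=> c0 c1.
have E S : \sum_i c i * (a i - S) ^+ 2 =
    \sum_i c i * a i ^+ 2 - 2 * S * (\sum_i c i * a i) + S ^+ 2 * (\sum_i c i).
  rewrite !mulr_sumr -sumrB -big_split /=; apply: eq_bigr => i _; ring.
set S := \sum_i c i * a i.
have : 0 <= \sum_i c i * (a i - S) ^+ 2 by apply: sumr_ge0 => i _; rewrite mulr_ge0 ?sqr_ge0.
rewrite E c1 -/S !expr2; lra.
Qed.

Lemma sqr_sum_le K (a : 'I_K -> R) : (\sum_i a i) ^+ 2 <= K%:R * \sum_i a i ^+ 2.
Proof.
case: K a => [|K] a; first by rewrite !big_ord0 expr0n mulr0.
have K0 : (0 : R) < K.+1%:R by rewrite ltr0n.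
have := @jensen_sqr K.+1 (fun=> K.+1%:R^-1) a (fun=> _).
rewrite invr_ge0 (ltW K0) => /(_ (fun=> isT)).
have -> : \sum_(i < K.+1) K.+1%:R^-1 = 1 :> R.
  by rewrite sumr_const card_ord -[_ *+ _]mulr_natr mulVf// gt_eqF.
move=> /(_ erefl); rewrite -!mulr_sumr exprMn => h.
have := ler_wpM2l (ltW (mulr_gt0 K0 K0)) h.
have -> : K.+1%:R * K.+1%:R * (K.+1%:R^-1 ^+ 2 * (\sum_i a i) ^+ 2) = (\sum_i a i) ^+ 2 :> R.
  by field; rewrite gt_eqF.
have -> : K.+1%:R * K.+1%:R * (K.+1%:R^-1 * \sum_i a i ^+ 2) = K.+1%:R * \sum_i a i ^+ 2 :> R.
  by field; rewrite gt_eqF.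
by [].
Qed.

Lemma comb_qsum N K c x s B : weights N K c ->
  (forall i, (N <= i < K)%N -> qsum (x i) s <= B) -> qsum (comb K c x) s <= B.
Proof.
move=> [c0 cz c1] h.
apply: (@le_trans _ _ (\sum_(i < K) c i * qsum (x i) s)).
  rewrite /qsum; under [leRHS]eq_bigr do rewrite mulr_sumr.
  rewrite exchange_big /=; apply: ler_sum => I _.
  have -> : comb K c x I.2 - comb K c x I.1 = \sum_(i < K) c i * (x i I.2 - x i I.1).
    by rewrite /comb -sumrB; apply: eq_bigr => i _; rewrite mulrBr.
  exact: (jensen_sqr (c := fun i : 'I_K => c i)).
rewrite -[B]mul1r -c1 mulr_suml; apply: ler_sum => i _.
have [iN|iN] := boolP (N <= i)%N; first by rewrite ler_wpM2l// h// iN /=.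
by rewrite cz ?mul0r// negb_and iN.
Qed.

Lemma comb_abs N K c x t B : weights N K c ->
  (forall i, (N <= i < K)%N -> `|x i t| <= B) -> `|comb K c x t| <= B.
Proof.
move=> [c0 cz c1] h; apply: le_trans (ler_norm_sum _ _ _) _.
rewrite -[B]mul1r -c1 mulr_suml; apply: ler_sum => i _; rewrite normrM (ger0_norm (c0 i)).
have [iN|iN] := boolP (N <= i)%N; first by rewrite ler_wpM2l// h// iN /=.
by rewrite cz ?mul0r// negb_and iN.
Qed.

Lemma comb_sub K c x t a : \sum_(i < K) c i = 1 ->
  comb K c x t - a = comb K c (fun i t => x i t - a) t.
Proof.
move=> c1; rewrite /comb; under [RHS]eq_bigr do rewrite mulrBr.
by rewrite sumrB -mulr_suml c1 mul1r.
Qed.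

Lemma comb_widen N K K' c x t : weights N K c -> (K <= K')%N ->
  \sum_(i < K') c i * x i t = comb K c x t.
Proof.
move=> [_ cz _] KK; rewrite /comb [RHS](big_ord_widen K' (fun i => c i * x i t))//.
rewrite [RHS]big_mkcond /=; apply: eq_bigr => i _; case: ifP => // iK.
by rewrite cz ?mul0r// iK andbF.
Qed.

Lemma weights_delta N i : (N <= i)%N -> weights N i.+1 (fun j => (j == i)%:R).
Proof.
move=> Ni; split => [j|j|]; first by rewrite ler0n.
  by case: eqP => [->|//]; rewrite Ni ltnSn.
rewrite big_ord_recr /= eqxx big1 ?add0r// => j _.
by case: eqP => // e; have := ltn_ord j; rewrite e ltnn.
Qed.

Lemma comb_delta i x t : comb i.+1 (fun j => (j == i)%:R) x t = x i t.
Proof.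
rewrite /comb big_ord_recr /= eqxx mul1r big1 ?add0r// => j _.
by case: eqP => e; rewrite ?mul0r//; have := ltn_ord j; rewrite e ltnn.
Qed.

Lemma weights_avg N M (Kf : nat -> nat) (c : nat -> nat -> R) : (0 < M)%N ->
  (forall j, weights N (Kf j) (c j)) -> exists K c', weights N K c' /\
  forall x t, comb K c' x t = M%:R^-1 * \sum_(j < M) comb (Kf j) (c j) x t.
Proof.
move=> M0 hc; pose K := (\sum_(j < M) Kf j)%N.
have KK (j : 'I_M) : (Kf j <= K)%N by rewrite /K (bigD1 j)//= leq_addr.
exists K, (fun i => M%:R^-1 * \sum_(j < M) c j i).
have E x t : comb K (fun i => M%:R^-1 * \sum_(j < M) c j i) x t =
    M%:R^-1 * \sum_(j < M) comb (Kf j) (c j) x t.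
  rewrite /comb mulr_sumr.
  under eq_bigr do rewrite -mulrA mulr_suml mulr_sumr.
  rewrite exchange_big /=; apply: eq_bigr => j _.
  by rewrite -mulr_sumr (comb_widen x t (hc j) (KK j)).
split => //; split.
- move=> i; rewrite mulr_ge0 ?invr_ge0// sumr_ge0// => j _; by have [h _ _] := hc j.
- move=> i hi; rewrite big1 ?mulr0// => j _; have [_ h _] := hc j; apply: h.
  by apply: contra hi => /andP[-> /leq_trans]; apply.
- have := E (fun _ _ => 1) 0; rewrite /comb; under eq_bigr do rewrite mulr1.
  move=> ->; under eq_bigr do under eq_bigr do rewrite mulr1.
  have -> : \sum_(j < M) \sum_(i < Kf j) c j i = \sum_(j < M) 1 :> R.
    by apply: eq_bigr => j _; have [_ _ ->] := hc j.
  by rewrite sumr_const card_ord mulVf// pnatr_eq0 -lt0n.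
Qed.

Lemma sq_abs_cont_comb N K c x : weights N K c -> (forall i, sq_abs_cont (x i)) -> sq_abs_cont
  (comb K c x).
Proof.
move=> hc hx e e0.
have ex i : exists d, 0 < d /\ forall s, chain 0 1 s -> short d s -> qsum (x i) s <= e.
  by have [d d0 h] := hx i e e0; exists d.
have [d hd] := choice ex.
exists (running_min d K); first by apply: running_min_gt0 => i; have [] := hd i.
move=> s cs ss; apply: comb_qsum hc _ => i /andP[_ iK]; have [_ h] := hd i; apply: h => //.
by apply: short_le ss; apply: le_trans (running_min_le d (ltnW iK)) (running_min_leq d i).
Qed.

Lemma eventually_subseq (P : nat -> nat -> Prop) :
  (forall n, exists K, forall m, (K <= m)%N -> P n m) ->
  exists g, increasing g /\ forall i j, (i < j)%N -> P (g i) (g j).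
Proof.
move=> /choice[K hK]; pose fix g n := if n is m.+1 then maxn (g m).+1 (K (g m)) else 0%N.
have ig : increasing g by apply: increasingS => i /=; rewrite leq_maxl.
exists g; split => // i j ij; apply: hK.
apply: (@leq_trans (g i.+1)); first by rewrite /= leq_maxr.
by move: ij; rewrite leq_eqVlt => /orP[/eqP->//|/ig /ltnW].
Qed.

Lemma frequently_subseq (P : nat -> Prop) : (forall N, exists2 n, (N <= n)%N & P n) ->
  exists g, increasing g /\ forall i, P (g i).
Proof.
move=> H; have ex N : exists n, (N <= n)%N /\ P n by have [n h p] := H N; exists n.
have [h hh] := choice ex; pose fix g n := if n is m.+1 then h (g m).+1 else h 0%N.
exists g; split; first by apply: increasingS => i /=; have [] := hh (g i).+1.
by case=> [|n] /=; [have [] := hh 0%N|have [] := hh (g n).+1].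
Qed.

End Weights.

Section SupNull.
Variables (R : realType) (x : nat -> R -> R) (C e : R).
Hypothesis e0 : 0 < e.
Hypothesis xbv : forall n s, chain 0 1 s -> qsum (x n) s <= C.
Hypothesis xnull : forall t d, 0 <= t <= 1 -> 0 < d ->
  exists N, forall n, (N <= n)%N -> `|x n t| < d.
Implicit Types (T : seq R) (g : nat -> nat) (r t y : R).

Definition large_near T g := forall r, 0 < r -> exists N, forall n, (N <= n)%N ->
  forall t, t \in T -> exists y, [/\ 0 <= y <= 1, `|y - t| < r & e <= `|x (g n) y| ].

Lemma null_on_seq T g d : in01 T -> increasing g -> 0 < d ->
  exists N, forall n, (N <= n)%N -> forall t, t \in T -> `|x (g n) t| < d.
Proof.
move=> + ig d0; elim: T => [|t T IH] /=; first by exists 0%N.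
case/andP=> t01 /IH [N hN]; have [N' hN'] := xnull t01 d0.
exists (maxn N N') => n; rewrite geq_max => /andP[Nn Nn'] z.
rewrite inE => /orP[/eqP->|]; last exact: hN.
by apply: hN'; apply: leq_trans Nn' _; exact: increasing_ge.
Qed.

Lemma separated T : uniq T -> exists2 r, 0 < r &
  {in T &, forall t t', t != t' -> 2 * r <= `|t - t'|}.
Proof.
elim: T => [|t T IH] /=; first by exists 1.
case/andP=> tT /IH [r r0 hr].
have [q q0 hq] : exists2 q, 0 < q & {in T, forall t', 2 * q <= `|t - t'|}.
  elim: T tT {IH hr} => [|z T IH]; first by exists 1.
  rewrite inE negb_or => /andP[tz /IH [q q0 hq]].
  have tz0 : 0 < `|t - z| by rewrite normr_gt0 subr_eq0.
  exists (Num.min q (`|t - z| / 2)); first by rewrite lt_min q0; lra.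
  move=> t'; rewrite inE => /orP[/eqP->|/hq h].
    have : Num.min q (`|t - z| / 2) <= `|t - z| / 2 by rewrite ge_min lexx orbT.
    lra.
  have : Num.min q (`|t - z| / 2) <= q by rewrite ge_min lexx.
  lra.
have [m1 m2] : Num.min r q <= r /\ Num.min r q <= q by rewrite !ge_min !lexx orbT.
exists (Num.min r q); first by rewrite lt_min r0.
move=> a b; rewrite !inE => /orP[/eqP->|aT] /orP[/eqP->|bT] ab.
- by rewrite eqxx in ab.
- by have := hq b bT; lra.
- by have := hq a aT; rewrite distrC; lra.
- by have := hr a b aT bT ab; lra.
Qed.

(** The disjoint intervals that join the points of T, where x (g n) is small, to nearby
    points where it is large contribute at least (e / 2) ^+ 2 each. *)
Lemma large_near_size T g : uniq T -> in01 T -> increasing g -> large_near T g ->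
  (size T)%:R * (e / 2) ^+ 2 <= C.
Proof.
move=> uT T01 ig lT; have [r r0 hr] := separated uT.
have e2 : 0 < e / 2 by rewrite divr_gt0.
have [N hN] := lT r r0; have [N' hN'] := null_on_seq T01 ig e2.
pose n := maxn N N'.
have ex t : exists y, t \in T -> [/\ 0 <= y <= 1, `|y - t| < r & e <= `|x (g n) y| ].
  have [tT|_] := boolP (t \in T); last by exists 0.
  by have [|y hy] := hN n _ t tT; [exact: leq_maxl|exists y].
have [y hy] := choice ex.
pose J t := (Num.min t (y t), Num.max t (y t)).
have JT t : t \in T -> [/\ t - r < (J t).1, (J t).1 <= (J t).2, (J t).2 < t + r &
    0 <= (J t).1 /\ (J t).2 <= 1].
  move=> tT; have [y01 yt _] := hy t tT; have := allP T01 t tT.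
  move: yt y01; rewrite /J /= ltr_norml; case: (leP t (y t)) => h; move=> *; split; try split;
    lra.
have [||s [cs _ _ qs]] := @sort_family R 0 1 (map J T) ler01.
- by move=> _ /mapP[t tT ->]; have [] := JT t tT; move=> ? ? ? [].
- rewrite pairwise_map; move: uT; rewrite uniq_pairwise.
  apply: (sub_in_pairwise (P := mem T)); last by apply/allP.
  move=> t t' tT t'T /= /(hr _ _ tT t'T) h; rewrite /nonover.
  have [h1 h2 h3 _] := JT t tT; have [h1' h2' h3' _] := JT t' t'T.
  have [tt|tt] := leP t t'.
    by apply/orP; left; move: h; rewrite ler0_norm ?subr_le0//; lra.
  by apply/orP; right; move: h; rewrite gtr0_norm ?subr_gt0//; lra.
apply: le_trans (xbv (g n) cs); rewrite qs /qsum big_map.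
have -> : (size T)%:R * (e / 2) ^+ 2 = \sum_(t <- T) (e / 2) ^+ 2.
  by rewrite big_const_seq count_predT iter_addr_0 mulr_natl.
rewrite !big_seq; apply: ler_sum => t tT.
have [_ _ ye] := hy t tT; have xt := hN' n (leq_maxr _ _) t tT.
have -> : (x (g n) (J t).2 - x (g n) (J t).1) ^+ 2 = (x (g n) (y t) - x (g n) t) ^+ 2.
  by rewrite /J /=; case: (leP t (y t)) => _ //; rewrite -sqrrN opprB.
rewrite -[leRHS]real_normK ?num_real// ler_pXn2r ?nnegrE ?(ltW e2)//.
have := lerB_dist (x (g n) (y t)) (x (g n) t); lra.
Qed.

Definition concentrated T g := forall r, 0 < r -> exists N, forall n, (N <= n)%N ->
  forall y, 0 <= y <= 1 -> e <= `|x (g n) y| -> exists2 t, t \in T & `|y - t| < r.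

(** If the peaks do not concentrate on T, those that stay away from T accumulate at a
    new point. *)
Lemma large_near_extend T g : uniq T -> in01 T -> increasing g -> large_near T g ->
  ~ concentrated T g -> exists t g', [/\ uniq (t :: T), in01 (t :: T), increasing g' &
    large_near (t :: T) g'].
Proof.
move=> uT T01 ig lT nc.
have [r [r0 hr]] : exists r, 0 < r /\ forall N, exists2 n, (N <= n)%N &
    exists y, [/\ 0 <= y <= 1, e <= `|x (g n) y| & forall t, t \in T -> r <= `|y - t| ].
  apply: contrapT => H; apply: nc => r r0; apply: contrapT => G; apply: H.
  exists r; split => // N; apply: contrapT => G'; apply: G; exists N => n Nn y y01 hy.
  apply: contrapT => G; apply: G'; exists n => //; exists y; split => // t tT.
  by rewrite leNgt; apply/negP => h; apply: G; exists t.
have [g1 [ig1 /choice[y hy]]] := frequently_subseq hr.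
have y01 n : 0 <= y n <= 1 by have [] := hy n.
have [g2 [t [ig2 t01 ht]]] := bolzano_weierstrass01 y01.
have tT : t \notin T.
  apply/negP => tT; have [N /(_ N (leqnn N))] := ht r r0.
  by have [_ _ /(_ t tT)] := hy (g2 N); lra.
exists t, (g \o (g1 \o g2)); split.
- by rewrite /= tT.
- by rewrite /= t01.
- by apply: increasing_comp => //; exact: increasing_comp.
- move=> q q0; have [N1 h1] := lT q q0; have [N2 h2] := ht q q0.
  exists (maxn N1 N2) => n; rewrite geq_max => /andP[n1 n2] z.
  rewrite inE => /orP[/eqP->|zT].
    by exists (y (g2 n)); have [a b _] := hy (g2 n); split => //; exact: h2.
  apply: h1 => //; apply: leq_trans n1 _.
  apply: leq_trans (increasing_ge _ ig2) _; exact: increasing_ge.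
Qed.

(** By [large_near_size] the extension of T by new points must stop. *)
Lemma concentration : exists T g, [/\ in01 T, increasing g & concentrated T g].
Proof.
apply: contrapT => H.
have ex k : exists T g, [/\ size T = k, uniq T, in01 T, increasing g & large_near T g].
  elim: k => [|k [T [g [sT uT T01 ig lT]]]].
    exists [::], id; split => //; by exists 0%N.
  have [|t [g' [u' T01' ig' lT']]] := large_near_extend uT T01 ig lT.
    by move=> c; apply: H; exists T, g.
  by exists (t :: T), g'; split => //=; rewrite sT.
have e2 : 0 < (e / 2) ^+ 2 by rewrite exprn_gt0 ?divr_gt0.
have C0 : 0 <= C by have := @xbv 0%N [::]; rewrite qsum_nil => h; apply: h; exact: ler01.
have Ce : 0 <= C / (e / 2) ^+ 2 by rewrite divr_ge0 ?(ltW e2).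
have [T [g [sT uT T01 ig lT]]] := ex (Num.bound (C / (e / 2) ^+ 2)).
have := large_near_size uT T01 ig lT; rewrite sT -ler_pdivlMr// leNgt.
by rewrite archi_boundP.
Qed.

Hypothesis xsac : forall n, sq_abs_cont (x n).

Lemma sq_abs_cont_near n d : 0 < d -> exists2 r, 0 < r & forall t y,
  0 <= t <= 1 -> 0 <= y <= 1 -> `|y - t| < r -> `|x n y - x n t| < d.
Proof.
move=> d0; have d2 : 0 < (d / 2) ^+ 2 by rewrite exprn_gt0 ?divr_gt0.
have [r r0 hr] := xsac n d2; exists r => // t y /andP[t0 t1] /andP[y0 y1] yt.
pose J := (Num.min t y, Num.max t y).
have : qsum (x n) [:: J] <= (d / 2) ^+ 2.
  apply: hr; rewrite /= /J /=.
    by case: (leP t y) => h; rewrite ?t0 ?t1 ?y0 ?y1 ?h ?(ltW h).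
  by rewrite /short /= andbT; move: yt; rewrite ltr_norml; case: (leP t y) => h; lra.
have -> : qsum (x n) [:: J] = (x n y - x n t) ^+ 2.
  rewrite /qsum big_seq1 /J /=; case: (leP t y) => _ //=.
  by rewrite -sqrrN opprB.
have d20 : 0 <= d / 2 by lra.
rewrite -[X in X <= _]real_normK ?num_real// ler_pXn2r ?nnegrE// => h; lra.
Qed.

(** Around the finitely many points where the sequence may stay large, each function
    is eventually beaten: the next ones are large only where it is small. *)
Lemma disjoint_peaks : exists g, increasing g /\ forall i j, (i < j)%N -> forall y,
  0 <= y <= 1 -> e <= `|x (g i) y| -> `|x (g j) y| < e.
Proof.
have [T [g [T01 ig cT]]] := concentration.
have e2 : 0 < e / 2 by rewrite divr_gt0.
have [N hN] := null_on_seq T01 ig e2.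
have [|h [ih hh]] := @eventually_subseq (fun n m => forall y, 0 <= y <= 1 ->
    e <= `|x (g (N + n)%N) y| -> `|x (g (N + m)%N) y| < e).
  move=> n; have [r r0 hr] := sq_abs_cont_near (g (N + n)%N) e2.
  have [K hK] := cT r r0; exists K => m Km y y01 he; rewrite ltNge; apply/negP => he'.
  have [|t tT yt] := hK (N + m)%N _ y y01 he'; first by rewrite (leq_trans Km)// leq_addl.
  have := hr t y (allP T01 t tT) y01 yt; have := hN (N + n)%N (leq_addr _ _) t tT.
  have := lerB_dist (x (g (N + n)%N) y) (x (g (N + n)%N) t); lra.
exists (fun n => g (N + h n)%N); split => //.
by move=> i j ij; apply: ig; rewrite ltn_add2l; exact: ih.
Qed.

(** At each point at most one of the averaged functions is large. *)
Lemma small_average : (forall n y, 0 <= y <= 1 -> `|x n y| <= C + 1) ->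
  exists g M, [/\ increasing g, (0 < M)%N & forall y, 0 <= y <= 1 ->
    `|M%:R^-1 * \sum_(j < M) x (g j) y| <= 2 * e].
Proof.
move=> hC; have [g [ig hg]] := disjoint_peaks.
have C0 : 0 <= C by have := @xbv 0%N [::]; rewrite qsum_nil => h; apply: h; exact: ler01.
pose M := (Num.bound ((C + 1) / e)).+1.
have M0 : (0 : R) < M%:R by rewrite ltr0n.
have hM : C + 1 <= M%:R * e.
  have Ce : 0 <= (C + 1) / e by rewrite divr_ge0 ?(ltW e0)//; lra.
  rewrite -ler_pdivrMr//; apply: le_trans (ltW (archi_boundP Ce)) _.
  by rewrite ler_nat.
exists g, M; split => // y y01; rewrite normrM (@ger0_norm _ M%:R^-1) ?invr_ge0 ?(ltW M0)//.
rewrite [leLHS]mulrC ler_pdivrMr//; apply: le_trans (ler_norm_sum _ _ _) _.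
have Me (P : pred 'I_M) : \sum_(j < M | P j) e <= M%:R * e.
  rewrite sumr_const -[e *+ _]mulr_natl ler_wpM2r ?(ltW e0)// ler_nat.
  by apply: leq_trans (max_card _) _; rewrite card_ord.
have [[j0 hj0]|none] := pselect (exists j : 'I_M, e <= `|x (g j) y|); last first.
  apply: (@le_trans _ _ (\sum_(j < M) e)); last by have := Me xpredT; have := mulr_gt0 M0 e0;
    lra.
  apply: ler_sum => j _; rewrite leNgt; apply/negP => h; apply: none; exists j; exact: ltW.
rewrite (bigD1 j0)//=; have := Me (fun j => j != j0); have := hC (g j0) y y01.
suff : \sum_(j < M | j != j0) `|x (g j) y| <= \sum_(j < M | j != j0) e by lra.
apply: ler_sum => j jj0; have [lt|lt|eq] := ltngtP j j0.
- rewrite leNgt; apply/negP => h; have := hg j j0 lt y y01 (ltW h); lra.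
- by apply: ltW; apply: (hg j0 j lt).
- by move: jj0; rewrite -val_eqE /= eq eqxx.
Qed.

End SupNull.

Section Mazur.
Variable R : realType.
Implicit Types (x y : nat -> R -> R) (C e : R) (s : seq (R * R)).

Lemma comb_small_sup x C N e : 0 < e -> (forall n, sq_abs_cont (x n)) ->
  (forall n s, chain 0 1 s -> qsum (x n) s <= C) ->
  (forall n, x n 0 = 0) ->
  (forall t d, 0 <= t <= 1 -> 0 < d -> exists N, forall n, (N <= n)%N -> `|x n t| < d) ->
  exists K c, weights N K c /\ forall t, 0 <= t <= 1 -> `|comb K c x t| <= e.
Proof.
move=> e0 xsac xbv x0 xnull.
have e2 : 0 < e / 2 by rewrite divr_gt0.
have C0 : 0 <= C by have := xbv 0%N [::]; rewrite qsum_nil => h; apply: h; exact: ler01.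
have [||||g [M [ig M0 h]]] := @small_average R (fun n => x (N + n)%N) C (e / 2) e2.
- by move=> n s; exact: xbv.
- move=> t d t01 d0; have [K hK] := xnull t d t01 d0; exists K => n Kn.
  by apply: hK; rewrite (leq_trans Kn)// leq_addl.
- by move=> n; exact: xsac.
- move=> n y /andP[y0 y1]; have := xbv (N + n)%N [:: (0, y)].
  rewrite /= lexx y0 y1 => /(_ isT); rewrite /qsum big_seq1 /= x0 subr0 => hy.
  have C1 : 0 <= C + 1 by lra.
  rewrite -(@ler_pXn2r _ 2) ?nnegrE// real_normK ?num_real//; apply: le_trans hy _.
  have := sqr_ge0 C; rewrite !expr2; lra.
have [K [c [wc E]]] := weights_avg (c := fun j i => (i == (N + g j)%N)%:R) M0
  (fun j => weights_delta R (leq_addr (g j) N)).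
exists K, c; split => // t t01; rewrite E.
under eq_bigr do rewrite comb_delta.
by apply: le_trans (h t t01) _; lra.
Qed.

(** The first index j0 with d j0 <= L accounts for the first sum. Any other term a j
    occurs in the second one, because L < d j if j < j0, while d j0 <= L if j > j0. When
    the a j are the increments of functions over an interval of length L, and d j is the
    length below which the j-th function hardly varies, the second sum will be small. *)
Lemma average_increment M (a d : 'I_M -> R) (L : R) :
  (\sum_j a j) ^+ 2 <= 2 * \sum_j a j ^+ 2 +
    2 * M%:R * \sum_j ((if L < d j then a j ^+ 2 else 0) +
       \sum_(i < M | (i < j)%N) (if d i <= L then a j ^+ 2 else 0)).
Proof.
pose b (j : 'I_M) := (if L < d j then a j ^+ 2 else 0) +
  \sum_(i < M | (i < j)%N) (if d i <= L then a j ^+ 2 else 0).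
rewrite -[\sum_j (_ + _)]/(\sum_j b j).
have b0 j : 0 <= b j.
  by rewrite addr_ge0//; [|apply: sumr_ge0 => i _]; case: ifP => _ //; exact: sqr_ge0.
have s0 : 0 <= \sum_j a j ^+ 2 by apply: sumr_ge0 => j _; exact: sqr_ge0.
have [[j1 hj1]|none] := pselect (exists j, d j <= L); last first.
  apply: le_trans (sqr_sum_le a) _.
  have : \sum_j a j ^+ 2 <= \sum_j b j.
    apply: ler_sum => j _; rewrite /b ifT; last first.
      by rewrite ltNge; apply/negP => h; apply: none; exists j.
    by rewrite lerDl sumr_ge0// => i _; case: ifP => _ //; exact: sqr_ge0.
  have M0 : (0 : R) <= M%:R by [].
  by move=> /(ler_wpM2l M0); have := mulr_ge0 M0 s0; lra.
have [j0 hj0 min] := @arg_minnP _ j1 (fun j => d j <= L) (fun j : 'I_M => j : nat) hj1.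
rewrite (bigD1 j0)//=; set S := \sum_(j < M | j != j0) a j.
have hS : S ^+ 2 <= M%:R * \sum_j b j.
  have -> : S = \sum_(j < M) (if j != j0 then a j else 0) by rewrite /S big_mkcond.
  apply: le_trans (sqr_sum_le _) _; rewrite ler_wpM2l//; apply: ler_sum => j _.
  case: ifP => jj0; last by rewrite expr0n.
  rewrite /b; have [Ld|dL] := ltP L (d j).
    by rewrite lerDl sumr_ge0// => i _; case: ifP => _ //; exact: sqr_ge0.
  have j0j : (j0 < j)%N by rewrite ltn_neqAle min// andbT eq_sym.
  rewrite add0r (bigD1 j0)//= hj0 lerDl sumr_ge0// => i _.
  by case: ifP => _ //; exact: sqr_ge0.
have : a j0 ^+ 2 <= \sum_j a j ^+ 2.
  by rewrite [leRHS](bigD1 j0)//= lerDl sumr_ge0// => j _; exact: sqr_ge0.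
have := sqr_ge0 (a j0 - S); rewrite -mulrA !expr2 in hS *; lra.
Qed.

Lemma average_small_variation y C e : 0 < e -> (forall n, sq_abs_cont (y n)) ->
  (forall n s, chain 0 1 s -> qsum (y n) s <= C) ->
  (forall d, 0 < d -> exists N, forall n, (N <= n)%N -> forall t, 0 <= t <= 1 -> `|y n t| <= d)
    ->
  exists g M, [/\ increasing g, (0 < M)%N & forall s, chain 0 1 s ->
    qsum (fun t => M%:R^-1 * \sum_(j < M) y (g j) t) s <= e].
Proof.
move=> e0 ysac ybv ynull.
have C0 : 0 <= C by have := ybv 0%N [::]; rewrite qsum_nil => h; apply: h; exact: ler01.
pose M := (Num.bound (4 * C / e)).+1.
have M0 : (0 : R) < M%:R by rewrite ltr0n.
have hM : 4 * C <= M%:R * e.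
  have Ce : 0 <= 4 * C / e by rewrite divr_ge0 ?(ltW e0)//; lra.
  rewrite -ler_pdivrMr//; apply: le_trans (ltW (archi_boundP Ce)) _.
  by rewrite ler_nat.
pose eta := e / (4 * (M%:R + 1)).
have eta0 : 0 < eta by rewrite divr_gt0//; lra.
have exd n : exists d, 0 < d /\ forall s, chain 0 1 s -> short d s -> qsum (y n) s <= eta.
  by have [d d0 h] := ysac n eta eta0; exists d.
have [d hd] := choice exd.
have [|g [ig hg]] := @eventually_subseq (fun n m => forall s, chain 0 1 s ->
    all (fun I => d n <= I.2 - I.1) s -> qsum (y m) s <= eta).
  move=> n; have [dn _] := hd n; pose q := Num.min 1 (eta * d n / 4).
  have q0 : 0 < q by rewrite lt_min ltr01 divr_gt0 ?mulr_gt0.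
  have q1 : q <= 1 by rewrite ge_min lexx.
  have q2 : q <= eta * d n / 4 by rewrite ge_min lexx orbT.
  have [N hN] := ynull q q0; exists N => m Nm s cs al.
  apply: (@le_trans _ _ (\sum_(I <- s) (4 * q))).
    rewrite /qsum !big_seq; apply: ler_sum => I Is; have [I0 I12 I1] := chain_mem cs Is.
    have h1 := hN m Nm I.1; have h2 := hN m Nm I.2.
    have {}h1 : `|y m I.1| <= q by apply: h1; apply/andP; split; lra.
    have {}h2 : `|y m I.2| <= q by apply: h2; apply/andP; split; lra.
    have h : `|y m I.2 - y m I.1| <= 2 * q by have := ler_normB (y m I.2) (y m I.1); lra.
    rewrite -real_normK ?num_real//; apply: (@le_trans _ _ ((2 * q) ^+ 2)).
      by rewrite ler_pXn2r ?nnegrE//; lra.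
    rewrite exprMn -natrX ler_wpM2l// expr2 ler_piMr// ltW//.
  have := chain_length dn cs al; rewrite subr0 => sz.
  rewrite big_const_seq count_predT iter_addr_0 -[_ *+ _]mulr_natl.
  apply: (@le_trans _ _ ((size s)%:R * (eta * d n))); first by rewrite ler_wpM2l//; lra.
  by rewrite mulrCA ler_piMr// ltW.
exists g, M; split => // s cs.
have -> : qsum (fun t => M%:R^-1 * \sum_(j < M) y (g j) t) s =
    (M%:R ^+ 2)^-1 * \sum_(I <- s) (\sum_(j < M) (y (g j) I.2 - y (g j) I.1)) ^+ 2.
  rewrite /qsum mulr_sumr; apply: eq_bigr => I _.
  by rewrite -mulrBr -sumrB exprMn exprVn.
rewrite mulrC ler_pdivrMr ?exprn_gt0//.
apply: (@le_trans _ _ (\sum_(I <- s) (2 * \sum_(j < M) (y (g j) I.2 - y (g j) I.1) ^+ 2 +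
    2 * M%:R * \sum_(j < M) ((if I.2 - I.1 < d (g j) then (y (g j) I.2 - y (g j) I.1) ^+ 2 else
      0) +
     \sum_(i < M | (i < j)%N)
       (if d (g i) <= I.2 - I.1 then (y (g j) I.2 - y (g j) I.1) ^+ 2 else 0))))).
  by apply: ler_sum => I _; exact: (average_increment _ (fun j => d (g j))).
rewrite big_split /= -!mulr_sumr exchange_big /=.
rewrite [X in _ + _ * X]exchange_big /=.
apply: (@le_trans _ _ (2 * \sum_(j < M) C + 2 * M%:R * \sum_(j < M) (eta + M%:R * eta))).
  apply: lerD; first by rewrite ler_wpM2l//; apply: ler_sum => j _; exact: ybv.
  rewrite ler_wpM2l ?mulr_ge0//; apply: ler_sum => j _; rewrite big_split /=; apply: lerD.
    rewrite -big_mkcond -big_filter; have [_ h] := hd (g j).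
    by apply: h; [exact: chain_filter|exact: filter_all].
  rewrite exchange_big /=; apply: (@le_trans _ _ (\sum_(i < M | (i < j)%N) eta)).
    apply: ler_sum => i ij; rewrite -big_mkcond -big_filter.
    by apply: (hg i j ij); [exact: chain_filter|exact: filter_all].
  rewrite sumr_const -[eta *+ _]mulr_natl ler_wpM2r ?(ltW eta0)// ler_nat.
  by apply: leq_trans (max_card _) _; rewrite card_ord.
rewrite !sumr_const card_ord -[C *+ _]mulr_natl -[(_ + _) *+ _]mulr_natl.
have h1 : M%:R * (4 * C) <= M%:R * (M%:R * e) by rewrite ler_wpM2l// ltW.
have h2 : (M%:R + 1) * eta = e / 4 by rewrite /eta; field; rewrite gt_eqF//; lra.
have -> : 2 * M%:R * (M%:R * (eta + M%:R * eta)) = 2 * (M%:R * M%:R) * ((M%:R + 1) * eta) by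
  ring.
rewrite h2 expr2; lra.
Qed.

(** Mazur's lemma in V_2^0, for bounded pointwise null sequences: convex combinations
    that are uniformly small first, then averages of these. *)
Lemma comb_small_variation x C N e : 0 < e -> (forall n, sq_abs_cont (x n)) ->
  (forall n s, chain 0 1 s -> qsum (x n) s <= C) ->
  (forall n, x n 0 = 0) ->
  (forall t d, 0 <= t <= 1 -> 0 < d -> exists N, forall n, (N <= n)%N -> `|x n t| < d) ->
  exists K c, weights N K c /\ forall s, chain 0 1 s -> qsum (comb K c x) s <= e.
Proof.
move=> e0 xsac xbv x0 xnull.
have ex n : exists Kc : nat * (nat -> R), weights N Kc.1 Kc.2 /\
    forall t, 0 <= t <= 1 -> `|comb Kc.1 Kc.2 x t| <= n.+1%:R^-1.
  have n0 : (0 : R) < n.+1%:R^-1 by rewrite invr_gt0.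
  by have [K [c h]] := comb_small_sup N n0 xsac xbv x0 xnull; exists (K, c).
have [Kc hKc] := choice ex.
pose y n := comb (Kc n).1 (Kc n).2 x.
have [|||g [M [ig M0 h]]] := @average_small_variation y C e e0.
- by move=> n; have [w _] := hKc n; exact: sq_abs_cont_comb w xsac.
- by move=> n s cs; have [w _] := hKc n; apply: comb_qsum w _ => i _; exact: xbv.
- move=> d d0; have d1 : 0 <= d^-1 by rewrite invr_ge0 ltW.
  exists (Num.bound d^-1) => n Nn t t01; have [_ hn] := hKc n; apply: le_trans (hn t t01) _.
  rewrite -[leRHS]invrK lef_pV2 ?posrE ?invr_gt0//.
  by apply: le_trans (ltW (archi_boundP d1)) _; rewrite ler_nat leqW.
have [K [c [w E]]] := weights_avg (Kf := fun j => (Kc (g j)).1) (c := fun j => (Kc (g j)).2) M0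
  (fun j => proj1 (hKc (g j))).
exists K, c; split => // s cs.
by apply: le_trans (h s cs); rewrite /qsum; apply: ler_sum => I _; rewrite !E.
Qed.

End Mazur.

(** * Families of intervals, oscillation and convex blocks *)

Section Families.
Variable R : realType.
Implicit Types (f g : {i01 R} -> R) (s : seq (R * R)) (x y z : R).

Lemma le01E (a b : {i01 R}) : (a <= b)%O = (val01 a <= val01 b). Proof. by []. Qed.
Lemma lt01E (a b : {i01 R}) : (a < b)%O = (val01 a < val01 b). Proof. by []. Qed.

Definition ends (i : interval {i01 R}) : R * R := (val01 (left_end i), val01 (right_end i)).

Lemma ends_mem (i : interval {i01 R}) t : t \in i -> (ends i).1 <= val01 t <= (ends i).2.
Proof.
have t0 := val01_ge0 t; have t1 := val01_le1 t.
case: i => [[[] a|[]] [[] b|[]]]; rewrite in_itv /= ?andbF //;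
  rewrite ?le01E ?lt01E ?andbT /=; lra.
Qed.

Lemma mem_ends (i : interval {i01 R}) t t' : t' \in i -> (ends i).1 < val01 t < (ends i).2 -> t
  \in i.
Proof.
have t0 := val01_ge0 t; have t1 := val01_le1 t.
case: i => [[[] a|[]] [[] b|[]]]; rewrite !in_itv /= ?andbF //;
  rewrite ?(le01E, lt01E) ?andbT /=; lra.
Qed.

Lemma ends_le (i : interval {i01 R}) : neitv i -> [/\ 0 <= (ends i).1, (ends i).1 <= (ends i).2
  & (ends i).2 <= 1].
Proof.
move=> /set0P [t ti]; have /andP[h1 h2] := ends_mem ti.
by split; rewrite ?val01_ge0 ?val01_le1// (le_trans h1).
Qed.

Lemma is_interval_val01 (i : interval {i01 R}) : is_interval (@val01 R @` [set` i]).
Proof.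
move=> _ _ [a ai <-] [b bi <-] z /andP[az zb].
have z0 : 0 <= z by apply: le_trans az; exact: val01_ge0.
have z1 : z <= 1 by apply: le_trans zb _; exact: val01_le1.
exists (clip01 z); last by rewrite val01_clip clip_id.
case: i ai bi => l r; rewrite /= !itv_boundlr => /andP[la _] /andP[_ br]; apply/andP; split.
  by apply: le_trans la _; rewrite bnd_simp le01E val01_clip clip_id.
by apply: le_trans br; rewrite bnd_simp le01E val01_clip clip_id.
Qed.

Lemma open_ends_sub (i : interval {i01 R}) : neitv i -> `](ends i).1, (ends i).2[%classic `<=`
  (@val01 R @` [set` i])°.
Proof.
move=> ni; rewrite -open_subsetE; last exact: interval_open.
have /set0P [t' t'i] := ni; have [/= e0 e1 e2] := ends_le ni.
move=> x; rewrite /= in_itv /= => /andP[ax xb].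
have vx : val01 (clip01 x) = x by rewrite val01_clip clip_id //; lra.
by exists (clip01 x) => //; apply: (mem_ends t'i); rewrite vx /= ax.
Qed.

Lemma overlap (p q : R * R) : p.1 < p.2 -> q.1 < q.2 -> ~~ nonover p q ->
  exists z, [/\ p.1 < z, z < p.2, q.1 < z & z < q.2].
Proof.
case: p q => [a b] [a' b'] /= ab ab'; rewrite /nonover /= negb_or -!ltNge => /andP[h1 h2].
exists ((Num.max a a' + Num.min b b') / 2).
by split; case: (leP a a') => ?; case: (leP b b') => ?; lra.
Qed.

Lemma v2_familyE f (k : nat) (I : 'I_k -> interval {i01 R}) :
  v2_family f I ^+ 2 = qsum (ext f) [seq ends (I i) | i <- enum 'I_k].
Proof.
rewrite /v2_family sqr_sqrtr ?sumr_ge0// => [|i _]; last exact: sqr_ge0.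
by rewrite /qsum big_map big_enum /=; apply: eq_bigr => i _; rewrite !ext_val.
Qed.

Lemma measurable_union (k : nat) (I : 'I_k -> interval {i01 R}) :
  measurable (@val01 R @` union_family I : set (measurableTypeR R)).
Proof.
rewrite /union_family image_bigcup; apply: fin_bigcup_measurable => [|i _].
  exact: finite_finset.
by apply: is_interval_measurable; exact: is_interval_val01.
Qed.

(** Degenerate intervals are discarded, since they may lie inside other ones. The set E
    consists of the end points, which the intervals need not contain. *)
Lemma chain_of_family (k : nat) (I : 'I_k -> interval {i01 R}) : interval_family I ->
  exists s (E : seq R), [/\ chain 0 1 s, in01 E,
    forall f, qsum (ext f) s = v2_family f I ^+ 2 &
    cov s `<=` (@val01 R @` union_family I) `|` [set` E]].
Proof.
case=> nI tI; pose nd := [seq i <- enum 'I_k | (ends (I i)).1 < (ends (I i)).2].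
have [||s [cs ss lts qs]] := @sort_family R 0 1 [seq ends (I i) | i <- nd] ler01.
- by move=> _ /mapP[i _ ->]; exact: ends_le.
- rewrite pairwise_map; have : uniq nd by rewrite filter_uniq// enum_uniq.
  rewrite uniq_pairwise.
  apply: (sub_in_pairwise (P := fun i => (ends (I i)).1 < (ends (I i)).2)); last exact:
    filter_all.
  move=> i j ndi ndj /= ij; apply: contraT => /(overlap ndi ndj) [z [z1 z2 z3 z4]].
  have := tI i j Logic.I Logic.I.
  suff H : exists x, (interior (@val01 R @` [set` I i]) `&` interior (@val01 R @` [set` I j]))
    x.
    by move=> /(_ H) e; rewrite e eqxx in ij.
  by exists z; split; apply: open_ends_sub => //; rewrite /= in_itv; apply/andP.
exists s, ([seq (ends (I i)).1 | i <- nd] ++ [seq (ends (I i)).2 | i <- nd]); split => //.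
- rewrite /in01 all_cat; apply/andP; split; apply/allP => _ /mapP[i _ ->];
    have [h1 h2 h3] := ends_le (nI i); apply/andP; split => //; [exact: le_trans h3|exact:
      le_trans h1 h2].
- move=> f; rewrite qs v2_familyE [RHS](qsum_filterC _ (fun J => J.1 < J.2)) filter_map.
  rewrite [X in _ = _ + X](_ : _ = 0) ?addr0// /qsum big1_seq// => J.
  rewrite mem_filter -leNgt => /andP[_ /andP[h /mapP[i _ e]]]; rewrite e in h *.
  have [_ h' _] := ends_le (nI i).
  by rewrite (_ : (ends (I i)).1 = (ends (I i)).2) ?subrr ?expr0n//; apply/eqP; rewrite eq_le h
    h'.
- move=> x /covP [J /ss /mapP[i ind ->] /andP[]].
  rewrite le_eqVlt => /orP[/eqP <- _|xa].
    by right; rewrite /= mem_cat; apply/orP; left; apply/mapP; exists i.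
  rewrite le_eqVlt => /orP[/eqP ->|xb].
    by right; rewrite /= mem_cat; apply/orP; right; apply/mapP; exists i.
  left; have : (@val01 R @` [set` I i]) x.
    by apply: (interior_subset (open_ends_sub (nI i) _)); rewrite /= in_itv /= xa.
  by case=> t ti <-; exists t => //; exists i.
Qed.

Lemma chain_nth x y s d (i j : nat) : chain x y s -> (i < j)%N -> (j < size s)%N ->
  (nth d s i).2 <= (nth d s j).1.
Proof.
elim: s x i j => [//|J s IH] x [|i] [|j] //= /and3P[_ _ c] ij js.
  by have [] := chain_mem c (mem_nth d js).
by apply: (IH J.2).
Qed.

Lemma family_of_chain s : chain 0 1 s -> exists (p : nat) (J : 'I_p -> interval {i01 R}),
  [/\ interval_family J, forall f, v2_family f J ^+ 2 = qsum (ext f) s &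
    forall t, union_family J t -> exists2 I, I \in s & I.1 <= val01 t <= I.2].
Proof.
move=> cs; pose d : R * R := (0, 0).
pose J (i : 'I_(size s)) := Interval (BLeft (clip01 (nth d s i).1)) (BRight (clip01 (nth d s
  i).2)).
have eJ i : ends (J i) = nth d s i.
  have [h0 h1 h2] := chain_mem cs (mem_nth d (ltn_ord i)).
  by rewrite /ends /= !clip_id ?(le_trans h0)// ?(le_trans h1)//; case: (nth d s i).
exists (size s), J; split.
- split.
    move=> i; apply/set0P; exists (clip01 (nth d s i).1).
    have [h0 h1 h2] := chain_mem cs (mem_nth d (ltn_ord i)).
    by rewrite /= in_itv /= lexx /= le01E; apply: clip_homo.
  have wlogij (i j : 'I_(size s)) x : (i < j)%N -> interior (@val01 R @` [set` J i]) x ->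
      interior (@val01 R @` [set` J j]) x -> False.
    move=> ij.
    have sub k : interior (@val01 R @` [set` J k]) `<=` `](nth d s k).1, (nth d s k).2[%classic.
      have -> : `](nth d s k).1, (nth d s k).2[%classic = interior `[(nth d s k).1, (nth d s
        k).2]%classic.
        by rewrite interior_itv.
      by apply: interiorS => _ [t /ends_mem h <-]; rewrite -eJ /= in_itv.
    move=> /sub; rewrite /= in_itv /= => /andP[_ h1] /sub; rewrite /= in_itv /= => /andP[h2 _].
    have := chain_nth d cs ij (ltn_ord j); lra.
  move=> i j _ _ [x [xi xj]]; apply/val_inj => /=.
  have [ij|ij|//] := ltngtP i j; first by have := wlogij i j x ij xi xj.
  by have := wlogij j i x ij xj xi.
- move=> f; rewrite v2_familyE; congr qsum.
  apply: (@eq_from_nth _ d); first by rewrite size_map size_enum_ord.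
  rewrite size_map size_enum_ord => i ip.
  by rewrite (nth_map (Ordinal ip)) ?size_enum_ord// eJ nth_enum_ord.
- move=> t [i _ /ends_mem]; rewrite eJ => h; exists (nth d s i) => //; exact: mem_nth.
Qed.

End Families.

Section Oscillation.
Variables (R : realType) (f : {i01 R} -> R).

Lemma osc_ge0 t : (0 <= osc f t)%E.
Proof.
apply: le_ereal_inf_tmp => _ [V [_ Vt] <-]; apply: (@le_trans _ _ `|f t - f t|%:E).
  by rewrite subrr normr0.
by apply: ereal_sup_ubound; exists t.
Qed.

Lemma supnorm_ge0 (g : {i01 R} -> \bar R) : (0 <= supnorm g)%E.
Proof.
by apply: (@le_trans _ _ `|g (zero01 R)|%E) => //; apply: ereal_sup_ubound; exists (zero01 R).
Qed.

Lemma supnorm_osc_le : (supnorm (osc f) <= 2%:E * supnorm (EFin \o f))%E.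
Proof.
apply: ge_ereal_sup => _ [t _ <-]; rewrite gee0_abs ?osc_ge0//.
apply: (@le_trans _ _ (ereal_sup [set `|f x - f t|%:E | x in [set: {i01 R}] ])).
  by apply: ereal_inf_lbound; exists setT => //; split => //; exists setT => //; exact: openT.
have le x : (`|f x|%:E <= supnorm (EFin \o f))%E.
  by apply: ereal_sup_ubound; exists x.
apply: ge_ereal_sup => _ [x _ <-].
apply: (@le_trans _ _ (`|f x| + `|f t|)%:E); first by rewrite lee_fin ler_normB.
by rewrite EFinD mule_natl mule2n leeD.
Qed.

Lemma supnorm_le_V2norm N : 0 <= N -> f (zero01 R) = 0 -> (V2norm f <= N%:E)%E ->
  (supnorm (EFin \o f) <= N%:E)%E.
Proof.
move=> N0 f0 hN; apply: ge_ereal_sup => _ [t _ <-] /=; rewrite lee_fin.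
have c : chain 0 1 [:: (0, val01 t)] by rewrite /= lexx val01_ge0 val01_le1.
have := V2norm_ge N0 hN c; rewrite /qsum big_seq1 /= ext_val.
rewrite (_ : ext f 0 = 0) ?subr0; last exact: etrans (ext_val f (zero01 R)) f0.
by rewrite -[X in X <= _]real_normK ?num_real// ler_pXn2r ?nnegrE.
Qed.

End Oscillation.

Section Blocks.
Variable R : realType.
Implicit Types (x y : nat -> R -> R) (s : seq (R * R)) (c : nat -> R).

Lemma weights_lt N K c : weights N K c -> (N < K)%N.
Proof.
move=> [_ cz c1]; rewrite ltnNge; apply/negP => KN.
move: c1; rewrite big1 => [/eqP|i _]; first by rewrite eq_sym oner_eq0.
by apply: cz; rewrite negb_and -ltnNge (leq_trans (ltn_ord i)).
Qed.

Lemma comb_rsub K c x t a : \sum_(i < K) c i = 1 ->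
  a - comb K c x t = comb K c (fun i t => a - x i t) t.
Proof.
move=> c1; rewrite /comb; under [RHS]eq_bigr do rewrite mulrBr.
by rewrite sumrB -mulr_suml c1 mul1r.
Qed.

Lemma comb_comb_qsum N K c N' K' c' x s B : weights N K c -> weights N' K' c' ->
  (forall i j, (N <= i < K)%N -> (N' <= j < K')%N -> qsum (x j \- x i) s <= B) ->
  qsum (comb K' c' x \- comb K c x) s <= B.
Proof.
move=> w w' h; have [_ _ c1] := w; have [_ _ c1'] := w'.
rewrite (_ : _ \- _ = comb K' c' (fun j => x j \- comb K c x)); last first.
  by apply/funext => t /=; rewrite comb_sub.
apply: comb_qsum w' _ => j hj.
rewrite (_ : _ \- _ = comb K c (fun i => x j \- x i)); last first.
  by apply/funext => t /=; rewrite comb_rsub.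
by apply: comb_qsum w _ => i hi; exact: h.
Qed.

Lemma comb_comb_abs N K c N' K' c' x t B : weights N K c -> weights N' K' c' ->
  (forall i j, (N <= i < K)%N -> (N' <= j < K')%N -> `|x j t - x i t| <= B) ->
  `|comb K' c' x t - comb K c x t| <= B.
Proof.
move=> w w' h; have [_ _ c1] := w; have [_ _ c1'] := w'.
rewrite comb_sub//; apply: comb_abs w' _ => j hj.
by rewrite comb_rsub//; apply: comb_abs w _ => i hi; exact: h.
Qed.

(** Cauchy-Schwarz with a parameter. *)
Lemma qsum_add_le (G H : R -> R) lam s : 0 < lam ->
  qsum (G \+ H) s <= (1 + lam) * qsum G s + (1 + lam^-1) * qsum H s.
Proof.
move=> l0; rewrite /qsum !mulr_sumr -big_split /=; apply: ler_sum => I _.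
set a := G I.2 - G I.1; set b := H I.2 - H I.1.
rewrite (_ : _ - _ = a + b); last by rewrite /a /b; lra.
have : 0 <= lam^-1 * (lam * a - b) ^+ 2 by rewrite mulr_ge0 ?sqr_ge0// invr_ge0 ltW.
have -> : lam^-1 * (lam * a - b) ^+ 2 = lam * a ^+ 2 - 2 * a * b + lam^-1 * b ^+ 2.
  by field; rewrite gt_eqF.
rewrite !expr2; lra.
Qed.

Lemma cvg_qsum (G : nat -> R -> R) (H : R -> R) s :
  (forall t, G n t @[n --> \oo] --> H t) -> qsum (G n) s @[n --> \oo] --> qsum H s.
Proof.
move=> h; elim: s => [|I s IH].
  by rewrite qsum_nil; under eq_fun do rewrite qsum_nil; exact: cvg_cst.
rewrite qsum_cons; under eq_fun do rewrite qsum_cons.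
apply: cvgD => //; rewrite expr2; under eq_fun do rewrite expr2.
by apply: cvgM; apply: cvgB; exact: h.
Qed.

Lemma qsum_eventually (G : nat -> R -> R) (H : R -> R) s th :
  (forall t, G n t @[n --> \oo] --> H t) -> th < qsum H s ->
  exists N, forall n, (N <= n)%N -> th < qsum (G n) s.
Proof.
move=> h hth; have /cvgrPdist_lt := @cvg_qsum G H s h.
move=> /(_ (qsum H s - th)); rewrite subr_gt0 => /(_ hth) [N _ hN].
by exists N => n /hN; rewrite /= ltr_norml; lra.
Qed.

(** Disjoint ranges allow a single coefficient function for all the blocks. *)
Lemma convex_block_of_weights (u : nat -> {i01 R} -> R) (N K : nat -> nat) (c : nat -> nat ->
  R) :
  (forall n, weights (N n) (K n) (c n)) -> (forall n, (K n <= N n.+1)%N) ->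
  convex_block u (fun n => \sum_(i < K n) c n i *: u i).
Proof.
move=> w KN.
have NK n : (N n < K n)%N by exact: weights_lt (w n).
have Nle n m : (n < m)%N -> (K n <= N m)%N.
  elim: m => [//|m IH]; rewrite ltnS leq_eqVlt => /orP[/eqP->//|/IH h].
  by apply: leq_trans h _; apply: leq_trans (ltnW (NK m)) (KN m).
have Nn n : (n <= N n)%N.
  elim: n => [//|n IH]; apply: leq_ltn_trans IH _.
  exact: leq_trans (NK n) (KN n).
pose F n := seq_fset tt (iota (N n) (K n - N n)).
have FE n i : (i \in F n) = (N n <= i < K n)%N.
  by rewrite seq_fsetE mem_iota subnKC// ltnW.
pose r i := \sum_(n < i.+1) c n i.
have rE n i : i \in F n -> r i = c n i.
  rewrite FE => /andP[Ni iK]; have ni : (n < i.+1)%N by rewrite ltnS (leq_trans (Nn n)).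
  rewrite /r (bigD1 (Ordinal ni))//= big1 ?addr0// => j jn.
  have [_ cz _] := w j; apply: cz; have [jn'|jn'|e] := ltngtP j n.
  - by rewrite negb_and -[X in _ || X]leqNgt (leq_trans (Nle _ _ jn') Ni) orbT.
  - by rewrite negb_and -ltnNge (leq_trans iK (Nle _ _ jn')).
  - by move: jn; rewrite -val_eqE /= e eqxx.
have sumF (V : nmodType) n (G : nat -> V) : \sum_(i <- F n) G i = \sum_(N n <= i < K n) G i.
  rewrite (perm_big (iota (N n) (K n - N n)))//=.
  by apply: perm_trans (seq_fset_perm tt _) _; rewrite undup_id ?iota_uniq.
have widen (V : nmodType) n (G : nat -> V) : (forall i, (i < N n)%N -> G i = 0) ->
    \sum_(N n <= i < K n) G i = \sum_(i < K n) G i.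
  move=> h; rewrite -(big_mkord xpredT G) (@big_cat_nat _ _ _ (N n) 0 (K n))//= ?(ltnW (NK
    n))//.
  rewrite [X in _ = X + _]big_nat_cond [X in _ = X + _]big1 ?add0r// => i.
  by rewrite andbT => /= hi; exact: h.
exists F, r; split.
- move=> n i j; rewrite !FE => /andP[_ iK] /andP[Nj _].
  exact: leq_trans iK (leq_trans (KN n) Nj).
- move=> n i /rE ->; by have [h _ _] := w n.
- move=> n; have [_ cz c1] := w n; rewrite -c1.
  under eq_big_seq => i iF do rewrite (rE _ _ iF).
  rewrite sumF widen// => i iN; apply: cz; by rewrite negb_and -ltnNge iN.
- move=> n; under [RHS]eq_big_seq => i iF do rewrite (rE _ _ iF).
  rewrite sumF (widen _ n (fun i => c n i *: u i))// => i iN.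
  have [_ cz _] := w n; rewrite cz ?scale0r//; by rewrite negb_and -ltnNge iN.
Qed.

End Blocks.

(** * The convex block sequence *)

Section Prelim.
Variable R : realType.
Implicit Types (G H : R -> R) (s : seq (R * R)).

Lemma qsum_sub_le G H s : qsum (G \- H) s <= 2 * qsum G s + 2 * qsum H s.
Proof.
rewrite /qsum !mulr_sumr -big_split /=; apply: ler_sum => I _.
set a := G I.2; set b := G I.1; set a' := H I.2; set b' := H I.1.
have := sqr_ge0 ((a - b) + (a' - b')); rewrite !expr2; lra.
Qed.

Lemma sq_abs_cont_sub G H : sq_abs_cont G -> sq_abs_cont H -> sq_abs_cont (G \- H).
Proof.
move=> hG hH e e0; have e4 : 0 < e / 4 by lra.
have [d1 d10 h1] := hG _ e4; have [d2 d20 h2] := hH _ e4.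
exists (Num.min d1 d2); first by rewrite lt_min d10.
move=> s cs ss; apply: le_trans (qsum_sub_le _ _ _) _.
have := h1 s cs (short_le _ ss); rewrite ge_min lexx => /(_ isT).
have := h2 s cs (short_le _ ss); rewrite ge_min lexx orbT => /(_ isT); lra.
Qed.

Lemma submod_sum (X : set ({i01 R} -> R)) (u : nat -> {i01 R} -> R) K (c : nat -> R) :
  GRing.submod_closed (mem X) -> (forall n, X (u n)) -> X (\sum_(i < K) c i *: u i).
Proof.
move=> [X0 XD] uX; elim: K => [|K IH]; first by rewrite big_ord0; apply/set_mem.
rewrite big_ord_recr /= addrC; apply/set_mem; apply: XD; exact/mem_set.
Qed.

Lemma ext_sum (u : nat -> {i01 R} -> R) K (c : nat -> R) :
  ext (\sum_(i < K) c i *: u i) = comb K c (fun i => ext (u i)).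
Proof. by apply/funext => t; rewrite /ext /comb fct_sumE. Qed.

End Prelim.

Theorem proposition28 (R : realType) (X : set ({i01 R} -> R))
    (f : {i01 R} -> R) (u : nat -> {i01 R} -> R) :
  closed_subspace X -> infinite_dimensional X ->
  bidual X f -> ~ X f ->
  (forall n, X (u n)) -> (sup_V2norm u < +oo)%E -> pointwise_cvg u f ->
  forall delta : R, 0 < delta -> (delta%:E < dist_V2 f X)%E ->
  forall eps : nat -> R, (forall n, 0 < eps n) ->
  exists h : nat -> {i01 R} -> R,
    [/\ convex_block u h,
        forall n m : nat, (n < m)%N ->
          [/\ (delta%:E < V2norm (h m - h n)%R)%E /\
              (V2norm (h m - h n)%R <= 2%:E * sup_V2norm u)%E,
              (supnorm (EFin \o (h m - h n)%R)
                 <= 2%:E * supnorm (osc f) + (eps n)%:E)%E /\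
              (2%:E * supnorm (osc f) + (eps n)%:E
                 <= 4%:E * supnorm (EFin \o f) + (eps n)%:E)%E &
              forall (k : nat) (I : 'I_k -> interval {i01 R}),
                interval_family I ->
                ((v2_family (h m - h n)%R I ^+ 2)%R%:E
                   <= 4%:E * mu01 f (union_family I)
                      + 32%:E * V2norm f * sqrte (mu_discrete f setT)
                      + (eps n)%:E)%E] &
        forall (k : nat) (V : set {i01 R}) (theta : R),
          open01 V -> 0 < theta -> (theta%:E < mu01 f V)%E ->
          exists (p : nat) (J : 'I_p -> interval {i01 R}) (l : nat),
            [/\ interval_family J, union_family J `<=` V, (k < l)%N &
                theta < v2_family (h l - h k) J ^+ 2]].
Proof.
move=> [XV20 Xsub _] _ [[f0 fV] _] _ uX uM uf delta delta0 hdist eps eps0.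
pose N := fine (V2norm f); have hN : V2norm f = N%:E by exact: V2norm_fine.
have N0 : 0 <= N by rewrite fine_ge0// V2norm_ge0.
pose Mu := fine (sup_V2norm u).
have uV n : (V2norm (u n) <= sup_V2norm u)%E by apply: ereal_sup_ubound; exists n.
have M0 : (0 <= sup_V2norm u)%E by apply: le_trans (uV 0%N); exact: V2norm_ge0.
have hM : sup_V2norm u = Mu%:E by rewrite fineK// ge0_fin_numE.
have Mu0 : 0 <= Mu by rewrite fine_ge0.
have osc_f := supnorm_osc_le f.
have sup_f : (supnorm (EFin \o f) <= N%:E)%E by apply: supnorm_le_V2norm; rewrite ?hN.
pose d0 := fine (supnorm (osc f)).
have hd0 : supnorm (osc f) = d0%:E.
  rewrite fineK// ge0_fin_numE ?supnorm_ge0//; apply: le_lt_trans osc_f _.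
  apply: (@le_lt_trans _ _ (2%:E * N%:E)%E); last by rewrite -EFinM ltry.
  by rewrite lee_pmul2l.
pose ep := running_min eps.
have ep0 n : 0 < ep n := running_min_gt0 eps0 n.
have ep_le i j : (i <= j)%N -> ep j <= ep i := @running_min_le R eps i j.
pose eta n := ep n / 4.
have eta0 n : 0 < eta n by have := ep0 n; rewrite /eta; lra.
have eta_le i j : (i <= j)%N -> eta j <= eta i by move=> /ep_le; rewrite /eta; lra.
have hd0' : (supnorm (osc f) <= d0%:E)%E by rewrite hd0.
have [k [C [k0 [ksac kbv] kcv kosc kmu]]] := approximating_sequence fV hd0' eta0 eta_le.
pose F := ext f; pose T := mu_real f setT; pose D := discrete_mass f.
pose eu i := ext (u i); pose ek i := ext (k i).
pose x i := eu i \- ek i.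
have ubv n s : chain 0 1 s -> qsum (eu n) s <= Mu ^+ 2.
  by move=> cs; apply: V2norm_ge cs => //; rewrite -hM.
have usac n : sq_abs_cont (eu n) by apply: V20_sq_abs_cont; exact: XV20.
have xsac n : sq_abs_cont (x n) by apply: sq_abs_cont_sub; [exact: usac|exact: ksac].
have xbv n s : chain 0 1 s -> qsum (x n) s <= 2 * Mu ^+ 2 + 2 * C.
  move=> cs; apply: le_trans (qsum_sub_le _ _ _) _.
  have := ubv n s cs; have := kbv n _ _ _ cs; rewrite /ek; lra.
have x0 n : x n 0 = 0.
  have e (g : {i01 R} -> R) : ext g 0 = g (zero01 R) := ext_val g (zero01 R).
  have [[u0 _] _] := XV20 _ (uX n).
  by rewrite /x /eu /ek /= !e k0 f0 u0 subr0.
have ucv (t : {i01 R}) e : 0 < e -> exists N, forall n, (N <= n)%N -> `|u n t - f t| < e.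
  move=> e0; have /cvgrPdist_lt /(_ e e0) [N1 _ h1] := uf t.
  by exists N1 => n /h1 /=; rewrite distrC.
have xnull t d : 0 <= t <= 1 -> 0 < d -> exists N, forall n, (N <= n)%N -> `|x n t| < d.
  move=> _ d_gt0; have d2 : 0 < d / 2 by lra.
  have [N1 h1] := ucv (clip01 t) _ d2; have [N2 h2] := kcv (clip01 t) _ d2.
  exists (maxn N1 N2) => n; rewrite geq_max => /andP[/h1 a1 /h2 a2].
  rewrite /x /eu /ek /= /ext.
  have := ler_distD (f (clip01 t)) (u n (clip01 t)) (k n (clip01 t)).
  rewrite (distrC (f (clip01 t))); lra.
have T0 : 0 <= T by exact: mu_real_ge0.
have D0 : 0 <= D by apply: fine_ge0; apply: esum_ge0 => t _; rewrite mu01_set1// lee_fin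
  mu_real_ge0.
(* For m > n, the bounds [qq n] on the squared variation of h0 n - P n are chosen so
   that replacing P m - P n by h0 m - h0 n costs at most ep n in both estimates. *)
pose B0 := 4 * T + 16 * D + eta 0%N.
have B00 : 0 < B0 by have := eta0 0%N; rewrite /B0; lra.
pose lam n := ep n / (4 * B0).
have lam0 n : 0 < lam n by rewrite divr_gt0// mulr_gt0.
have lamB n : lam n * B0 = ep n / 4 by rewrite /lam; field; rewrite gt_eqF.
have lam1 n : 0 < 1 + (lam n)^-1 by rewrite ltr_wpDr// ltW// invr_gt0.
pose q n := Num.min ((ep n / 4) ^+ 2) (ep n / (16 * (1 + (lam n)^-1))).
have q0 n : 0 < q n.
  by rewrite lt_min exprn_gt0 ?divr_gt0// mulr_gt0.
pose qq := running_min q.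
have qq0 n : 0 < qq n := running_min_gt0 q0 n.
have qq_le i j : (i <= j)%N -> qq j <= qq i := @running_min_le R q i j.
have qq1 n : qq n <= (ep n / 4) ^+ 2.
  by apply: le_trans (running_min_leq q n) _; rewrite ge_min lexx.
have qq2 n : (1 + (lam n)^-1) * (4 * qq n) <= ep n / 4.
  have : qq n <= ep n / (16 * (1 + (lam n)^-1)).
    by apply: le_trans (running_min_leq q n) _; rewrite ge_min lexx orbT.
  by rewrite ler_pdivlMr ?mulr_gt0//; lra.
have exK (nN : nat * nat) : exists Kc : nat * (nat -> R), weights nN.2 Kc.1 Kc.2 /\
    forall s, chain 0 1 s -> qsum (comb Kc.1 Kc.2 x) s <= qq nN.1.
  have [K [c hc]] := comb_small_variation nN.2 (qq0 nN.1) xsac xbv x0 xnull.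
  by exists (K, c).
have [g hg] := choice exK.
pose fix Nn (n : nat) : nat := if n is p.+1 then (g (p, Nn p)).1 else 0%N.
pose c n := (g (n, Nn n)).2.
have w n : weights (Nn n) (Nn n.+1) (c n) by have [] := hg (n, Nn n).
have rq n s : chain 0 1 s -> qsum (comb (Nn n.+1) (c n) x) s <= qq n by have [_] := hg (n, Nn
  n); apply.
have Ninc : increasing Nn by apply: increasingS => n; exact: weights_lt (w n).
have Nge n : (n <= Nn n)%N by exact: increasing_ge.
have Nlt i j n m : (n < m)%N -> (Nn n <= i < Nn n.+1)%N -> (Nn m <= j < Nn m.+1)%N ->
    (n <= i)%N /\ (i < j)%N.
  move=> nm /andP[ni iN] /andP[mj _]; split; first exact: leq_trans (Nge n) ni.
  apply: leq_trans iN (leq_trans _ mj).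
  by move: nm; rewrite leq_eqVlt => /orP[/eqP->//|/Ninc/ltnW].
pose h0 n : {i01 R} -> R := \sum_(i < Nn n.+1) c n i *: u i.
pose P n := comb (Nn n.+1) (c n) ek.
pose r n := comb (Nn n.+1) (c n) x.
have hE n : ext (h0 n) = comb (Nn n.+1) (c n) eu by exact: ext_sum.
have hPr n : ext (h0 n) = P n \+ r n.
  rewrite hE; apply/funext => t; rewrite /P /r /comb /= -big_split /=.
  by apply: eq_bigr => i _; rewrite /x /=; ring.
have hX n : X (h0 n) by exact: (submod_sum (Nn n.+1) (c n) Xsub uX).
have hcv t : ext (h0 n) t @[n --> \oo] --> F t.
  apply/cvgrPdist_le => e e0; have [N1 h1] := ucv (clip01 t) e e0.
  exists N1 => // n /= Nn1; rewrite distrC hE.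
  have [_ _ c1] := w n; rewrite (comb_sub _ _ _ c1); apply: (comb_abs (N := Nn n)) => [|i
    /andP[ni _]]; first exact: w.
  by apply: ltW; apply: h1; apply: leq_trans Nn1 (leq_trans (Nge n) ni).
have ext_sub n m : ext (h0 m - h0 n)%R = ext (h0 m) \- ext (h0 n) by [].
have r_abs n t : 0 <= t <= 1 -> `|r n t| <= ep n / 4.
  move=> /andP[t0 t1]; have := rq n [:: (0, t)]; rewrite /= lexx t0 t1 => /(_ isT).
  rewrite /qsum big_seq1 /= -/(r n) (_ : r n 0 = 0) ?subr0; last first.
    by rewrite /r /comb big1// => i _; rewrite x0 mulr0.
  move=> /le_trans/(_ (qq1 n)); have ep4 : 0 <= ep n / 4 by have := ep0 n; lra.
  by rewrite -[X in X <= _]real_normK ?num_real// ler_pXn2r ?nnegrE.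
have h_abs n m t : (n < m)%N -> 0 <= t <= 1 ->
    `|ext (h0 m) t - ext (h0 n) t| <= 2 * d0 + ep n.
  move=> nm t01; rewrite !hPr /=.
  have h1 : `|P m t - P n t| <= 2 * d0 + eta n.
    apply: (comb_comb_abs (w n) (w m)) => i j hi hj.
    have [ni ij] := Nlt i j n m nm hi hj.
    apply: le_trans (kosc i j ij (clip01 t)) _; have := eta_le n i ni; lra.
  have h2 := r_abs n t t01; have h3 := r_abs m t t01; have h4 := ep_le n m (ltnW nm).
  have -> : P m t + r m t - (P n t + r n t) = (P m t - P n t) + (r m t - r n t) by lra.
  apply: le_trans (ler_normD _ _) _; have := ler_normB (r m t) (r n t).
  have := ep0 n; rewrite /eta in h1; lra.
have h_mu n m s : (n < m)%N -> chain 0 1 s ->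
    qsum (ext (h0 m - h0 n)) s <= 4 * mu_real f (cov s) + 16 * D + ep n.
  move=> nm cs; rewrite ext_sub !hPr.
  have -> : (P m \+ r m) \- (P n \+ r n) = (P m \- P n) \+ (r m \- r n).
    by apply/funext => t /=; lra.
  apply: le_trans (qsum_add_le _ _ s (lam0 n)) _.
  have mT : mu_real f (cov s) <= T by apply: mu_real_le => //; exact: measurable_cov.
  have h1 : qsum (P m \- P n) s <= 4 * mu_real f (cov s) + 16 * D + eta n.
    apply: (comb_comb_qsum (w n) (w m)) => i j hi hj.
    have [ni ij] := Nlt i j n m nm hi hj.
    apply: le_trans (kmu i j ij s cs) _; have := eta_le n i ni; rewrite -/D; lra.
  have h2 : qsum (r m \- r n) s <= 4 * qq n.
    apply: le_trans (qsum_sub_le _ _ _) _; have := rq n s cs; have := rq m s cs.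
    have := qq_le n m (ltnW nm); rewrite -/(r n) -/(r m); lra.
  have h3 : qsum (P m \- P n) s <= B0.
    apply: le_trans h1 _; have := eta_le 0%N n (leq0n n); rewrite /B0; lra.
  have h4 := ler_wpM2l (ltW (lam0 n)) h3; have h5 := ler_wpM2l (ltW (lam1 n)) h2.
  rewrite lamB in h4; have := qq2 n; have := ep0 n; rewrite /eta in h1; lra.
have h_far n : exists K, forall m, (K <= m)%N -> (delta%:E < V2norm (h0 m - h0 n)%R)%E.
  have : (delta%:E < V2norm (f - h0 n)%R)%E.
    apply: lt_le_trans hdist _; apply: ereal_inf_lbound; exists (h0 n) => //.
  case/(V2norm_gt (ltW delta0)) => s [cs hs].
  have [|K hK] := @qsum_eventually _ (fun m => ext (h0 m) \- ext (h0 n)) (F \- ext (h0 n)) s _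
    _ hs.
    by move=> t; apply: cvgB; [exact: hcv|exact: cvg_cst].
  by exists K => m /hK H; apply: (lt_V2norm (ltW delta0) cs).
have [sg [isg hsg]] := eventually_subseq h_far.
have ep_eps n : ep (sg n) <= eps n.
  by apply: le_trans (ep_le _ _ (increasing_ge n isg)) (running_min_leq eps n).
exists (fun n => h0 (sg n)); split.
- apply: (@convex_block_of_weights _ u (Nn \o sg) (fun n => Nn (sg n).+1) (fun n => c (sg n))).
    by move=> n; exact: w.
  move=> n; change (Nn (sg n).+1 <= Nn (sg n.+1))%N; have := isg n n.+1 (ltnSn n).
  by rewrite leq_eqVlt => /orP[/eqP->//|/Ninc/ltnW].
- move=> n m nm; have snm := isg n m nm; split.
  + split; first exact: hsg.
    rewrite hM -EFinM; apply: V2norm_le => [|s cs]; first by rewrite mulr_ge0.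
    rewrite ext_sub !hE; apply: (comb_comb_qsum (w _) (w _)) => i j _ _.
    apply: le_trans (qsum_sub_le _ _ _) _; have := ubv i s cs; have := ubv j s cs.
    by rewrite exprMn -natrX; lra.
  + split; last first.
      apply: leeD2r; apply: (@le_trans _ _ (2%:E * (2%:E * supnorm (EFin \o f)))%E).
        by rewrite lee_pmul2l.
      by rewrite muleA -EFinM -natrM.
    rewrite hd0 -EFinM -EFinD; apply: ge_ereal_sup => _ [t _ <-] /=; rewrite lee_fin.
    have := h_abs _ _ (val01 t) snm; rewrite val01_ge0 val01_le1 => /(_ isT).
    rewrite !ext_val => hb; apply: le_trans hb _; have := ep_eps n; lra.
  + move=> kk I fam; have [s [E [cs E01 qs cov_s]]] := chain_of_family fam.
    set A := (@val01 R @` union_family I) in cov_s.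
    have mA : measurable (A : set (measurableTypeR R)) by exact: measurable_union.
    have -> : mu01 f (union_family I) = (mu_real f A)%:E by rewrite /mu01 mu_realE.
    rewrite mu_discreteE// hN /= -!EFinM -!EFinD lee_fin -qs.
    apply: le_trans (h_mu _ _ s snm cs) _.
    have hc : mu_real f (cov s) <= mu_real f A + D.
      apply: (@le_trans _ _ (mu_real f (A `|` [set` E]))).
        by apply: mu_real_le => //; [exact: measurable_cov|apply: measurableU => //; exact:
          measurable_seq].
      apply: le_trans (mu_realU fV mA (measurable_seq E)) _.
      by rewrite lerD2l; apply: atoms_le.
    (* The end points and the cells cost 20 D, and D is at most the square of N. *)
    have DN : D <= N * Num.sqrt D.
      have hN' : (V2norm f <= N%:E)%E by rewrite hN.
      have DT := discrete_mass_le fV; have TN := mu_real_total_le fV N0 hN'.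
      rewrite -{1}(sqr_sqrtr D0) expr2 ler_wpM2r ?sqrtr_ge0//.
      rewrite -[leRHS](ger0_norm N0) -sqrtr_sqr ler_wsqrtr//.
      exact: le_trans DT TN.
    have := ep_eps n; rewrite -/D; lra.
- move=> kk V th [U oU VU] th0 hV.
  have mU : measurable (U : set (measurableTypeR R)) by exact: open_measurable.
  have {}hV : th < mu_real f U.
    rewrite -lte_fin -(mu_realE fV)//; apply: lt_le_trans hV _.
    apply: le_outer_measure.
    by rewrite VU => _ [t Ut <-].
  pose th' := (th + mu_real f U) / 2.
  have [th1 th2] : th < th' /\ th' < mu_real f U by rewrite /th'; split; lra.
  (* The chain for th' is so fine that h0 (sg kk) hardly moves along it. *)
  pose la := (th' - th) / (2 * th).
  have la0 : 0 < la by rewrite divr_gt0 ?mulr_gt0//; lra.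
  have la_th : (1 + la) * th = (th + th') / 2 by rewrite /la; field; rewrite gt_eqF.
  have la1 : 0 < 1 + la^-1 by rewrite ltr_wpDr// ltW// invr_gt0.
  pose et := (th' - th) / 4 / (1 + la^-1).
  have et0 : 0 < et by rewrite !divr_gt0//; lra.
  have hsac : sq_abs_cont (ext (h0 (sg kk))) by rewrite hE; apply: sq_abs_cont_comb (w _) usac.
  have [d d_gt0 hd] := hsac et et0.
  have [s [cs ss sU qs]] := open_chain fV oU d_gt0 th2.
  have hk := hd s cs ss.
  have hfk : th < qsum (F \- ext (h0 (sg kk))) s.
    have := qsum_add_le (F \- ext (h0 (sg kk))) (ext (h0 (sg kk))) s la0.
    have -> : (F \- ext (h0 (sg kk))) \+ ext (h0 (sg kk)) = F by apply/funext => t /=; lra.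
    move=> ha; have hb := ler_wpM2l (ltW la1) hk.
    have ee : (1 + la^-1) * et = (th' - th) / 4 by rewrite mulrC /et divfK ?gt_eqF.
    rewrite ee in hb.
    have la10 : 0 < 1 + la by lra.
    rewrite -(ltr_pM2l la10) la_th; lra.
  have [|K hK] := @qsum_eventually _ (fun m => ext (h0 m) \- ext (h0 (sg kk))) (F \- ext (h0
    (sg kk))) s _ _ hfk.
    by move=> t; apply: cvgB; [exact: hcv|exact: cvg_cst].
  pose l := maxn kk.+1 K.
  have Kl : (K <= sg l)%N by apply: leq_trans (increasing_ge _ isg); rewrite leq_maxr.
  have [p [J [famJ qJ uJ]]] := family_of_chain cs.
  exists p, J, l; split => //.
  + move=> t /uJ [I Is It]; rewrite VU; exact: (sU I Is _ It).
  + by rewrite leq_maxl.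
  + by rewrite qJ; exact: hK.
Qed.
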